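(* If Schinzel's hypothesis (H) is true, then $\overline{\mathfrak{X}(\mathbb{Z})}=L$, where the closure is taken inside $\prod_v\mathfrak{X}(\mathbb{Z}_v)$ with respect to the topology described below.
   Context: Let $k\geq3$ be an odd integer and $m\in\mathbb{Z}\setminus\{0\}$. Let $\mathfrak{X}:=\operatorname{Spec}\mathbb{Z}[X,Y,Z]/(X^2+Y^2+Z^k-m)$ and $\mathfrak{X}_\mathbb{Q}:=\mathfrak{X}\otimes_\mathbb{Z}\mathbb{Q}$. For a place $v$ of $\mathbb{Q}$ let $\mathbb{Z}_v$ be the $v$-adic integers (and $\mathbb{Z}_\infty:=\mathbb{R}$). Topology: on $\mathbb{Q}_v^3$ the first two coordinates (those of $X$ and $Y$) carry the trivial (indiscrete) topology and the third coordinate (that of $Z$) carries the usual topology of $\mathbb{Q}_v$; the sets $\mathfrak{X}(\mathbb{Z}_v)$ and $\prod_v\mathfrak{X}(\mathbb{Z}_v)$ get the induced (product) topologies. (So the statement is strong approximation ''at $Z$'' away from $\infty$.) Azumaya algebras: for integers $a,b>0$ and $n$ with $k=ab$ and $m=n^a$, the variety $\mathfrak{X}_\mathbb{Q}$ (given by $x^2+y^2+z^{ab}=n^a$) is covered by $U_1:=D(n-Z^b)$ and $U_2:=D(n^{a-1}+n^{a-2}Z^b+\dots+Z^{(a-1)b})$. Let $A$ be the Azumaya algebra on $\mathfrak{X}_\mathbb{Q}$ obtained by gluing the quaternion algebra $\left(\frac{n-Z^b,\,-1}{\mathcal O(U_1)}\right)$ on $U_1$ and $\left(\frac{n^{a-1}+\dots+Z^{(a-1)b},\,-1}{\mathcal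 O(U_2)}\right)$ on $U_2$ (via $i\mapsto (Xi'+Yi'j')/(n^{a-1}+\dots+Z^{(a-1)b})$, $j\mapsto j'$). Let $\operatorname{inv}_v:\operatorname{Br}(\mathbb{Q}_v)\to\mathbb{Q}/\mathbb{Z}$ be the local invariant map, and define $S(a,b,n):=\{(P_v)_v\in\prod_v\mathfrak{X}(\mathbb{Z}_v)\mid \sum_v\operatorname{inv}_v(A(P_v))=0\}$. Let $L:=\bigcap S(a,b,n)$, the intersection over all integers $a,b,n$ with $a,b>0$, $k=ab$, $m=n^a$. (One has $\mathfrak{X}(\mathbb{Z})\subseteq L$.) Schinzel's hypothesis (H): if $f_1,\dots,f_s\in\mathbb{Z}[X]$ are irreducible in $\mathbb{Q}[X]$, $\gcd\{f_1(x)\cdots f_s(x)\mid x\in\mathbb{Z}\}=1$ and $f_i(x)\to\infty$ as $x\to\infty$ for each $i$, then there is $x\in\mathbb{Z}$ with all $f_i(x)$ prime.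
   Formalization: At the real place the third coordinate carries the trivial instead of the usual topology (approximation away from ∞); with the usual topology of ℝ the claim fails, e.g. for k=3, m=1, replacing the real component of (1,0,0) by a real point with Z=−1/2. *)

(* Defs.v *)
From HB Require Import structures.
From mathcomp Require Import all_boot all_order all_algebra all_field.
From mathcomp Require Import all_classical all_reals all_analysis.
From mathcomp Require Import ring.

Set Implicit Arguments.
Unset Strict Implicit.
Unset Printing Implicit Defensive.

Import Order.TTheory GRing.Theory Num.Theory.

Local Open Scope classical_set_scope.
Local Open Scope ring_scope.

(** * Schinzel's hypothesis (H) *)

(* The gcd of an infinite set of integers is 1 iff 1 is its only common
   divisor in nat. *)
Definition schinzel_hypothesis : Prop :=
  forall (s : nat) (f : 'I_s -> {poly int}),
    (forall i, irreducible_poly (map_poly (intr : int -> rat) (f i))) ->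
    (forall d : nat,
       (forall x : int, (d%:Z %| \prod_(i < s) (f i).[x])%Z) -> d = 1%N) ->
    (forall i (M : int), exists N : int,
       forall x : int, N <= x -> M <= (f i).[x]) ->
    exists x : int, forall i, exists2 q : nat, prime q & (f i).[x] = q%:Z.

(** * The p-adic integers Z_p = lim Z/p^n and their fraction field Q_p *)

Record prime_nat := PrimeNat { prime_val :> nat; prime_valP : prime prime_val }.
HB.instance Definition _ := [isSub for prime_val].
HB.instance Definition _ := [Choice of prime_nat by <:].

Lemma modz_dvdm (m d e : int) : (e %| d)%Z -> ((m %% d)%Z = m %[mod e])%Z.
Proof.
by case/dvdzP=> q ->; rewrite [in RHS](divz_eq m (q * e)) mulrA modzMDl.
Qed.

Section PadicInt.
Variable p : prime_nat.

Let ppow (n : nat) : int := (p ^ n)%N%:Z.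

(* The n-th term is the representative in [0, p^n) of the class mod p^n. *)
Record padic_int := PadicInt {
  padic_seq :> nat -> int;
  padic_seqP : forall n, padic_seq n = (padic_seq n.+1 %% (p ^ n)%N%:Z)%Z }.

HB.instance Definition _ := gen_eqMixin padic_int.
HB.instance Definition _ := gen_choiceMixin padic_int.

Lemma padic_int_inj (x y : padic_int) : padic_seq x =1 padic_seq y -> x = y.
Proof.
case: x y => [x xP] [y yP] /= /funext exy; case: _ / exy in yP *.
by congr PadicInt; apply: Prop_irrelevance.
Qed.

Lemma ppow_dvd n : (ppow n %| ppow n.+1)%Z.
Proof. by rewrite dvdzE /= dvdn_exp2l. Qed.

Fact padic_mk_subproof (f : nat -> int) :
  (forall n, (f n = f n.+1 %[mod ppow n])%Z) ->
  forall n, (f n %% ppow n)%Z = ((f n.+1 %% ppow n.+1)%Z %% ppow n)%Z.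
Proof. by move=> fP n; rewrite fP modz_dvdm ?ppow_dvd. Qed.

Definition padic_mk f fP := PadicInt (@padic_mk_subproof f fP).

Lemma padic_seq_mod (x : padic_int) n : (x n = x n.+1 %[mod ppow n])%Z.
Proof. by rewrite [in LHS](padic_seqP x) modz_mod. Qed.

Lemma padic_seq_small (x : padic_int) n : (x n %% ppow n)%Z = x n.
Proof. by rewrite [in LHS](padic_seqP x) modz_mod -padic_seqP. Qed.

Fact padic_cst_subproof (c : int) n : (c = c %[mod ppow n])%Z.
Proof. by []. Qed.
Fact padic_add_subproof (x y : padic_int) n :
  (x n + y n = x n.+1 + y n.+1 %[mod ppow n])%Z.
Proof. by rewrite -modzDm !(padic_seq_mod _ n) modzDm. Qed.
Fact padic_opp_subproof (x : padic_int) n : (- x n = - x n.+1 %[mod ppow n])%Z.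
Proof. by rewrite -modzNm padic_seq_mod modzNm. Qed.
Fact padic_mul_subproof (x y : padic_int) n :
  (x n * y n = x n.+1 * y n.+1 %[mod ppow n])%Z.
Proof. by rewrite -modzMm !(padic_seq_mod _ n) modzMm. Qed.

Definition padic_cst c := padic_mk (padic_cst_subproof c).
Definition padic_add x y := padic_mk (padic_add_subproof x y).
Definition padic_opp x := padic_mk (padic_opp_subproof x).
Definition padic_mul x y := padic_mk (padic_mul_subproof x y).

Fact padic_addA : associative padic_add.
Proof. by move=> x y z; apply: padic_int_inj => n /=; rewrite modzDml modzDmr addrA. Qed.
Fact padic_addC : commutative padic_add.
Proof. by move=> x y; apply: padic_int_inj => n /=; rewrite addrC. Qed.
Fact padic_add0 : left_id (padic_cst 0) padic_add.
Proof.
by move=> x; apply: padic_int_inj => n /=; rewrite modzDml add0r padic_seq_small.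
Qed.
Fact padic_addN : left_inverse (padic_cst 0) padic_opp padic_add.
Proof. by move=> x; apply: padic_int_inj => n /=; rewrite modzDml addNr. Qed.
HB.instance Definition _ :=
  GRing.isZmodule.Build padic_int padic_addA padic_addC padic_add0 padic_addN.

Fact padic_mulA : associative padic_mul.
Proof. by move=> x y z; apply: padic_int_inj => n /=; rewrite modzMml modzMmr mulrA. Qed.
Fact padic_mulC : commutative padic_mul.
Proof. by move=> x y; apply: padic_int_inj => n /=; rewrite mulrC. Qed.
Fact padic_mul1 : left_id (padic_cst 1) padic_mul.
Proof.
by move=> x; apply: padic_int_inj => n /=; rewrite modzMml mul1r padic_seq_small.
Qed.
Fact padic_mulD : left_distributive padic_mul padic_add.
Proof.
by move=> x y z; apply: padic_int_inj => n /=; rewrite modzMml modzDm mulrDl.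
Qed.
Fact padic_1_neq0 : padic_cst 1 != 0.
Proof.
apply/eqP => /(congr1 (fun x : padic_int => x 1%N)) /=.
by rewrite mod0z modz_small //= ltz_nat prime_gt1 ?prime_valP.
Qed.
HB.instance Definition _ := GRing.Zmodule_isComNzRing.Build padic_int
  padic_mulA padic_mulC padic_mul1 padic_mulD padic_1_neq0.

Definition padic_unit : pred padic_int := fun x => `[< exists y, y * x = 1 >].
Definition padic_inv (x : padic_int) := xget x [set y | y * x = 1].

Fact padic_mulV : {in padic_unit, left_inverse 1 padic_inv *%R}.
Proof.
by move=> x /asboolP ux; rewrite /padic_inv; case: xgetP => // nP; case: ux => y /nP.
Qed.
Fact padic_unitP (x y : padic_int) : y * x = 1 -> padic_unit x.
Proof. by move=> yx; apply/asboolP; exists y. Qed.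
Fact padic_inv_out : {in [predC padic_unit], padic_inv =1 id}.
Proof.
move=> x /negP ux; rewrite /padic_inv; case: xgetP => // y _ /= yx.
by case: ux; exact: padic_unitP yx.
Qed.
HB.instance Definition _ := GRing.ComNzRing_hasMulInverse.Build padic_int
  padic_mulV padic_unitP padic_inv_out.

Lemma padic_seq_dvd (x : padic_int) m n : (m <= n)%N ->
  (ppow m %| x n)%Z -> x m = 0.
Proof.
move=> /subnKC <-; elim: (n - m)%N => [|d IHd].
  by rewrite addn0 => /dvdz_mod0P; rewrite padic_seq_small.
rewrite addnS => dvdx; apply: IHd; rewrite (padic_seqP x).
apply/dvdz_mod0P; rewrite modz_dvdm; first exact/dvdz_mod0P.
by rewrite dvdzE /= dvdn_exp2l ?leq_addr.
Qed.

Fact padic_idomain (x y : padic_int) : x * y = 0 -> (x == 0) || (y == 0).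
Proof.
move=> xy0; apply/orP; apply: contrapT => /not_orP[/negP x0 /negP y0].
have nz (z : padic_int) : z != 0 -> exists i, z i != 0.
  move=> z0; apply: contrapT => /forallNP zi; case/eqP: z0.
  apply: padic_int_inj => n /=; rewrite mod0z.
  by apply/eqP; have /negP := zi n; rewrite negbK.
have [[i xi] [j yj]] := (nz _ x0, nz _ y0).
have : (ppow (i + j) %| x (i + j)%N * y (i + j)%N)%Z.
  by apply/dvdz_mod0P; rewrite -[LHS]/((x * y) (i + j)%N) xy0 /= mod0z.
have pP := prime_valP p.
have ndvd (z : padic_int) l : z l != 0 -> (l <= i + j)%N ->
    (0 < `|z (i + j)|)%N && (logn p `|z (i + j)| < l)%N.
  move=> zl lij; have ndv : ~~ (ppow l %| z (i + j)%N)%Z.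
    by apply: contra zl => /(padic_seq_dvd lij)->.
  have zn0 : (0 < `|z (i + j)|)%N.
    by rewrite absz_gt0; apply: contraNneq ndv => ->; rewrite dvdz0.
  by rewrite zn0 ltnNge -pfactor_dvdn.
have /andP[xn0 lx] := ndvd _ _ xi (leq_addr _ _).
have /andP[yn0 ly] := ndvd _ _ yj (leq_addl _ _).
rewrite dvdzE abszM /= pfactor_dvdn ?muln_gt0 ?xn0 //.
by rewrite lognM // leqNgt -addnS leq_add // ltnW.
Qed.
HB.instance Definition _ :=
  GRing.ComUnitRing_isIntegral.Build padic_int padic_idomain.

Definition padic := {fraction padic_int}.
HB.instance Definition _ := GRing.Field.on padic.

(* A basis of neighbourhoods of x for the p-adic topology: x + p^n Z_p. *)
Definition padic_nbhs (x : padic) : set_system padic :=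
  filter_from [set: nat] (fun n =>
    [set y | exists t : padic_int, y = x + p%:R ^+ n * tofrac t]).

HB.instance Definition _ := hasNbhs.Build padic padic_nbhs.

Fact padic_nbhs_filter (x : padic) : ProperFilter (nbhs x).
Proof.
apply: filter_from_proper; last first.
  by move=> n _; exists x; exists 0; rewrite rmorph0 mulr0 addr0.
apply: filter_from_filter; first by exists 0%N.
move=> i j _ _; exists (i + j)%N => // y [t ->]; split.
  by exists (p%:R ^+ j * t); rewrite rmorphM rmorphXn rmorph_nat exprD mulrA.
exists (p%:R ^+ i * t).
by rewrite rmorphM rmorphXn rmorph_nat addnC exprD mulrA.
Qed.
Fact padic_nbhs_singleton (x : padic) (A : set padic) : nbhs x A -> A x.
Proof. by case=> n _; apply; exists 0; rewrite rmorph0 mulr0 addr0. Qed.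
Fact padic_nbhs_nbhs (x : padic) (A : set padic) :
  nbhs x A -> nbhs x (nbhs^~ A).
Proof.
case=> n _ sA; exists n => // _ [t ->]; exists n => // _ [u ->].
by apply: sA; exists (t + u); rewrite rmorphD mulrDr addrA.
Qed.
HB.instance Definition _ := Nbhs_isNbhsTopological.Build padic
  padic_nbhs_filter padic_nbhs_singleton padic_nbhs_nbhs.

Definition padic_valuation (c : padic) (e : int) : Prop :=
  exists2 u : padic_int, u \is a GRing.unit & c = p%:R ^ e * tofrac u.

End PadicInt.

(** * Places of Q and the local rings and fields *)

Variant place := Infinite | Finite of prime_nat.
HB.instance Definition _ := gen_eqMixin place.
HB.instance Definition _ := gen_choiceMixin place.

Section Local.
Variable R : realType.

Definition local_field (v : place) : fieldType :=
  match v with Infinite => R | Finite p => padic p end.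

Definition local_ring (v : place) : comNzRingType :=
  match v with Infinite => R | Finite p => padic_int p end.

Definition local_incl (v : place) : {rmorphism local_ring v -> local_field v} :=
  match v return {rmorphism local_ring v -> local_field v} with
  | Infinite => idfun
  | Finite p => @tofrac (padic_int p)
  end.

End Local.

(** * Quaternion algebras *)

Section Quaternion.
Variable K : fieldType.

(* The quaternion algebra (a, b / K): the coordinates are those on the basis
   1, i, j, ij, with i^2 = a, j^2 = b and ji = - ij. *)
Definition quaternion (a b : K) : Type := 'rV[K]_4.

Variables a b : K.
Local Notation Q := (quaternion a b).
HB.instance Definition _ := Vector.on Q.

Definition quat (x0 x1 x2 x3 : K) : Q :=
  \row_(i < 4) nth 0 [:: x0; x1; x2; x3] i.

Definition quat_i : Q := quat 0 1 0 0.
Definition quat_j : Q := quat 0 0 1 0.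

Definition quat_one : Q := quat 1 0 0 0.
Definition quat_mul (x y : Q) : Q :=
  quat (x 0 0 * y 0 0 + a * (x 0 1 * y 0 1) + b * (x 0 2 * y 0 2)
          - a * b * (x 0 3 * y 0 3))
       (x 0 0 * y 0 1 + x 0 1 * y 0 0 - b * (x 0 2 * y 0 3)
          + b * (x 0 3 * y 0 2))
       (x 0 0 * y 0 2 + x 0 2 * y 0 0 + a * (x 0 1 * y 0 3)
          - a * (x 0 3 * y 0 1))
       (x 0 0 * y 0 3 + x 0 3 * y 0 0 + x 0 1 * y 0 2 - x 0 2 * y 0 1).

Lemma quatE x0 x1 x2 x3 : let q := quat x0 x1 x2 x3 in
  (q 0 0 = x0) * (q 0 1 = x1) * (q 0 2 = x2) * (q 0 3 = x3).
Proof. by rewrite /= !mxE. Qed.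

Lemma quat_eqP (x y : Q) : x 0 0 = y 0 0 -> x 0 1 = y 0 1 ->
  x 0 2 = y 0 2 -> x 0 3 = y 0 3 -> x = y.
Proof.
move=> e0 e1 e2 e3; apply/rowP => -[[|[|[|[|i]]]] // lti].
- by rewrite (_ : Ordinal lti = 0) //; apply: val_inj.
- by rewrite (_ : Ordinal lti = 1) //; apply: val_inj.
- by rewrite (_ : Ordinal lti = 2) //; apply: val_inj.
- by rewrite (_ : Ordinal lti = 3) //; apply: val_inj.
Qed.

Fact quat_mulA : associative quat_mul.
Proof. by move=> x y z; apply: quat_eqP; rewrite !quatE; ring. Qed.
Fact quat_mul1 : left_id quat_one quat_mul.
Proof. by move=> x; apply: quat_eqP; rewrite !quatE; ring. Qed.
Fact quat_mulr1 : right_id quat_one quat_mul.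
Proof. by move=> x; apply: quat_eqP; rewrite !quatE; ring. Qed.
Fact quat_mulDl : left_distributive quat_mul +%R.
Proof. by move=> x y z; apply: quat_eqP; rewrite !(quatE, mxE); ring. Qed.
Fact quat_mulDr : right_distributive quat_mul +%R.
Proof. by move=> x y z; apply: quat_eqP; rewrite !(quatE, mxE); ring. Qed.
Fact quat_1_neq0 : quat_one != 0.
Proof.
by apply/eqP => /rowP/(_ 0) /eqP; rewrite !mxE /= oner_eq0.
Qed.
HB.instance Definition _ := GRing.Zmodule_isNzRing.Build Q
  quat_mulA quat_mul1 quat_mulr1 quat_mulDl quat_mulDr quat_1_neq0.

Fact quat_scaleAl (c : K) (x y : Q) : c *: (x * y) = c *: x * y.
Proof. by apply: quat_eqP; rewrite !(quatE, mxE) /=; ring. Qed.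
HB.instance Definition _ := GRing.Lmodule_isLalgebra.Build K Q quat_scaleAl.
Fact quat_scaleAr (c : K) (x y : Q) : c *: (x * y) = x * (c *: y).
Proof. by apply: quat_eqP; rewrite !(quatE, mxE) /=; ring. Qed.
HB.instance Definition _ := GRing.Lalgebra_isAlgebra.Build K Q quat_scaleAr.
HB.instance Definition _ := Algebra_isFalgebra.Build K Q.

End Quaternion.

Lemma quat_gluing (K : fieldType) (f h x y : K) :
    f != 0 -> h != 0 -> f * h = x ^+ 2 + y ^+ 2 ->
  let i' := quat_i h (- 1) in let j' := quat_j h (- 1) in
  exists phi : {lrmorphism quaternion f (- 1) -> quaternion h (- 1)},
    [/\ bijective phi, phi (quat_i _ _) = h^-1 *: (x *: i' + y *: (i' * j')) &
        phi (quat_j _ _) = j'].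
Proof.
move=> f0 h0 fh i' j'.
pose Q1 := quaternion f (- 1); pose Q2 := quaternion h (- 1).
pose F (q : Q1) : Q2 := quat h (- 1) (q 0 0)
  ((x * q 0 1 - y * q 0 3) / h) (q 0 2) ((y * q 0 1 + x * q 0 3) / h).
pose G (q : Q2) : Q1 := quat f (- 1) (q 0 0)
  ((x * q 0 1 + y * q 0 3) / f) (q 0 2) ((x * q 0 3 - y * q 0 1) / f).
have linF : linear F.
  by move=> c u v; apply: quat_eqP; rewrite !(quatE, mxE) /=; ring.
have mulF : monoid_morphism F.
  split; first by apply: quat_eqP; rewrite !(quatE, mxE) /=; ring.
  by move=> u v; apply: quat_eqP; rewrite !(quatE, mxE) /=; field: fh.
pose LF := GRing.isLinear.Build K Q1 Q2 *:%R F linF.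
pose MF := GRing.isMonoidMorphism.Build Q1 Q2 F mulF.
pose phi : {lrmorphism Q1 -> Q2} := HB.pack F LF MF.
exists phi; split.
- exists G => q; apply: quat_eqP; rewrite !(quatE, mxE) /=;
    by field: fh; rewrite ?f0 ?h0.
- by apply: quat_eqP; rewrite !(quatE, mxE) /=; field.
- by apply: quat_eqP; rewrite !(quatE, mxE) /=; field.
Qed.

(** * The invariant maps of local fields *)

(* The predicate underlying Num.int : the integers as a subgroup of rat. *)
Definition Zrat : zmodClosed rat := (Num.int_num_subdef : {pred rat}).
Definition QmodZ := Quotient.quot Zrat.
HB.instance Definition _ := GRing.Zmodule.on QmodZ.
Definition QmodZ_of (q : rat) : QmodZ := (\pi_(QmodZ) q)%qT.

Section PadicInvariant.
Variable p : prime_nat.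

Section Extension.
Variable K : fieldExtType (padic p).

(* Membership in the ring of integers O_K, the integral closure of Z_p. *)
Definition padic_integral (x : K) : Prop :=
  integralOver (fun t : padic_int p => (tofrac t)%:A : K) x.

(* The ramification index is 1, i.e., p is a uniformizer of K. *)
Definition unramified : Prop :=
  forall x : K, x != 0 -> exists e : int, exists w : K,
    [/\ padic_integral w, padic_integral w^-1 & x = p%:R ^ e * w].

(* s induces the map x |-> x^p on the residue field of K. *)
Definition is_frobenius (s : K -> K) : Prop :=
  forall x, padic_integral x ->
    exists2 t, padic_integral t & s x - x ^+ p = p%:R * t.

End Extension.

(* A central simple algebra B of degree n over Q_p contains the unramified
   extension K of Q_p of degree n; if conjugation by a unit u of B induces the
   Frobenius automorphism on K, then u^n is in Q_p and the invariant of B is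
   the class of v_p(u^n) / n. *)
Definition is_padic_invariant (B : falgType (padic p)) (q : QmodZ) : Prop :=
  exists (n : nat) (K : fieldExtType (padic p)) (s : {lrmorphism K -> K})
         (iota : {lrmorphism K -> B}) (u : B) (c : padic p) (e : int),
    [/\ (0 < n)%N, \dim {: B} = (n ^ 2)%N & \dim {: K} = n] /\
    [/\ unramified K, is_frobenius s, (forall x, u * iota x = iota (s x) * u),
        u ^+ n = c%:A & padic_valuation c e] /\
    q = QmodZ_of (e%:~R / n%:R).

Definition padic_invariant (B : falgType (padic p)) : QmodZ :=
  xget 0 [set q | is_padic_invariant B q].

End PadicInvariant.

Definition split_algebra (K : fieldType) (B : falgType K) : Prop :=
  exists n (f : {lrmorphism B -> 'M[K]_n.+1}), bijective f.

(* The Brauer group of R has order 2. *)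
Definition real_invariant (R : realType) (B : falgType R) : QmodZ :=
  if `[< split_algebra B >] then 0 else QmodZ_of (1 / 2).

Definition local_invariant (R : realType) (v : place) :
    falgType (local_field R v) -> QmodZ :=
  match v return falgType (local_field R v) -> QmodZ with
  | Infinite => @real_invariant R
  | Finite p => @padic_invariant p
  end.

(** * The affine surface x^2 + y^2 + z^k = m *)

Section Points.
Variables (k : nat) (m : int).

Definition points (S : comNzRingType) : Type :=
  {P : S * S * S | P.1.1 ^+ 2 + P.1.2 ^+ 2 + P.2 ^+ k == m%:~R}.
HB.instance Definition _ S := Choice.on (points S).

Definition xcoord S (P : points S) : S := (val P).1.1.
Definition ycoord S (P : points S) : S := (val P).1.2.
Definition zcoord S (P : points S) : S := (val P).2.

Lemma pointsP S (P : points S) :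
  xcoord P ^+ 2 + ycoord P ^+ 2 + zcoord P ^+ k = m%:~R.
Proof. exact/eqP/(valP P). Qed.

Fact points_map_subproof (S T : comNzRingType) (f : {rmorphism S -> T})
    (P : points S) :
  f (xcoord P) ^+ 2 + f (ycoord P) ^+ 2 + f (zcoord P) ^+ k == m%:~R.
Proof.
have /(congr1 f) := pointsP P.
by rewrite !rmorphD !rmorphXn rmorph_int => <-.
Qed.

Definition points_map (S T : comNzRingType) (f : {rmorphism S -> T})
    (P : points S) : points T :=
  Sub (f (xcoord P), f (ycoord P), f (zcoord P)) (points_map_subproof f P).

End Points.

(** * The Azumaya algebra A attached to k = ab and m = n^a *)

Section Azumaya.
Variables (K : fieldType) (a b : nat) (n : int).

Definition chart1 (z : K) : K := n%:~R - z ^+ b.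
Definition chart2 (z : K) : K :=
  \sum_(i < a) n%:~R ^+ (a.-1 - i) * z ^+ (b * i).

(* The fibre A(P): it is (n - z^b, -1) if P is in U_1, and it is given by the
   chart on U_2 otherwise. On the overlap, both charts give isomorphic fibres,
   see azumaya_gluing. *)
Definition azumaya_fibre (k : nat) (m : int) (P : points k m K) : falgType K :=
  if chart1 (zcoord P) != 0
  then (quaternion (chart1 (zcoord P)) (- 1) : falgType K)
  else quaternion (chart2 (zcoord P)) (- 1).

Lemma chart12 z : chart1 z * chart2 z = n%:~R ^+ a - z ^+ (a * b).
Proof.
rewrite mulnC exprM subrXX /chart1 /chart2; apply: congr1.
by apply: eq_bigr => i _; rewrite exprM.
Qed.

Lemma azumaya_gluing (P : points (a * b) (n ^+ a) K) :
    chart1 (zcoord P) != 0 -> chart2 (zcoord P) != 0 ->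
  let h := chart2 (zcoord P) in
  let i' := quat_i h (- 1) in let j' := quat_j h (- 1) in
  exists phi : {lrmorphism quaternion (chart1 (zcoord P)) (- 1) ->
                           quaternion h (- 1)},
    [/\ bijective phi,
        phi (quat_i _ _) = h^-1 *: (xcoord P *: i' + ycoord P *: (i' * j')) &
        phi (quat_j _ _) = j'].
Proof.
move=> f0 h0; apply: quat_gluing => //; rewrite chart12.
by have := pointsP P; rewrite rmorphXn => <-; rewrite addrK.
Qed.

End Azumaya.

(** * Adelic points and the Brauer-Manin set *)

Definition indiscrete (T : Type) : Type := T.
Section Indiscrete.
Variable T : choiceType.
HB.instance Definition _ := Choice.on (indiscrete T).
Let op : set_system (indiscrete T) := [set A | A = set0 \/ A = setT].
Fact indiscreteT : op setT. Proof. by right. Qed.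
Fact indiscreteI : setI_closed op.
Proof.
move=> A B [->|->] [->|->]; rewrite ?set0I ?setI0 ?setIT; by [left|right].
Qed.
Fact indiscrete_bigU (I : Type) (f : I -> set (indiscrete T)) :
  (forall i, op (f i)) -> op (\bigcup_i f i).
Proof.
move=> opf; have [[i fi]|nf] := pselect (exists i, f i = setT).
  by right; rewrite eqEsubset; split=> // x _; exists i => //; rewrite fi.
left; rewrite bigcup0 // => i _; case: (opf i) => // fi.
by case: nf; exists i.
Qed.
HB.instance Definition _ := isOpenTopological.Build (indiscrete T)
  indiscreteT indiscreteI indiscrete_bigU.
End Indiscrete.

Section Adelic.
Variables (R : realType) (k : nat) (m : int).

(* Approximation is at Z and away from the infinite place: R^3 as a whole is
   indiscrete. With the usual topology on the Z-coordinate in R, the image of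
   the integral points would have no limit point with a real Z-coordinate
   outside of the integers, whereas brauer_manin_set never constrains the real
   component of a point, as k is odd. *)
Definition zspace (v : place) : topologicalType :=
  match v with Infinite => indiscrete R | Finite p => padic p end.

Definition to_zspace (v : place) : local_field R v -> zspace v :=
  match v return local_field R v -> zspace v with
  | Infinite => id
  | Finite p => id
  end.

Definition affine_space (v : place) : topologicalType :=
  (indiscrete (local_field R v) * indiscrete (local_field R v) * zspace v)%type.

Definition to_affine_space (v : place) (P : points k m (local_ring R v)) :
    affine_space v :=
  (local_incl R v (xcoord P), local_incl R v (ycoord P),
   to_zspace (local_incl R v (zcoord P))).

Definition local_points (v : place) : topologicalType :=
  initial_topology (@to_affine_space v).

Definition adelic_points : topologicalType := prod_topology local_points.

Definition integral_to_adelic (P : points k m int) : adelic_points :=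
  fun v => points_map (intr : {rmorphism int -> local_ring R v}) P.

Definition invariant_at (a b : nat) (n : int) (P : adelic_points) (v : place) :
    QmodZ :=
  local_invariant
    (azumaya_fibre a b n (points_map (local_incl R v) (P v))).

(* The sum over the infinite set of all places is meaningful (and not just the
   default value 0) as invariant_at a b n P v = 0 for all v not dividing
   2 * a * m, whenever m = n ^+ a is nonzero and k = a * b. *)
Definition brauer_set (a b : nat) (n : int) : set adelic_points :=
  [set P | \sum_(v \in [set: place]) invariant_at a b n P v = 0].

Definition brauer_manin_set : set adelic_points :=
  [set P | forall (a b : nat) (n : int), (0 < a)%N -> (0 < b)%N ->
     k = (a * b)%N -> m = n ^+ a -> brauer_set a b n P].

End Adelic.

Arguments integral_to_adelic : clear implicits.
Arguments brauer_manin_set : clear implicits.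

(* Main.v *)
Require Import Defs.
From HB Require Import structures.
From mathcomp Require Import all_boot all_order all_algebra all_solvable all_field.
From mathcomp Require Import all_classical all_reals all_analysis.
From mathcomp Require Import zify ring lra.

Set Implicit Arguments.
Unset Strict Implicit.
Unset Printing Implicit Defensive.

Import Order.TTheory GRing.Theory Num.Theory.

Local Open Scope ring_scope.

(** The invariant at p of the quaternion algebra (c, -1) is 0 or 1/2 according to
    the Hilbert symbol (c, -1)_p, it vanishes at real points as k is odd, and it
    is locally constant along the surface. Hence each S(a, b, n) is closed, and
    it contains the integral points by reciprocity.

    Conversely, write m = n^a and k = ab with a maximal. Then
    m - z^k = prod_(d | a) f_d(z) where f_d is, up to sign, the homogenized d-th
    cyclotomic polynomial in z^b and n, irreducible over Q because n is not a
    proper power with exponent dividing b. The conditions S(a/e, be, n^e) for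
    e | a say that the invariants of (prod_(d | e) f_d(z), -1) sum to 0, hence so
    do those of each (f_d(z), -1). Take an integer z0 close to the given
    z-coordinates at all p <= B. Hypothesis (H) provides z = z0 - M t such that
    every f_d(z) is a prime q_d times primes at most B. By reciprocity q_d is not
    3 mod 4, so the positive integer m - z^k has even valuation at every prime
    that is 3 mod 4 and is a sum of two squares.

    The invariant of (c, -1) is computed in two steps: a central simple algebra
    of dimension 4 has invariant 1/2 or 0 according to whether it is a division
    algebra, and the required embedding of the unramified quadratic extension,
    generated by a square root of -1 if p = 3 mod 4 and by a cube root of unity
    if p = 2, is written down explicitly. *)

(** * Sums of two squares and the symbol (a, -1)_p *)

(** Three obstacles shape the details. Invariants are defined through an existential choice, so
    their values have to be shown to be forced; deciding whether the algebra has zero divisors does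
    this for all presentations at once, and it later makes the symbol on Z_p well defined. Next, n -
    z^b or even m - z^k may vanish at a local point. The cofactor of n - z^b is a n^(a-1) modulo n -
    z^b, so one of the two charts is always nonzero; and a zero of m - z^k is first moved slightly,
    to a z where m - z^k is nonzero with trivial symbol, before integers are brought in. Finally,
    (H) requires polynomials without fixed divisor. The part of f_d(z0) supported on the primes up
    to B is divided out of f_d(z0 - M X), which settles the primes up to B; a larger prime q is
    prime to M, so z = 0 mod q is possible, and q would then divide m. The bound B is at least 2 a
    |m|, beyond which all invariants vanish. Since X and Y carry the indiscrete topology, any
    representation of m - z^k as a sum of two squares will do. *)

Lemma Fp_int_eq0 (p : nat) (a : int) : prime p ->
  ((a%:~R : 'F_p) == 0) = (p %| a)%Z.
Proof. by move=> pP; rewrite (dvdz_pcharf (pchar_Fp pP)). Qed.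

Lemma Fp_intE (p : nat) (x : 'F_p) : x = (nat_of_ord x)%:Z%:~R.
Proof. by rewrite -[LHS]natr_Zp. Qed.

Lemma Fp_expf (p : nat) (x : 'F_p) : prime p -> x != 0 -> x ^+ p.-1 = 1.
Proof.
move=> pP x0; apply: (mulfI x0); rewrite -exprS prednK ?prime_gt0 // mulr1.
by rewrite -{2}(expf_card x) card_Fp.
Qed.

(** With h = (p - 1)/2, the polynomial X^h - 1 has at most h roots, so some nonzero x has x^h = -1;
    as h is even, x^(h/2) is the required root. *)
Lemma Fp_sqrtN1 (p : nat) : prime p -> (p %% 4 = 1)%N -> exists x : 'F_p, x ^+ 2 = - 1.
Proof.
move=> pP p1; pose h := p./2.
have ph : p = (h.*2).+1 by rewrite /h; lia.
have h0 : (0 < h)%N by have := prime_gt1 pP; lia.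
pose P : {poly 'F_p} := 'X^h - 1.
have : exists2 x : 'F_p, x != 0 & x ^+ h != 1.
  apply/exists_inP; rewrite -negb_forall_in; apply/negP => /forall_inP all1.
  have sP : size P = h.+1 by rewrite size_Xn_sub_1.
  have P0 : P != 0 by rewrite -size_poly_gt0 sP.
  have allP : all (root P) (enum [pred x : 'F_p | x != 0]).
    apply/allP => x; rewrite mem_enum inE => /all1 /eqP xh.
    by rewrite /root !hornerE xh subrr.
  have := max_poly_roots P0 allP (enum_uniq _).
  have -> : size (enum [pred x : 'F_p | x != 0]) = p.-1.
    by rewrite -cardE (eq_card (B := predC1 0)) ?cardC1 ?card_Fp.
  by rewrite sP; lia.
case=> x x0 xh; have := Fp_expf pP x0; rewrite (_ : p.-1 = h * 2)%N ?exprM; last by rewrite ph; lia.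
move/eqP.
rewrite sqrf_eq1 (negPf xh) /= => /eqP xhN.
exists (x ^+ h./2); rewrite -exprM -xhN; congr (_ ^+ _).
by lia.
Qed.

Lemma Fp_sqr_neqN1 (p : nat) (x : 'F_p) : prime p -> (p %% 4 = 3)%N -> x ^+ 2 != - 1.
Proof.
move=> pP p3; apply/eqP => x2.
have x0 : x != 0.
  by apply: contra_eq_neq x2 => ->; rewrite expr0n /= eq_sym oppr_eq0 oner_eq0.
have := Fp_expf pP x0; have -> : p.-1 = (2 * (p./2))%N by lia.
rewrite exprM x2 -signr_odd; have -> : odd p./2 by lia.
move/eqP; rewrite expr1 eq_sym -subr_eq0 opprK -[1 + 1]/((2%:Z)%:~R) Fp_int_eq0 //.
by move=> /dvdn_leq; lia.
Qed.

Lemma Fp_natr_eq0 (p k : nat) : prime p -> ((k%:R : 'F_p) == 0) = (p %| k)%N.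
Proof. by move=> pP; rewrite -[k%:R]/((k%:Z)%:~R) Fp_int_eq0 // dvdzE. Qed.

Lemma Fp_sqr_inj (p i j : nat) : prime p -> (i <= p./2)%N -> (j <= p./2)%N ->
  odd p -> (i%:R : 'F_p) ^+ 2 = j%:R ^+ 2 -> i = j.
Proof.
move=> pP; wlog ij : i j / (i <= j)%N => [H ih jh op e|].
  by have [/H|/ltnW/H H'] := leqP i j; [exact | symmetry; exact: H'].
move=> ih jh op /eqP; rewrite -subr_eq0 subr_sqr mulf_eq0 -[i%:R - _]opprB.
rewrite oppr_eq0 -natrB // -natrD !Fp_natr_eq0 // => /orP[] /dvdnP[[|q]]; nia.
Qed.

(** Pigeonhole: the squares and the elements c + D y^2 each take (p + 1)/2 values in a field of p
    elements, so the two sets meet. *)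
Lemma Fp_norm_surj (p : nat) (D c : 'F_p) : prime p -> odd p -> D != 0 ->
  exists x y : 'F_p, x ^+ 2 - D * y ^+ 2 = c.
Proof.
move=> pP op D0.
pose f (s : 'I_(p./2).+1 + 'I_(p./2).+1) : 'F_p :=
  match s with inl i => i%:R ^+ 2 | inr j => c + D * j%:R ^+ 2 end.
have /injectivePn[s [t st fst]] : ~~ injectiveb f.
  apply/negP => /injectiveP /leq_card; rewrite card_Fp // card_sum !card_ord.
  by lia.
have inj (i j : 'I_(p./2).+1) : (i%:R : 'F_p) ^+ 2 = j%:R ^+ 2 -> i = j.
  move=> e; apply: val_inj; apply: (Fp_sqr_inj pP _ _ op e); rewrite -ltnS; exact: ltn_ord.
case: s t st fst => [i|i] [j|j] /= st fst.
- by case/eqP: st; congr inl; exact: inj.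
- by exists i%:R, j%:R; rewrite fst addrK.
- by exists j%:R, i%:R; rewrite -fst addrK.
- case/eqP: st; congr inr; apply: inj.
  by apply: (mulfI D0); apply: (addrI c).
Qed.

(** Otherwise D and the (p - 1)/2 nonzero squares would all be roots of X^((p-1)/2) - 1, one more
    than its degree allows. *)
Lemma Fp_euler (p : nat) (D : 'F_p) : prime p -> odd p -> D ^+ p./2 = 1 ->
  exists y, y ^+ 2 = D.
Proof.
move=> pP op Dh; have p1 := prime_gt1 pP; have h0 : (0 < p./2)%N by lia.
have [/exists_eqP//|] := boolP [exists y : 'F_p, y ^+ 2 == D].
rewrite negb_exists => /forallP nsq; exfalso.
pose P : {poly 'F_p} := 'X^(p./2) - 1.
have sP : size P = (p./2).+1 by rewrite size_Xn_sub_1.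
pose s : seq 'F_p := D :: [seq i%:R ^+ 2 | i <- iota 1 p./2].
have P0 : P != 0 by rewrite -size_poly_gt0 sP.
have /(max_poly_roots P0) : all (root P) s.
  rewrite /= /root !hornerE Dh subrr eqxx /=; apply/allP => _ /mapP[i + ->].
  rewrite mem_iota => /andP[i0 ih]; rewrite !hornerE -exprM.
  rewrite (_ : 2 * p./2 = p.-1)%N; last by lia.
  rewrite Fp_expf ?subrr // Fp_natr_eq0 //; apply/negP => /dvdn_leq; lia.
have /[swap]/[apply] : uniq s.
  rewrite /= map_inj_in_uniq ?iota_uniq ?andbT.
    by apply/mapP => -[i _ Di]; have := nsq i%:R; rewrite Di eqxx.
  move=> i j; rewrite !mem_iota => ih jh; apply: Fp_sqr_inj => //; lia.
by rewrite sP /= size_map size_iota ltnn.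
Qed.

Lemma dvdz_sum2sq (p : nat) (x y : int) : prime p -> (p %% 4 = 3)%N ->
  (p %| x ^+ 2 + y ^+ 2)%Z -> (p %| x)%Z && (p %| y)%Z.
Proof.
move=> pP p3; rewrite -!Fp_int_eq0 // rmorphD !rmorphXn /=.
set X : 'F_p := x%:~R; set Y : 'F_p := y%:~R => /eqP XY.
have [Y0|Y0] := eqVneq Y 0.
  by move/eqP: XY; rewrite Y0 expr0n addr0 sqrf_eq0 => ->.
case/eqP: (Fp_sqr_neqN1 (X / Y) pP p3).
by apply/eqP; rewrite expr_div_n -subr_eq0 opprK -[1](divff (expf_neq0 2 Y0)) -mulrDl XY mul0r.
Qed.

Lemma sqrt_floor (n : nat) : exists s, (s ^ 2 <= n < s.+1 ^ 2)%N.
Proof.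
elim: n => [|n [s /andP[sn ns]]]; first by exists 0%N.
have [ns1|] := ltnP n.+1 (s.+1 ^ 2); first by exists s; rewrite ns1 andbT; lia.
by exists s.+1; apply/andP; split; nia.
Qed.

(** Thue's argument: if z^2 = -1 and s is the integer square root of p, then i - z j takes some
    value twice for 0 <= i, j <= s. The differences u, w of the coordinates satisfy p | u^2 + w^2
    and 0 < u^2 + w^2 < 2p. *)
Lemma prime_sum2sq (p : nat) : prime p -> (p %% 4 = 1)%N ->
  exists x y : int, p%:Z = x ^+ 2 + y ^+ 2.
Proof.
move=> pP p1; have [z z2] := Fp_sqrtN1 pP p1.
have [s /andP[sp ps]] := sqrt_floor p.
pose f (ij : 'I_s.+1 * 'I_s.+1) : 'F_p := ij.1%:R - z * ij.2%:R.
have /injectivePn[[i j] [[i' j'] neq fij]] : ~~ injectiveb f.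
  apply/negP => /injectiveP /leq_card; rewrite card_Fp // card_prod !card_ord.
  by lia.
pose u : int := i%:Z - i'%:Z; pose w : int := j%:Z - j'%:Z.
have uw : u%:~R = z * w%:~R :> 'F_p.
  rewrite /u /w !rmorphB /= mulrBr; move: fij; rewrite /f /= => /eqP.
  rewrite -subr_eq0 => /eqP fij; apply/eqP.
  by rewrite -subr_eq0 -fij; apply/eqP; ring.
have : (p %| u ^+ 2 + w ^+ 2)%Z.
  by rewrite -Fp_int_eq0 // rmorphD !rmorphXn /= uw exprMn z2 mulN1r addNr.
case/dvdzP => q uwq.
have sp' : (s ^ 2 < p)%N.
  rewrite ltn_neqAle sp andbT; apply/eqP => sp2; have p_gt1 := prime_gt1 pP.
  have /primeP[_ /(_ s)] := pP; rewrite -{1}sp2 dvdn_exp // => /(_ isT).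
  by case/orP => /eqP; nia.
have uw0 : 0 < u ^+ 2 + w ^+ 2.
  rewrite lt_neqAle addr_ge0 ?sqr_ge0 // andbT eq_sym paddr_eq0 ?sqr_ge0 // !sqrf_eq0.
  rewrite !subr_eq0 !eqz_nat; apply: contra neq => /andP[/eqP ii /eqP jj].
  by apply/eqP; congr (_, _); apply: val_inj.
have ub (k l : 'I_s.+1) : (k%:Z - l%:Z) ^+ 2 <= (s ^ 2)%N%:Z.
  have := ltn_ord k; have := ltn_ord l => ls ks.
  have -> : (s ^ 2)%N%:Z = s%:Z ^+ 2 by rewrite -rmorphXn.
  by rewrite -subr_ge0 subr_sqr; apply: mulr_ge0; lia.
have := ub i i'; have := ub j j'; rewrite -/u -/w => wb uub.
exists u, w; rewrite uwq; suff -> : q = 1 by rewrite mul1r.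
by nia.
Qed.

Lemma sum2sqM (x y z t : int) : (x ^+ 2 + y ^+ 2) * (z ^+ 2 + t ^+ 2) =
  (x * z - y * t) ^+ 2 + (x * t + y * z) ^+ 2.
Proof. ring. Qed.

(** Strong induction, dividing by a sum of two squares: 2, a prime that is 1 mod 4, or the square of
    a prime that is 3 mod 4. Such a factor has even valuation at every prime that is 3 mod 4, so the
    hypothesis passes to the quotient. *)
Lemma sum2sq (n : nat) : (0 < n)%N ->
  (forall p, prime p -> (p %% 4 = 3)%N -> ~~ odd (logn p n)) ->
  exists x y : int, n%:Z = x ^+ 2 + y ^+ 2.
Proof.
elim/ltn_ind: n => n IHn n0 oddn.
have [n1|n1] := leqP n 1; first by exists 1, 0; lia.
move: (pdiv n) (pdiv_prime n1) (pdiv_dvd n) => p pP pn.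
have step : forall q, (1 < q)%N -> (q %| n)%N ->
    (forall r, prime r -> (r %% 4 = 3)%N -> ~~ odd (logn r q)) ->
    (exists x y : int, q%:Z = x ^+ 2 + y ^+ 2) ->
    exists x y : int, n%:Z = x ^+ 2 + y ^+ 2.
  move=> q q1 qn lq [x [y qxy]].
  have m0 : (0 < n %/ q)%N.
    rewrite divn_gt0; last exact: ltnW.
    exact: dvdn_leq.
  have [||z [t mzt]] := IHn (n %/ q)%N _ m0.
  - by rewrite ltn_Pdiv.
  - move=> r rP r3; have := oddn r rP r3; rewrite -{1}(divnK qn) lognM //; last exact: ltnW.
    by rewrite oddD (negPf (lq r rP r3)) addbF.
  exists (z * x - t * y), (z * y + t * x).
  by rewrite -sum2sqM -mzt -qxy -PoszM divnK.
have [p2|p2] := eqVneq p 2%N.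
  apply: (step p) => // [|r rP r3|]; first exact: prime_gt1.
    by rewrite p2 logn_prime //; case: eqP => // r2; lia.
  by exists 1, 1; rewrite p2.
have podd : odd p by case: (even_prime pP) => // /eqP; rewrite (negPf p2).
have [p3|p3] := eqVneq (p %% 4)%N 3%N.
  have p2n : (p ^ 2 %| n)%N.
    rewrite pfactor_dvdn //; have := oddn p pP p3.
    have : (0 < logn p n)%N by rewrite logn_gt0 mem_primes pP n0.
    by case: (logn p n) => [|[|]].
  apply: (step (p ^ 2)%N) => // [|r rP r3|].
  - by have := prime_gt1 pP; nia.
  - by rewrite lognX mul2n odd_double.
  - by exists p%:Z, 0; rewrite expr0n addr0 -rmorphXn.
apply: (step p) => // [|r rP r3|]; first exact: prime_gt1.
  by rewrite logn_prime //; case: eqP => // r2; lia.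
by apply: prime_sum2sq => //; lia.
Qed.

(* [chi p a] holds iff the Hilbert symbol [(a, -1)_p] is [-1]. *)
Definition chi (p : nat) (a : int) : bool :=
  if p == 2%N then ((a %/ (2 ^ logn 2 `|a|)%N%:Z)%Z %% 4)%Z == 3
  else (p %% 4 == 3)%N && odd (logn p `|a|).

Lemma unit_part (p : nat) (a : int) : prime p -> a != 0 ->
  exists2 c, ~~ (p %| c)%Z & a = (p ^ logn p `|a|)%N%:Z * c.
Proof.
move=> pP a0; have ga : (0 < `|a|)%N by rewrite absz_gt0.
have : (a %/ (p ^ logn p `|a|)%N%:Z)%Z * (p ^ logn p `|a|)%N%:Z = a.
  by rewrite divzK // dvdzE pfactor_dvdnn.
set c := (_ %/ _)%Z => Da; exists c; last by rewrite mulrC.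
apply/negP => /dvdzP[d Dc]; move: Da; rewrite Dc -mulrA -PoszM -expnS.
move=> /(congr1 (fun b => p ^ (logn p `|a|).+1 %| `|b|)%N).
rewrite abszM dvdn_mull // => /esym.
by rewrite pfactor_dvdn // ltnn.
Qed.

Lemma unit_partE (p e : nat) (c : int) : prime p -> ~~ (p %| c)%Z ->
  logn p `|(p ^ e)%N%:Z * c| = e.
Proof.
move=> pP pc; have c0 : (0 < `|c|)%N.
  by rewrite absz_gt0; apply: contraNneq pc => ->; rewrite dvdz0.
rewrite abszM absz_nat lognM ?expn_gt0 ?(prime_gt0 pP) // pfactorK // logn_coprime ?addn0 //.
by rewrite prime_coprime.
Qed.

Lemma chi2E (e : nat) (c : int) : ~~ (2 %| c)%Z ->
  chi 2 ((2 ^ e)%N%:Z * c) = ((c %% 4)%Z == 3).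
Proof.
move=> c2; rewrite /chi /= -[2%N]/(2%N) (@unit_partE 2 e c) // mulrC mulzK //.
by rewrite eqz_nat expn_eq0.
Qed.

Lemma odd_mod4 (c : int) : ~~ (2 %| c)%Z -> (c %% 4)%Z = 1 \/ (c %% 4)%Z = 3.
Proof. by lia. Qed.

Lemma chiM (p : nat) (a b : int) : prime p -> a != 0 -> b != 0 ->
  chi p (a * b) = chi p a (+) chi p b.
Proof.
move=> pP a0 b0; have [p2|p2] := eqVneq p 2%N; last first.
  rewrite /chi (negPf p2) abszM lognM ?absz_gt0 // oddD.
  by case: (_ == _).
subst p; have [c c2 ->] := unit_part pP a0; have [d d2 ->] := unit_part pP b0.
rewrite mulrACA -PoszM -expnD !chi2E //.
  rewrite -modzMm.
  by have [->|->] := odd_mod4 c2; have [->|->] := odd_mod4 d2.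
by rewrite dvdzE abszM Euclid_dvdM // negb_or -!dvdzE c2.
Qed.

Lemma chi1 (p : nat) : prime p -> chi p 1 = false.
Proof. by move=> pP; rewrite /chi /= !logn1 andbF; case: eqP. Qed.

Lemma chi_prime (p q : nat) : prime p -> prime q ->
  chi p q = (q %% 4 == 3)%N && ((p == q) || (p == 2%N)).
Proof.
move=> pP qP; have [p2|p2] := eqVneq p 2%N.
  have [q2|q2] := eqVneq q 2%N; first by rewrite p2 q2.
  rewrite p2 orbT andbT -[q%:Z]mul1r -[1]/((2 ^ 0)%N%:Z) chi2E; first by lia.
  by case: (even_prime qP) => [/eqP|]; [rewrite (negPf q2) | lia].
rewrite /chi (negPf p2) orbF /= logn_prime // eq_sym.
by have [->|] := eqVneq p q; rewrite ?andbT ?andbF.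
Qed.

(** In the relative precision 4p, the factor p preserves the valuation and the factor 4 preserves
    the odd part mod 4, which matters for p = 2. *)
Lemma chi_close (p : nat) (a c : int) : prime p -> a != 0 ->
  ((p ^ logn p `|a|)%N%:Z * (4 * p%:Z) %| c - a)%Z -> c != 0 /\ chi p c = chi p a.
Proof.
move=> pP a0 /dvdzP[t]; have [d pd Da] := unit_part pP a0.
set e := logn _ _ in Da * => ca.
have Dc : c = (p ^ e)%N%:Z * (d + 4 * p%:Z * t).
  by rewrite mulrDr -Da -[c](subrK a) ca addrC; congr (_ + _); ring.
have pd' : ~~ (p %| d + 4 * p%:Z * t)%Z.
  by rewrite rpredDr // mulrAC dvdz_mull.
split.
  rewrite Dc mulf_neq0 ?eqz_nat -?lt0n ?expn_gt0 ?prime_gt0 //.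
  by apply: contraNneq pd' => ->; rewrite dvdz0.
have [p2|p2] := eqVneq p 2%N.
  by subst p; rewrite Dc Da !chi2E //; lia.
by rewrite /chi (negPf p2) Dc unit_partE.
Qed.

(** The product formula for (n, -1); the real place is silent because n is positive. By
    multiplicativity n may be taken prime, and a prime q that is 3 mod 4 contributes exactly twice,
    at q and at 2. *)
Lemma chi_product (n B : nat) : (0 < n)%N -> (2 <= B)%N ->
  (forall p, prime p -> (p %| n)%N -> (p <= B)%N) ->
  \big[addb/false]_(p < B.+1 | prime p) chi p n%:Z = false.
Proof.
move=> n0 B2; elim/ltn_ind: n n0 => n IHn n0 nB.
have [n1|n1] := leqP n 1.
  by rewrite big1 // => p pP; have -> : n = 1%N by [lia]; rewrite chi1.
have [q [qP qn]] : exists q, prime q /\ (q %| n)%N.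
  exists (pdiv n); split; last exact: pdiv_dvd.
  exact: pdiv_prime.
have m0 : (0 < n %/ q)%N by rewrite divn_gt0 ?prime_gt0 //; exact: dvdn_leq.
rewrite -(divnK qn) (eq_bigr (fun p : 'I_B.+1 => chi p (n %/ q)%N (+) chi p q)); last first.
  by move=> p pP; rewrite PoszM chiM // eqz_nat -lt0n ?m0 ?(prime_gt0 qP).
rewrite big_split /= IHn //=; first last.
- move=> p pP /dvdn_mulr pn; apply: nB => //.
  by rewrite -(divnK qn); exact: pn.
- by rewrite ltn_Pdiv ?prime_gt1.
have qB : (q < B.+1)%N by rewrite ltnS nB.
rewrite (eq_bigr (fun p : 'I_B.+1 => (q %% 4 == 3)%N && ((p == q :> nat) || (p == 2%N :> nat)))); last first.
  by move=> p pP; rewrite chi_prime.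
case: (eqVneq (q %% 4)%N 3%N) => q3 /=; last by rewrite big1.
have q2 : q != 2%N by apply: contra_eq_neq q3 => ->.
rewrite (bigD1 (Ordinal qB)) //= eqxx /=.
rewrite (bigD1 (Ordinal (B2 : 2 < B.+1)%N)) /=; last by rewrite -val_eqE /= eq_sym.
rewrite big1 ?eqxx ?orbT // => p /andP[/andP[_ pq] p2].
by rewrite -!val_eqE /= in pq p2; rewrite (negPf pq) (negPf p2).
Qed.

(** For odd p by descent, since a prime that is 3 mod 4 can only divide x^2 + y^2 by dividing x and
    y. For p = 2 the product formula applies, all other symbols being known to vanish. *)
Lemma chi_sum2sq (p : nat) (x y : int) : prime p -> x ^+ 2 + y ^+ 2 != 0 ->
  chi p (x ^+ 2 + y ^+ 2) = false.
Proof.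
have chi3 q u v : prime q -> q != 2%N -> u ^+ 2 + v ^+ 2 != 0 -> chi q (u ^+ 2 + v ^+ 2) = false.
  move=> qP q2; move: {2}`|u ^+ 2 + v ^+ 2|.+1 (leqnn `|u ^+ 2 + v ^+ 2|.+1) => N.
  elim: N u v => // N IHN u v uvN uv0.
  rewrite /chi (negPf q2); case: (eqVneq (q %% 4)%N 3%N) => //= q3.
  have [quv|quv] := boolP (q %| u ^+ 2 + v ^+ 2)%Z; last first.
    by rewrite logn_coprime // prime_coprime.
  have /andP[/dvdzP[u' Du] /dvdzP[v' Dv]] := dvdz_sum2sq qP q3 quv.
  have Duv : u ^+ 2 + v ^+ 2 = (q ^ 2)%N%:Z * (u' ^+ 2 + v' ^+ 2).
    by rewrite Du Dv -mulnn PoszM; ring.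
  have uv'0 : u' ^+ 2 + v' ^+ 2 != 0.
    by apply: contraNneq uv0 => uv'0; rewrite Duv uv'0 mulr0.
  rewrite Duv abszM absz_nat lognM ?absz_gt0 // ?expn_gt0 ?(prime_gt0 qP) //.
  rewrite pfactorK //=.
  have := IHN u' v' _ uv'0; rewrite /chi (negPf q2) q3 /= negbK; apply.
  rewrite ltnS in uvN; apply: leq_trans uvN; rewrite Duv abszM absz_nat.
  by rewrite ltn_Pmull ?absz_gt0 // -(exp1n 2) ltn_exp2r ?prime_gt1.
move=> pP xy0; have [p2|p2] := eqVneq p 2%N; last exact: chi3.
have ge0 : 0 <= x ^+ 2 + y ^+ 2 by rewrite addr_ge0 ?sqr_ge0.
have := gez0_abs ge0; set n := `|_|%N => Dn.
have n0 : (0 < n)%N by rewrite absz_gt0.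
have := @chi_product n (maxn 2 n) n0 (leq_maxl _ _).
rewrite p2 Dn (bigD1 (Ordinal (leq_maxl 2 n : 2 < (maxn 2 n).+1)%N)) //= big1 ?addbF.
  by apply=> q _ /dvdn_leq; rewrite leq_max => ->; rewrite ?orbT.
by move=> q /andP[qP q2]; rewrite chi3.
Qed.

(** * The irreducible factors of Z^(ab) - n^a *)

Lemma conj_unity_root (N : nat) (x : algC) :
  (0 < N)%N -> x ^+ N = 1 -> Num.conj x = x^-1.
Proof.
move=> N0 xN; have x0 : x != 0.
  by apply: contra_eq_neq xN => ->; rewrite expr0n gtn_eqF // eq_sym oner_eq0.
apply: (mulfI x0); rewrite divff // -normCK.
suff /eqP-> : `|x| == 1 by rewrite expr1n.
by rewrite -(pexpr_eq1 N0) // -normrX xN normr1.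
Qed.

Lemma real_odd_expf_inj (b : nat) (x y : algC) : odd b ->
  x \is Num.real -> y \is Num.real -> x ^+ b = y ^+ b -> x = y.
Proof.
move=> ob xR yR xy; have b0 : (0 < b)%N by case: b ob {xy}.
have [y0|y0] := eqVneq y 0.
  by move/eqP: xy; rewrite y0 expr0n gtn_eqF // expf_eq0 b0 /= => /eqP->.
have wb : (x / y) ^+ b = 1 by rewrite expr_div_n xy divff ?expf_neq0.
have wR : x / y \is Num.real by rewrite rpred_div.
have /eqP : (x / y) ^+ 2 = 1.
  rewrite -real_normK //; suff /eqP-> : `|x / y| == 1 by rewrite expr1n.
  by rewrite -(pexpr_eq1 b0) // -normrX wb normr1.
rewrite sqrf_eq1 => /orP[] /eqP w1.
  by rewrite -[x](divfK y0) w1 mul1r.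
move/eqP: wb; rewrite w1 -signr_odd ob expr1 eq_sym -subr_eq0 opprK.
by rewrite -mulr2n pnatr_eq0.
Qed.

(* Apply Galois theory to the splitting field of the minimal polynomial. *)
Lemma Crat_fixed (s : algC) :
  (forall u : {rmorphism algC -> algC}, u s = s) -> s \in Crat.
Proof.
move=> fix_s; have [q [Dq qmon] _] := minCpolyP s.
have [rs Drs] := closed_field_poly_normal (minCpoly s).
rewrite (monicP (minCpoly_monic s)) scale1r in Drs.
have [Qs [QsC [s1 Ds1 genQs]]] := num_field_exists rs.
have spl : SplittingField.axiom Qs.
  exists (map_poly (in_alg Qs) q).
    by apply/polyOverP => i; rewrite coef_map /= rpredZ ?rpred1.
  exists s1; last exact: genQs.
  rewrite (_ : map_poly _ _ = \prod_(x <- s1) ('X - x%:P)) ?eqpxx //.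
  apply: (map_poly_inj QsC); rewrite -map_poly_comp.
  rewrite (@eq_map_poly _ _ _ ratr) => [|a]; last first.
    by rewrite /= alg_num_field fmorph_rat.
  rewrite -Dq Drs -Ds1 big_map rmorph_prod /=.
  by apply: eq_bigr => x _; rewrite map_polyXsubC.
pose SM := FieldExt_isSplittingField.Build rat Qs spl.
pose L : splittingFieldType rat := HB.pack (FieldExt.sort Qs) SM.
have : s \in rs by rewrite -root_prod_XsubC -Drs root_minCpoly.
rewrite -Ds1 => /mapP[a _ sa].
have char0 : has_char0 L by move=> p; rewrite pchar_lalg pchar_num.
have gal1 : galois 1%AS ({:L}%AS).
  apply/and3P; split; first exact: subvf.
    by apply/separableP => x _; exact: pcharf0_separable.
  by apply/splitting_normalField; [exact: subvf | exact: spl].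
have : (a : L) \in fixedField ('Gal({:L} / 1%AS))%g.
  apply/fixedFieldP; first exact: memvf.
  move=> x _; have [u Du] := extend_algC_subfield_aut QsC (x : {rmorphism L -> L}).
  by apply: (fmorph_inj QsC); rewrite Du -sa fix_s.
rewrite (galois_fixedField gal1) => /vlineP[c Dc].
apply/CratP; exists c; rewrite sa Dc.
by rewrite -[c%:A]/(c%:A : Qs) alg_num_field fmorph_rat.
Qed.

Lemma odd_real_root (b : nat) (n : int) : odd b ->
  exists2 r : algC, r \is Num.real & r ^+ b = n%:~R.
Proof.
move=> ob; have b0 : (0 < b)%N by case: b ob.
have [n0|n0] := leP 0 n.
  exists (b.-root n%:~R); last by rewrite rootCK.
  by rewrite ger0_real // rootC_ge0 // ler0z.
exists (- b.-root (- n%:~R)); last by rewrite exprNn -signr_odd ob rootCK // mulrNN mul1r.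
by rewrite rpredN ger0_real // rootC_ge0 // oppr_ge0 lerz0 ltW.
Qed.

(** For odd b this is the classical criterion for Z^b - n to be irreducible over Q. For odd b and n
    = 1 or n = -1 it forces b = 1. *)
Definition not_proper_power (b : nat) (n : int) :=
  forall (l : nat) (c : int), (l %| b)%N -> n = c ^+ l -> l = 1%N.

(** By Bezout r^g is rational for g = gcd(e, b). It is also an algebraic integer, hence an integer
    c, and n = c^(b/g) forces g = b. *)
Lemma rational_power_dvdn (b e : nat) (n : int) (r : algC) :
  (0 < e)%N -> (0 < b)%N -> n != 0 -> not_proper_power b n ->
  r ^+ b = n%:~R -> r ^+ e \in Crat -> (b %| e)%N.
Proof.
move=> e0 b0 n0 npp rb re; pose g := gcdn e b.
have r0 : r != 0.
  apply: contraNneq n0 => r0; move/eqP: rb; rewrite r0 expr0n gtn_eqF //=.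
  by rewrite eq_sym intr_eq0.
have rg : r ^+ g \in Crat.
  case: (egcdnP b e0) => km kn def _.
  have -> : r ^+ g = (r ^+ e) ^+ km / (r ^+ b) ^+ kn.
    by rewrite -!exprM mulnC def mulnC exprD mulrAC divff ?expf_neq0 // mul1r.
  by apply: rpred_div; apply: rpredX; rewrite ?rb ?rpred_int.
have gb : (g %| b)%N := dvdn_gcdr e b; have ge : (g %| e)%N := dvdn_gcdl e b.
have rgb : (r ^+ g) ^+ (b %/ g) = n%:~R by rewrite -exprM mulnC divnK.
have bg0 : (0 < b %/ g)%N by rewrite divn_gt0 ?gcdn_gt0 ?e0 // dvdn_leq.
have /intrP[c rgc] : r ^+ g \in Num.int.
  apply: (Cint_rat_Aint rg).
  apply: (@root_monic_Aint ('X^(b %/ g) - (n%:~R)%:P)).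
  - by rewrite /root !hornerE rgb subrr.
  - exact: monicXnsubC.
  - apply/polyOverP => i; rewrite coefB coefXn coefC.
    by apply: rpredB; [exact: rpred_nat | case: ifP => _; rewrite ?rpred_int ?rpred0].
have : n = c ^+ (b %/ g).
  by apply: (intr_inj (R := algC)); rewrite rmorphXn /= -rgc rgb.
move/(npp _ _ (dvdn_div gb)) => bg1.
by rewrite -(divnK gb) bg1 mul1n.
Qed.

(** * Roots of a rational polynomial, grouped by the value of x^b *)

Section RootGrouping.
Variables (q : {poly rat}) (b d : nat) (n : int) (R : seq algC).
Hypothesis uniqR : uniq R.
Hypothesis memR : forall x, (x \in R) = root (map_poly ratr q) x.
Local Notation group eta := [pred x | x ^+ b == n%:~R * eta].

Lemma perm_aut_roots (u : {rmorphism algC -> algC}) : perm_eq (map u R) R.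
Proof.
have uR : uniq (map u R) by rewrite map_inj_uniq //; exact: fmorph_inj.
have sub : {subset map u R <= R}.
  move=> _ /mapP[x + ->]; rewrite !memR -(fmorph_root u) -map_poly_comp.
  by rewrite (@eq_map_poly _ _ _ ratr) // => a; rewrite /= fmorph_rat.
apply: uniq_perm => //.
have sz : (size R <= size (map u R))%N by rewrite size_map.
exact: (uniq_min_size uR sub sz).2.
Qed.

Lemma aut_group (u : {rmorphism algC -> algC}) eta x :
  (u x \in group (u eta)) = (x \in group eta).
Proof.
rewrite !inE -[in RHS](inj_eq (fmorph_inj u)).
by rewrite rmorphXn rmorphM /= rmorph_int.
Qed.

Lemma aut_group_prod (u : {rmorphism algC -> algC}) eta :
  u (\prod_(x <- R | group eta x) x) = \prod_(x <- R | group (u eta) x) x.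
Proof.
rewrite -[RHS](perm_big _ (perm_aut_roots u)) big_map rmorph_prod.
by apply: eq_bigl => x; rewrite -[LHS](aut_group u).
Qed.

Lemma aut_group_count (u : {rmorphism algC -> algC}) eta :
  count (group (u eta)) R = count (group eta) R.
Proof.
rewrite -(permP (perm_aut_roots u)) count_map.
by apply: eq_count => x; exact: (aut_group u).
Qed.

(* The product of the roots with x^b = n * eta is r^e times a root of unity
   zeta, and grouping makes both of them, hence also the real number r^e,
   commute with complex conjugation and automorphisms; as r^e is determined
   among its conjugates by being real, it is rational. *)
Lemma dvdn_group_count eta : (0 < d)%N -> eta ^+ d = 1 -> odd b -> n != 0 ->
  not_proper_power b n -> (0 < count (group eta) R)%N ->
  (b %| count (group eta) R)%N.
Proof.
move=> d0 etad ob n0 npp; set e := count _ _ => e0.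
have b0 : (0 < b)%N by case: b ob.
have [r rR rb] := odd_real_root n ob.
apply: (rational_power_dvdn e0 b0 n0 npp rb); apply: Crat_fixed => u.
have r0 : r != 0.
  apply: contraNneq n0 => r0; move/eqP: rb; rewrite r0 expr0n gtn_eqF //=.
  by rewrite eq_sym intr_eq0.
pose c t := \prod_(x <- R | group t x) x.
pose z := \prod_(x <- R | group eta x) (x / r).
have cz : c eta = r ^+ e * z.
  rewrite /e -sum1_count -prodrXr -big_split /=.
  by apply: eq_bigr => x _; rewrite expr1 mulrC divfK.
have zN : z ^+ (b * d) = 1.
  rewrite /z -prodrXl big1_seq // => x /andP[/eqP xb _].
  rewrite exprM expr_div_n xb rb mulrAC divff ?intr_eq0 // mul1r.
  exact: etad.
have N0 : (0 < b * d)%N by rewrite muln_gt0 b0.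
have conj_aut (N : nat) t : (0 < N)%N -> t ^+ N = 1 -> Num.conj (u t) = u (Num.conj t).
  move=> N1 tN; rewrite (conj_unity_root N1 tN) fmorphV.
  by apply: (conj_unity_root N1); rewrite -rmorphXn tN rmorph1.
have z0 : z != 0.
  by apply: contra_eq_neq zN => ->; rewrite expr0n gtn_eqF // eq_sym oner_eq0.
have re : r ^+ e = c eta / z by rewrite cz mulfK.
have uR : u (r ^+ e) \is Num.real.
  apply/CrealP; rewrite -[in RHS](CrealP (rpredX e rR)) re !fmorph_div /=.
  have conjP t : Num.conj (c t) = c (Num.conj t) := aut_group_prod Num.conj t.
  have uP t : u (c t) = c (u t) := aut_group_prod u t.
  by rewrite (conj_aut _ _ N0 zN) uP !conjP uP (conj_aut _ _ d0 etad).
apply: (real_odd_expf_inj ob uR (rpredX e rR)).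
by rewrite -rmorphXn /= exprAC rb -rmorphXn rmorph_int.
Qed.
End RootGrouping.

(* The product of [Z^b - eta n] over the primitive [d]-th roots of unity [eta]. *)
Definition hom_cyclotomic (b : nat) (n : int) (d : nat) : {poly int} :=
  \sum_(i < (totient d).+1)
    ('Phi_d`_i * n ^+ (totient d - i)) *: 'X^(b * i).

Section HomCyclotomic.
Variables (b : nat) (n : int).
Hypotheses (n0 : n != 0) (b0 : (0 < b)%N).
Local Notation nC := (n%:~R : algC).
Local Notation G := (hom_cyclotomic b n).
Local Notation pZtoC := (map_poly (intr : int -> algC)).

Lemma nC_neq0 : nC != 0. Proof. by rewrite intr_eq0. Qed.

Lemma hom_cyclotomic_comp d :
  pZtoC (G d) = nC ^+ totient d *: (pZtoC 'Phi_d \Po (nC^-1 *: 'X^b)).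
Proof.
rewrite comp_polyE size_map_inj_poly ?rmorph0 //; last exact: intr_inj.
rewrite size_Cyclotomic scaler_sumr rmorph_sum /=; apply: eq_bigr => i _.
rewrite map_polyZ map_polyXn rmorphM rmorphXn /= coef_map /=.
have := ltn_ord i; rewrite ltnS => leid.
rewrite exprZn -exprM !scalerA exprVn.
have -> : nC ^+ totient d = nC ^+ (totient d - i) * nC ^+ i.
  by rewrite -exprD subnK.
by congr (_ *: _); field; rewrite expf_neq0 // nC_neq0.
Qed.

Lemma hom_cyclotomic_prodC d z : d.-primitive_root z ->
  pZtoC (G d) = \prod_(k < d | coprime k d) ('X^b - (nC * z ^+ k)%:P).
Proof.
move=> prim_z; rewrite hom_cyclotomic_comp (Cintr_Cyclotomic prim_z).
rewrite /cyclotomic rmorph_prod /=.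
have -> : nC ^+ totient d = \prod_(k < d | coprime k d) nC.
  rewrite prodr_const -sum1_card totient_count_coprime big_mkord big_mkcond /=.
  rewrite [in RHS]big_mkcond /=; congr (_ ^+ _); apply: eq_bigr => k _.
  by rewrite coprime_sym -[_ \in _]/(coprime k d); case: coprime.
rewrite -(scaler_prod (index_enum _) _ (fun=> nC)); apply: eq_bigr => k _.
rewrite comp_polyB comp_polyX comp_polyC scalerBr scalerA divff ?nC_neq0 //.
by rewrite scale1r -mul_polyC -polyCM.
Qed.

Lemma hom_cyclotomic_prod a : (0 < a)%N ->
  \prod_(d <- divisors a) G d = 'X^(a * b) - (n ^+ a)%:P.
Proof.
move=> a0; apply: (map_inj_poly (f := intr : int -> algC)) => //; first exact: intr_inj.
rewrite rmorph_prod /= (eq_bigr _ (fun d _ => hom_cyclotomic_comp d)).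
rewrite scaler_prod -rmorph_prod -rmorph_prod /= prod_Cyclotomic //.
have sum_tot : (\sum_(d <- divisors a) totient d)%N = a.
  rewrite -[RHS](sum_totient_dvd a) -(big_mkord (fun d => d %| a)%N totient).
  rewrite -[RHS]big_filter; apply: perm_big; apply: uniq_perm.
  - exact: divisors_uniq.
  - by rewrite filter_uniq // iota_uniq.
  move=> d; rewrite mem_filter mem_index_iota -dvdn_divisors //= ltnS.
  by case: (boolP (_ %| _)%N) => // /dvdn_leq ->.
rewrite prodrXr sum_tot !rmorphB /= rmorph1 !map_polyXn map_polyC /=.
rewrite comp_Xn_poly exprZn exprVn scalerBr scalerA.
rewrite divff ?expf_neq0 ?nC_neq0 // scale1r -exprM mulnC.
rewrite -polyC1 comp_polyC -mul_polyC -polyCM mulr1.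
by rewrite [(n ^+ a)%:~R]rmorphXn.
Qed.

Lemma hom_cyclotomicC_monic d : (0 < d)%N -> pZtoC (G d) \is monic.
Proof.
move=> d0; have [z prim_z] := C_prim_root_exists d0.
by rewrite (hom_cyclotomic_prodC prim_z) monic_prod // => k _; exact: monicXnsubC.
Qed.

Lemma size_hom_cyclotomic d : (0 < d)%N ->
  size (G d) = (b * totient d).+1.
Proof.
move=> d0.
rewrite -(size_map_inj_poly (f := intr : int -> algC)) ?rmorph0 //; last exact: intr_inj.
rewrite -[LHS]prednK; last by rewrite size_poly_gt0 monic_neq0 ?hom_cyclotomicC_monic.
rewrite hom_cyclotomic_comp size_scale ?expf_neq0 ?nC_neq0 // size_comp_poly.
rewrite size_map_inj_poly ?rmorph0 //; last exact: intr_inj.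
by rewrite size_Cyclotomic size_scale ?invr_eq0 ?nC_neq0 // size_polyXn mulnC.
Qed.

(** A nonconstant factor q has a root with x^b = n z^k0 for some k0 prime to d. Automorphisms carry
    z^k0 to every primitive d-th root of unity, so each of the phi(d) groups contains a root of q,
    hence at least b of them by [dvdn_group_count]. The groups are disjoint, so q has full degree b
    phi(d). *)
Lemma hom_cyclotomic_irreducible d : (0 < d)%N -> odd b ->
  not_proper_power b n ->
  irreducible_poly (map_poly (intr : int -> rat) (G d)).
Proof.
move=> d0 ob npp.
have [z prim_z] := C_prim_root_exists d0.
have zd := prim_expr_order prim_z.
set g := map_poly _ _.
have Dg : map_poly ratr g = \prod_(k < d | coprime k d) ('X^b - (nC * z ^+ k)%:P).
  rewrite -hom_cyclotomic_prodC // /g -map_poly_comp.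
  by apply: eq_map_poly => x /=; rewrite ratr_int.
have size_g : size g = (b * totient d).+1.
  by rewrite size_map_inj_poly ?size_hom_cyclotomic //; exact: intr_inj.
split=> [|q q1 qg]; first by rewrite size_g ltnS muln_gt0 b0 totient_gt0.
have g0 : g != 0 by rewrite -size_poly_gt0 size_g.
have q0 : q != 0 by apply: contraTneq qg => ->; rewrite dvd0p.
rewrite -dvdp_size_eqp // eqn_leq dvdp_leq //= size_g.
pose Q : {poly algC} := map_poly ratr q.
have Q0 : Q != 0 by rewrite map_poly_eq0.
have [rs Drs] := closed_field_poly_normal Q.
pose R := undup rs.
have memR x : (x \in R) = root Q x.
  by rewrite mem_undup Drs rootZ ?lead_coef_eq0 // root_prod_XsubC.
have sizeR : (size R < size q)%N.
  rewrite -(size_map_poly (ratr : {rmorphism rat -> algC})) -/Q Drs.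
  by rewrite size_scale ?lead_coef_eq0 // size_prod_XsubC ltnS size_undup.
apply: leq_trans sizeR; rewrite ltnS.
have uniqR : uniq R := undup_uniq rs.
pose group (eta : algC) := [pred x : algC | x ^+ b == nC * eta].
have [x0 Qx0] : exists x0, root Q x0.
  by apply/closed_rootP; rewrite /Q size_map_poly.
have : root (map_poly ratr g) x0.
  by move: qg; rewrite -(dvdp_map (ratr : {rmorphism rat -> algC})) => /root_dvdp; exact.
rewrite Dg => /rootP; rewrite horner_prod => /eqP /prodf_eq0[k0 cok0].
rewrite !hornerE subr_eq0 => /eqP x0b.
have cnt k : coprime k d -> (b <= count (group (z ^+ k)) R)%N.
  move=> cok; suff cnt0 : (0 < count (group (z ^+ k)) R)%N.
    apply: dvdn_leq => //; apply: (dvdn_group_count uniqR memR d0) => //.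
    by rewrite exprAC zd expr1n.
  have [u Du] : exists u : {rmorphism algC -> algC}, u (z ^+ k0) = z ^+ k.
    have prim0 : d.-primitive_root (z ^+ k0) by rewrite (prim_root_exp_coprime _ prim_z).
    have zkd : (z ^+ k) ^+ d = 1 by rewrite exprAC zd expr1n.
    have [j Dj] := prim_rootP prim0 zkd.
    have coj : coprime j d.
      by rewrite -(prim_root_exp_coprime _ prim0) -Dj (prim_root_exp_coprime _ prim_z).
    have [u Du] := Qn_aut_exists coj.
    by exists u; rewrite Du -?Dj // exprAC zd expr1n.
  rewrite -Du (aut_group_count _ _ uniqR memR) -has_count; apply/hasP; exists x0 => //=.
    by rewrite memR.
  exact/eqP.
rewrite -sum1_size; apply: (@leq_trans (\sum_(k < d | coprime k d) count (group (z ^+ k)) R)%N).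
  apply: (@leq_trans (\sum_(k < d | coprime k d) b)%N); last by apply: leq_sum => k /cnt.
  rewrite totient_count_coprime big_mkord big_distrr /= [leqRHS]big_mkcond /=.
  by apply: leq_sum => k _; rewrite coprime_sym; case: coprime; rewrite ?muln1 ?muln0.
rewrite (eq_bigr _ (fun k _ => esym (sum1_count R (group (z ^+ nat_of_ord k))))) /=.
rewrite (exchange_big_dep predT) //=; apply: leq_sum => x _.
rewrite sum1dep_card.
apply/card_le1_eqP => i j; rewrite !inE => /andP[_ /eqP xi] /andP[_ /eqP xj].
apply/val_inj; move: xi; rewrite xj => /(mulfI nC_neq0)/eqP.
by rewrite (eq_prim_root_expr prim_z) !modn_small // => /eqP.
Qed.
End HomCyclotomic.

(** * The p-adic integers and numbers *)

Section PadicIntegers.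
Variable p : prime_nat.
Local Notation Zp := (padic_int p).
Local Notation pP := (prime_valP p).

Lemma padic_cstE (c : int) : padic_cst p c = c%:~R.
Proof.
have add a b : padic_cst p (a + b) = padic_cst p a + padic_cst p b.
  by apply: padic_int_inj => n /=; rewrite modzDm.
have cst0 : padic_cst p 0 = 0 by [].
have pos (k : nat) : padic_cst p k%:Z = k%:R.
  by elim: k => [|k IHk] //; rewrite -natr1 -IHk -add; congr padic_cst; lia.
case: c => k; first exact: pos.
apply/eqP; rewrite NegzE rmorphN /= -addr_eq0 -[X in _ + X]pos -add addNr.
by rewrite cst0.
Qed.

Lemma padic_intE (c : int) n : (c%:~R : Zp) n = (c %% (p ^ n)%N%:Z)%Z.
Proof. by rewrite -padic_cstE. Qed.

Lemma ppowE n : (p%:R ^+ n : Zp) = ((p ^ n)%N%:Z)%:~R.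
Proof. by rewrite -natrX. Qed.

Lemma ppow_neq0 n : (p ^ n)%N%:Z != 0.
Proof. by rewrite eqz_nat -lt0n expn_gt0 prime_gt0 ?pP. Qed.

Lemma padic_seq_le (x : Zp) m n : (m <= n)%N -> (x n = x m %[mod (p ^ m)%N%:Z])%Z.
Proof.
move=> /subnKC <-; elim: (n - m)%N => [|k IHk]; first by rewrite addn0.
rewrite -IHk addnS [in RHS](padic_seqP x) modz_dvdm //.
by rewrite dvdzE /= dvdn_exp2l ?leq_addr.
Qed.

Lemma padic_addE (x y : Zp) n : (x + y) n = ((x n + y n) %% (p ^ n)%N%:Z)%Z.
Proof. by []. Qed.

Lemma padic_seq0 (x : Zp) : x 0%N = 0.
Proof. by rewrite -padic_seq_small modz1. Qed.

Lemma padic_dvdP (x : Zp) n : x n = 0 -> exists y, x = p%:R ^+ n * y.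
Proof.
move=> xn0.
have dvd i : ((p ^ n)%N%:Z %| x (n + i)%N)%Z.
  by apply/dvdz_mod0P; rewrite (padic_seq_le _ (leq_addr i n)) xn0 mod0z.
have fP i : ((x (n + i)%N %/ (p ^ n)%N%:Z)%Z = (x (n + i.+1)%N %/ (p ^ n)%N%:Z)%Z
    %[mod (p ^ i)%N%:Z])%Z.
  apply/eqP; rewrite eqz_mod_dvd -(dvdz_mul2l (ppow_neq0 n)).
  rewrite mulrBr ![(p ^ n)%N%:Z * _]mulrC !divzK // -PoszM -expnD -eqz_mod_dvd addnS.
  by rewrite addnC; apply/eqP; exact: padic_seq_mod.
exists (padic_mk fP); apply: padic_int_inj => i.
rewrite ppowE /= padic_intE /= modzMm.
have [q Dq] := dvdzP (dvd i).
rewrite Dq mulzK ?ppow_neq0 // mulrC -Dq.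
by rewrite addnC (padic_seq_le _ (leq_addr n i)) padic_seq_small.
Qed.

Lemma padic_approx (x : Zp) n : exists y, x = (x n)%:~R + p%:R ^+ n * y.
Proof.
have [|y Dy] := @padic_dvdP (x - (x n)%:~R) n; last by exists y; rewrite -Dy subrKC.
rewrite /= padic_intE padic_seq_small.
by rewrite modzDmr subrr mod0z.
Qed.

Lemma padic_dvd_seq (y : Zp) n : (p%:R ^+ n * y) n = 0.
Proof. by rewrite ppowE /= padic_intE modzz mul0r mod0z. Qed.

(** Completeness of Z_p: the i-th iterate from 0 is already correct modulo p^i, so the diagonal
    [s i i] is a coherent sequence and defines the limit. *)
Lemma padic_fixpoint (F : Zp -> Zp) :
  (forall (n : nat) (x y : Zp), x n = y n -> F x n.+1 = F y n.+1) -> exists x, F x = x.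
Proof.
move=> FP; pose s i := iter i F 0.
have sP i : s i i = s i.+1 i.
  by elim: i => [|i IHi]; [rewrite !padic_seq0 | exact: FP].
have fP i : (s i i = s i.+1 i.+1 %[mod (p ^ i)%N%:Z])%Z.
  by rewrite sP; exact: padic_seq_mod.
exists (padic_mk fP); apply: padic_int_inj => i.
rewrite [RHS]/= padic_seq_small.
case: i => [|i]; first by rewrite !padic_seq0.
by apply: FP; rewrite /= padic_seq_small.
Qed.

Lemma padic_eq_seq (x y : Zp) n : x n = y n <-> exists z, x - y = p%:R ^+ n * z.
Proof.
split=> [xy|[z Dz]]; last first.
  by rewrite -[x](subrK y) Dz padic_addE padic_dvd_seq add0r padic_seq_small.
by apply: padic_dvdP; rewrite /= xy modzDmr subrr mod0z.
Qed.

Lemma padic_contraction (F : Zp -> Zp) :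
  (forall x y, exists z, F x - F y = p%:R * z * (x - y)) -> exists x, F x = x.
Proof.
move=> FP; apply: padic_fixpoint => n x y /padic_eq_seq[z xy].
by apply/padic_eq_seq; have [t ->] := FP x y; exists (t * z); rewrite xy exprS; ring.
Qed.

Lemma padic_unit1 (z : Zp) : (1 + p%:R * z) \is a GRing.unit.
Proof.
have [|w Dw] := @padic_contraction (fun w => 1 - p%:R * z * w).
  by move=> x y; exists (- z); ring.
apply/unitrPr; exists w.
by rewrite mulrDl mul1r -{1}Dw subrK.
Qed.

Lemma padic_unitE (x : Zp) : (x \is a GRing.unit) = (x 1%N != 0).
Proof.
apply/idP/idP => [/unitrPr[y xy]|x1].
  apply/eqP => x10; have := congr1 (fun z : Zp => z 1%N) xy.
  by rewrite /= x10 mul0r mod0z modz_small //= ltz_nat expn1 prime_gt1 ?pP.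
have [y ->] := padic_approx x 1.
have cop : coprimez (x 1%N) p.
  rewrite /coprimez gcdzC -/(coprimez _ _) coprimezE prime_coprime ?pP //.
  apply: contra x1 => px; apply/eqP.
  by rewrite -(padic_seq_small x 1); apply/dvdz_mod0P; rewrite expn1.
have [[u v] /= uv] := coprimezP _ _ cop.
have : (u%:~R * ((x 1%N)%:~R + p%:R ^+ 1 * y) : Zp) \is a GRing.unit.
  have -> : (u%:~R * ((x 1%N)%:~R + p%:R ^+ 1 * y) : Zp) =
            1 + p%:R * (u%:~R * y - v%:~R).
    have e : u%:~R * (x 1%N)%:~R + v%:~R * p%:R = 1 :> Zp.
      by rewrite -[p%:R]/(p%:Z%:~R) -!rmorphM -rmorphD /= uv.
    transitivity (u%:~R * (x 1%N)%:~R + v%:~R * p%:R + p%:R * (u%:~R * y - v%:~R) : Zp).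
      by ring.
    by rewrite e.
  exact: padic_unit1.
by rewrite unitrM => /andP[].
Qed.

Lemma padic_decomp (x : Zp) : x != 0 ->
  exists e u, u \is a GRing.unit /\ x = p%:R ^+ e * u.
Proof.
move=> x0; have ex : exists n, x n != 0.
  apply: contrapT => /forallNP xn; case/eqP: x0; apply: padic_int_inj => n /=.
  by rewrite mod0z; apply/eqP; have /negP := xn n; rewrite negbK.
case: (ex_minnP ex) => -[|e]; first by rewrite padic_seq0.
move=> xe min; have : x e = 0 by apply/eqP; apply: contraT => /min; rewrite ltnn.
move=> /padic_dvdP[u Du]; exists e, u; split => //; rewrite padic_unitE.
apply: contra xe => /eqP/padic_dvdP[v Dv].
by apply/eqP; rewrite Du Dv mulrA -exprSr padic_dvd_seq.
Qed.

Lemma padic_int_eq0 (c : int) : ((c%:~R : Zp) == 0) = (c == 0).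
Proof.
apply/eqP/eqP => [c0|->//].
(* Looking modulo p^|c| is enough, because p^|c| > |c|. *)
have := congr1 (fun z : Zp => z `|c|%N) c0.
rewrite padic_intE [X in _ = X]/= mod0z => /dvdz_mod0P; rewrite dvdzE /= => dvd.
apply/eqP; rewrite -absz_eq0 -leqn0 leqNgt; apply/negP => /dvdn_leq/(_ dvd).
by rewrite leqNgt ltn_expl // prime_gt1 ?pP.
Qed.

(** Since (1 + 2pv)^2 = 1 + 4p(v + p v^2), it suffices to solve v = t - p v^2, a contraction. This
    form of Hensel's lemma is uniform in p, including p = 2. *)
Lemma padic_sqrt (t : Zp) : exists v, (1 + 2 * p%:R * v) ^+ 2 = 1 + 4 * p%:R * t.
Proof.
have [|v Dv] := @padic_contraction (fun v => t - p%:R * v ^+ 2).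
  by move=> x y; exists (- (x + y)); ring.
have Dt : t = v + p%:R * v ^+ 2 by rewrite -[LHS](subrK (p%:R * v ^+ 2)) Dv.
by exists v; rewrite Dt; ring.
Qed.
End PadicIntegers.

Lemma tofracP (R : idomainType) (c : {fraction R}) :
  exists a b : R, b != 0 /\ c = tofrac a / tofrac b.
Proof.
elim/quotW: c => x; have d0 := denom_ratioP x.
exists (frac x).1, (frac x).2; split=> //.
have tof0 : tofrac (frac x).2 != 0 by rewrite tofrac_eq0.
apply: (mulIf tof0); rewrite divfK //; unlock FracField.tofrac.
rewrite -[LHS]FracField.pi_mul; apply/eqmodP => /=.
rewrite FracField.equivfE /FracField.mulf !numden_Ratio ?oner_neq0 ?mulr1 //.
by rewrite mulrC.
Qed.

Section PadicField.
Variable p : prime_nat.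
Local Notation Zp := (padic_int p).
Local Notation F := (padic p).

Lemma padic_p_neq0 : (p%:R : F) != 0.
Proof.
rewrite -(rmorph_nat (@tofrac Zp)) tofrac_eq0 -[p%:R]/(p%:Z%:~R) padic_int_eq0.
by rewrite eqz_nat -lt0n prime_gt0 // prime_valP.
Qed.

Lemma padic_pexpz_neq0 (e : int) : (p%:R : F) ^ e != 0.
Proof. by rewrite expfz_neq0 // padic_p_neq0. Qed.

Lemma tofrac_unit (u : Zp) : u \is a GRing.unit ->
  tofrac u^-1 = (tofrac u)^-1.
Proof.
move=> uU; have u0 : tofrac u != 0.
  by rewrite tofrac_eq0; apply: contraTneq uU => ->; rewrite unitr0.
by apply: (mulfI u0); rewrite -rmorphM !divrr // ?rmorph1 // unitfE.
Qed.

Lemma padic_valuation_exists (c : F) : c != 0 -> exists e, padic_valuation c e.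
Proof.
have [a [b [b0 ->]]] := tofracP c.
rewrite mulf_eq0 invr_eq0 !tofrac_eq0 (negPf b0) orbF => a0.
have [e [u [uU ->]]] := padic_decomp a0; have [f [v [vU ->]]] := padic_decomp b0.
exists (e%:Z - f%:Z); exists (u / v); first by rewrite unitrM uU unitrV.
rewrite !rmorphM !rmorphXn !rmorph_nat /= tofrac_unit // expfzDr ?padic_p_neq0 //.
by rewrite invfM -!exprnP exprnN; ring.
Qed.

Lemma padic_valuationM (c d : F) e f :
  padic_valuation c e -> padic_valuation d f -> padic_valuation (c * d) (e + f).
Proof.
move=> [u uU ->] [v vU ->]; exists (u * v); first by rewrite unitrM uU.
by rewrite expfzDr ?padic_p_neq0 // rmorphM mulrACA.
Qed.

Lemma padic_valuationV (c : F) e : padic_valuation c e -> padic_valuation c^-1 (- e).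
Proof.
move=> [u uU ->]; exists u^-1; first by rewrite unitrV.
by rewrite invfM tofrac_unit // invr_expz.
Qed.

Lemma padic_p_nonunit (x : Zp) : (p%:R * x) \is a GRing.unit = false.
Proof. by rewrite padic_unitE -[p%:R]expr1 padic_dvd_seq eqxx. Qed.

Lemma padic_valuation_ge0 (a : Zp) e : padic_valuation (tofrac a) e -> 0 <= e.
Proof.
case: e => // e [u uU]; rewrite NegzE => /(congr1 (fun x => p%:R ^+ e.+1 * x)).
rewrite mulrA -exprnN divff ?expf_neq0 ?padic_p_neq0 // mul1r.
rewrite -(rmorph_nat (@tofrac Zp)) -rmorphXn -rmorphM => /eqP; rewrite tofrac_eq => /eqP ua.
by move: uU; rewrite -ua exprS -mulrA padic_p_nonunit.
Qed.

Lemma padic_valuation_int (c : F) (e : nat) : padic_valuation c e%:Z ->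
  exists2 u : Zp, u \is a GRing.unit & c = tofrac (p%:R ^+ e * u).
Proof.
by case=> u uU ->; exists u; rewrite ?rmorphM ?rmorphXn ?rmorph_nat.
Qed.

Lemma padic_valuation_inj (c : F) e f :
  padic_valuation c e -> padic_valuation c f -> e = f.
Proof.
move=> ve vf; apply/eqP; rewrite eq_le.
have [u uU cu] := ve; have c0 : c != 0.
  rewrite cu mulf_neq0 ?padic_pexpz_neq0 // tofrac_eq0.
  by apply: contraTneq uU => ->; rewrite unitr0.
have v1 : padic_valuation (tofrac (1 : Zp)) (e - f).
  by rewrite rmorph1 -(divff c0); apply: padic_valuationM => //; exact: padic_valuationV.
have v2 : padic_valuation (tofrac (1 : Zp)) (f - e).
  by rewrite rmorph1 -(divff c0); apply: padic_valuationM => //; exact: padic_valuationV.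
by have := padic_valuation_ge0 v1; have := padic_valuation_ge0 v2; lia.
Qed.

(* If c is not in Z_p, then d = 1/c is in p Z_p and d^n P(c) = 1 + d g. *)
Lemma padic_int_closed (c : F) : integralOver (@tofrac Zp) c -> exists a, c = tofrac a.
Proof.
move=> [P Pmon /rootP Pc]; have [->|c0] := eqVneq c 0; first by exists 0; rewrite rmorph0.
have [[e|e] ve] := padic_valuation_exists c0.
  by have [u _ ->] := padic_valuation_int ve; exists (p%:R ^+ e * u).
have := padic_valuationV ve; rewrite NegzE opprK => /padic_valuation_int[u uU Dd].
have sP : (size P).-1.+1 = size P by rewrite prednK // size_poly_gt0 monic_neq0.
set n := (size P).-1 in sP.
move: Pc; rewrite horner_coef size_map_poly_id0; last first.
  by rewrite (monicP Pmon) rmorph1 oner_eq0.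
rewrite -sP big_ord_recr /= coef_map /= -/(lead_coef P) (monicP Pmon) rmorph1 mul1r.
move=> /(congr1 (fun x => c^-1 ^+ n * x)); rewrite mulr0 mulrDr -exprMn mulVf // expr1n.
have [d Dp {}Dd] : exists2 d : Zp, d = p%:R * (p%:R ^+ e * u) & c^-1 = tofrac d.
  by eexists; last exact: Dd; rewrite mulrA -exprS.
have -> : c^-1 ^+ n * (\sum_(i < n) (map_poly (@tofrac Zp) P)`_i * c ^+ i) =
    tofrac (d * \sum_(i < n) P`_i * d ^+ (n - i.+1)).
  rewrite mulr_sumr rmorphM rmorph_sum mulr_sumr; apply: eq_bigr => i _.
  rewrite coef_map /= rmorphM rmorphXn /= -Dd.
  have -> : c^-1 ^+ n = c^-1 * c^-1 ^+ (n - i.+1) * c^-1 ^+ i.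
    by rewrite -exprS -exprD; congr (_ ^+ _); have := ltn_ord i; lia.
  by rewrite [in RHS]mulrCA -[RHS]mulr1 -(expr1n _ i) -(mulVf c0) exprMn; ring.
rewrite -(rmorph1 (@tofrac Zp)) -rmorphD => /eqP; rewrite tofrac_eq0 addrC => /eqP D0.
have := padic_unit1 (p%:R ^+ e * u * \sum_(i < n) P`_i * d ^+ (n - i.+1)).
by rewrite mulrA -Dp D0 unitr0.
Qed.
End PadicField.

(** * Unramified quadratic extensions and invariants *)

(* Here and below, [A] and [F] stand for [Z_p] and [Q_p]. *)
Section Integral.
Variables (A : idomainType) (F : fieldType) (tof : {rmorphism A -> F}).
Hypothesis tof_inj : injective tof.
Hypothesis closed : forall c, integralOver tof c -> exists a, c = tof a.
Variable K : fieldExtType F.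
Local Notation iota := (in_alg K \o tof).
Local Notation integral := (integralOver (fun t : A => (tof t)%:A : K)).
Local Notation is_tof_unit c := (exists2 u, u \is a GRing.unit & c = tof u).

Lemma integral_algebra_int (a : A) : integral ((tof a)%:A : K).
Proof. exact: (@integral_id _ _ iota). Qed.

Lemma integralM_alg (x y : K) : integral x -> integral y -> integral (x * y).
Proof. exact: (@integral_mul _ _ iota). Qed.

Lemma integralD_alg (x y : K) : integral x -> integral y -> integral (x + y).
Proof. exact: (@integral_add _ _ iota). Qed.

Lemma integralB_alg (x y : K) : integral x -> integral y -> integral (x - y).
Proof. exact: (@integral_sub _ _ iota). Qed.

Lemma integral_base (c : F) : integral (c%:A : K) -> exists a, c = tof a.
Proof.
move=> [P Pmon Pc]; apply: closed; exists P => //.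
rewrite -(fmorph_root (in_alg K)) -map_poly_comp; exact: Pc.
Qed.

Lemma integral_unit (c : F) : c != 0 ->
  integral (c%:A : K) -> integral ((c%:A)^-1 : K) -> is_tof_unit c.
Proof.
move=> c0 /integral_base[a ca].
rewrite -[_^-1](fmorphV (in_alg K)) => /integral_base[b cb].
exists a => //; apply/unitrPr; exists b; apply: tof_inj.
by rewrite rmorphM rmorph1 -ca -cb divff.
Qed.

Lemma integral_quadratic (x : K) (T N : A) :
  x ^+ 2 = tof T *: x - (tof N)%:A -> integral x.
Proof.
move=> x2; exists ('X^2 - (T *: 'X - N%:P)).
  rewrite monicE lead_coefDl ?lead_coefXn // size_polyXn size_polyN.
  apply: leq_ltn_trans (size_polyD _ _) _; rewrite size_polyN gtn_max.
  rewrite (leq_ltn_trans (size_scale_leq _ _)) ?size_polyX //=.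
  exact: leq_ltn_trans (size_polyC_leq1 _) _.
rewrite /root -[map_poly _ _]/(map_poly iota _) !rmorphB /= map_polyXn map_polyZ /=.
by rewrite map_polyX map_polyC /= !hornerE x2 mulr_algl subrr.
Qed.

Variables (theta : K) (T N : F).
Hypothesis theta2 : theta ^+ 2 = T *: theta - N%:A.
Hypothesis thetaNF : forall c : F, theta != c%:A.
Local Notation elem x y := (x%:A + y *: theta : K).

Lemma quad_elem_eq0 (x y : F) : elem x y = 0 -> x = 0 /\ y = 0.
Proof.
move=> xy; have y0 : y = 0.
  apply/eqP; apply: contraT => y0; have /eqP := thetaNF (- x / y); case.
  apply: (scalerI y0); rewrite scalerA mulrCA divff // mulr1 scaleNr.
  by apply/eqP; rewrite -addr_eq0 addrC xy.
split=> //; move/eqP: xy; rewrite y0 scale0r addr0 scaler_eq0 oner_eq0 orbF.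
by move/eqP.
Qed.

Lemma quad_elemM (x y z t : F) :
  elem x y * elem z t = elem (x * z - N * y * t) (x * t + y * z + T * y * t).
Proof.
have th2 : theta ^+ 2 = in_alg K T * theta - in_alg K N by rewrite theta2 mulr_algl.
rewrite -!(mulr_algl _ theta).
rewrite -![_%:A]/(in_alg K _).
ring: th2.
Qed.

(** The conjugate of [theta] is T - [theta], so the second element is the conjugate of [elem x y].
    That evaluation of a polynomial over F commutes with conjugation is read off the coordinates
    along Horner's scheme. *)
Lemma quad_horner_conj (P : {poly F}) (x y : F) :
  exists a b, (map_poly (in_alg K) P).[elem x y] = elem a b /\
    (map_poly (in_alg K) P).[elem (x + T * y) (- y)] = elem (a + T * b) (- b).
Proof.
elim/poly_ind: P => [|P c [a [b [e1 e2]]]].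
  by exists 0, 0; rewrite rmorph0 !horner0 mulr0 addr0 scale0r oppr0 scale0r addr0.
exists (a * x - N * b * y + c), (a * y + b * x + T * b * y).
rewrite rmorphD rmorphM /= map_polyX map_polyC /= !hornerE e1 e2 !quad_elemM.
rewrite -!(mulr_algl _ theta) -![_%:A]/(in_alg K _).
by split; ring.
Qed.

Lemma integral_conj (x y : F) :
  integral (elem x y) -> integral (elem (x + T * y) (- y)).
Proof.
move=> [P Pmon /rootP Pxy]; exists P => //; apply/rootP.
have [a [b []]] := quad_horner_conj (map_poly (tof) P) x y.
rewrite -!map_poly_comp => e1 e2; move: (esym e1); rewrite Pxy => /quad_elem_eq0[a0 b0].
by move: e2; rewrite a0 b0 mulr0 addr0 oppr0 !scale0r addr0.
Qed.

(** The expression is the norm of x + y [theta], its product with the conjugate. Conjugation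
    preserves integrality, so the norm and its inverse are both integral and lie in the integrally
    closed base. *)
Lemma quad_norm_unit (x y : F) : elem x y != 0 ->
  integral (elem x y) -> integral (elem x y)^-1 ->
  is_tof_unit (x ^+ 2 + T * x * y + N * y ^+ 2).
Proof.
move=> xy0 ixy ivxy; set M := _ + N * _.
have DM : elem x y * elem (x + T * y) (- y) = M%:A.
  rewrite quad_elemM (_ : _ + _ + _ = 0) ?scale0r ?addr0 /M; last by ring.
  by congr (_ *: _); ring.
have c0 : elem (x + T * y) (- y) != 0.
  apply: contra xy0 => /eqP/quad_elem_eq0[/[swap] /eqP]; rewrite oppr_eq0 => /eqP-> .
  by rewrite mulr0 addr0 => ->; rewrite !scale0r addr0.
have M0 : M != 0.
  have : M%:A != 0 :> K by rewrite -DM mulf_neq0.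
  by rewrite scaler_eq0 oner_eq0 orbF.
apply: integral_unit => //.
  by rewrite -DM; apply: integralM_alg => //; exact: integral_conj.
rewrite -DM invfM; apply: integralM_alg => //.
have Dv : (elem x y)^-1 = elem ((x + T * y) / M) (- y / M).
  apply: (mulfI xy0); rewrite divff // ![_ / M]mulrC -!scalerA -scalerDr.
  by rewrite -scalerAr DM scalerA mulVf ?scale1r.
have -> : (elem (x + T * y) (- y))^-1 =
    elem ((x + T * y) / M + T * (- y / M)) (- (- y / M)).
  apply: (mulfI c0); rewrite divff // mulrDr (_ : _ + T * _ = x / M); last by ring.
  rewrite (_ : - (- y / M) = y / M); last by ring.
  rewrite ![_ / M]mulrC -!scalerA -mulrDr -scalerDr -scalerAr mulrC DM scalerA mulVf ?scale1r //.
by apply: integral_conj; rewrite -Dv.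
Qed.

End Integral.

Section LocalQuadratic.
Variables (p : nat) (A : idomainType) (F : fieldType) (tof : {rmorphism A -> F}).
Hypothesis pP : prime p.
Hypothesis tof_inj : injective tof.
Hypothesis closed : forall c, integralOver tof c -> exists a, c = tof a.
Hypothesis p0 : p%:R != 0 :> F.
Hypothesis two0 : 2 != 0 :> F.
Hypothesis unit1 : forall z : A, (1 + p%:R * z) \is a GRing.unit.
Hypothesis p_nonunit : forall z : A, (p%:R * z) \is a GRing.unit = false.
Hypothesis residue : forall z : A, exists (n : int) (t : A), z = n%:~R + p%:R * t.
Hypothesis hensel : forall t : A, exists v, v ^+ 2 = 1 + 4 * p%:R * t.
Local Notation is_tof_unit c := (exists2 u, u \is a GRing.unit & c = tof u).
Hypothesis val_inj : forall (e f : int) (u v : A), u \is a GRing.unit ->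
  v \is a GRing.unit -> p%:R ^ e * tof u = p%:R ^ f * tof v -> e = f.

Lemma local_int_unit (n : int) : ~~ (p %| n)%Z -> (n%:~R : A) \is a GRing.unit.
Proof.
move=> pn; have cop : coprimez n p.
  by rewrite /coprimez gcdzC -/(coprimez _ _) coprimezE prime_coprime.
have [[u v] /= uv] := coprimezP _ _ cop.
have : (u%:~R * n%:~R : A) \is a GRing.unit.
  have -> : u%:~R * n%:~R = 1 + p%:R * (- v%:~R) :> A; last exact: unit1.
  have e : u%:~R * n%:~R + v%:~R * p%:R = 1 :> A.
    by rewrite -[p%:R]/(p%:Z%:~R) -!rmorphM -rmorphD /= uv.
  transitivity (u%:~R * n%:~R + v%:~R * p%:R + p%:R * (- v%:~R) : A); first by ring.
  by rewrite e.
by rewrite unitrM => /andP[].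
Qed.

Lemma local_dvd_int (n : int) (t : A) : n%:~R = p%:R * t -> (p %| n)%Z.
Proof.
move=> nt; apply: contraT => /local_int_unit.
by rewrite nt p_nonunit.
Qed.

Lemma local_residue_unit (z : A) : z \is a GRing.unit ->
  exists (n : int) (t : A), ~~ (p %| n)%Z /\ z = n%:~R + p%:R * t.
Proof.
move=> zU; have [n [t Dz]] := residue z; exists n, t; split=> //.
apply/negP => /dvdzP[q Dn]; move: zU.
have -> : z = p%:R * (q%:~R + t) by rewrite Dz Dn rmorphM /= -[(p%:Z)%:~R]/(p%:R); ring.
by rewrite p_nonunit.
Qed.

Lemma local_sqrt (a t : A) (y : int) : odd p -> ~~ (p %| y)%Z ->
  a = y%:~R ^+ 2 + p%:R * t -> exists r, r ^+ 2 = a.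
Proof.
move=> op py Da; have yU := local_int_unit py.
have U4 : (4 : A) \is a GRing.unit.
  apply: (@local_int_unit 4); rewrite dvdzE -[(_ %| _)%N]/(p %| 2 ^ 2)%N Euclid_dvdX // andbT.
  by rewrite dvdn_prime2 //; apply: contraTneq op => ->.
have [v Dv] := hensel (t / (4 * y%:~R ^+ 2)); exists (y%:~R * v).
rewrite exprMn Dv Da invrM ?unitrX // mulrDr mulr1; congr (_ + _).
have -> : y%:~R ^+ 2 * (4 * p%:R * (t * (y%:~R ^- 2 / 4))) =
  (y%:~R ^+ 2 * y%:~R ^- 2) * (4 / 4) * (p%:R * t) :> A by ring.
by rewrite !divrr ?unitrX // !mul1r.
Qed.

(** Solve modulo p by [Fp_norm_surj], then lift by Hensel the unknown that is prime to p: x if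
    possible, and otherwise y, since p cannot divide both. *)
Lemma local_norm_equation (D v : A) : odd p -> D \is a GRing.unit ->
  v \is a GRing.unit -> exists X Y, X ^+ 2 - D * Y ^+ 2 = v.
Proof.
move=> op DU vU.
have [d [dt [pd Dd]]] := local_residue_unit DU.
have [n [nt [pn Dn]]] := local_residue_unit vU.
have d0 : d%:~R != 0 :> 'F_p by rewrite Fp_int_eq0.
have [x [y]] := Fp_norm_surj n%:~R pP op d0.
rewrite [x]Fp_intE [y]Fp_intE; move: (Posz _) (Posz _) => {x y} y x xy.
have /dvdzP[q Dq] : (p %| x ^+ 2 - d * y ^+ 2 - n)%Z.
  by rewrite -Fp_int_eq0 // !rmorphB /= [(d * _)%:~R]rmorphM !rmorphXn /= xy subrr.
have Dx : x%:~R ^+ 2 = d%:~R * y%:~R ^+ 2 + n%:~R + p%:R * q%:~R :> A.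
  rewrite -[p%:R]/(p%:Z%:~R) -!rmorphXn -!rmorphM -!rmorphD /= [p%:Z * q]mulrC -Dq.
  by congr (_%:~R); ring.
have [px|px] := boolP (p %| x)%Z.
  have py : ~~ (p %| y)%Z.
    apply: contra pn => py; have -> : n = x ^+ 2 - d * y ^+ 2 - q * p by rewrite -Dq; ring.
    by rewrite rpredB ?dvdz_mull // rpredB // ?dvdz_mull // dvdz_exp.
  have [r Dr] : exists r, r ^+ 2 = (x%:~R ^+ 2 - v) / D.
    apply: (@local_sqrt _ ((q%:~R - nt - dt * y%:~R ^+ 2) / D) y op py).
    apply: (mulIr DU); rewrite divrK // mulrDl -[p%:R * _ * D]mulrA divrK //.
    by rewrite Dn Dx Dd; ring.
  by exists x%:~R, r; rewrite Dr mulrC divrK // subKr.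
have [r Dr] : exists r, r ^+ 2 = D * y%:~R ^+ 2 + v.
  apply: (@local_sqrt _ (dt * y%:~R ^+ 2 + nt - q%:~R) x op px).
  by rewrite Dn Dx Dd; ring.
by exists r, y%:~R; rewrite Dr addrC addKr.
Qed.

Section UnramifiedQuadratic.
Variable K : fieldExtType F.
Local Notation integral := (integralOver (fun t : A => (tof t)%:A : K)).
Hypothesis unr : forall x : K, x != 0 -> exists e : int, exists w : K,
    [/\ integral w, integral w^-1 & x = p%:R ^ e * w].

Lemma pexpz_alg (e : int) : (p%:R ^ e : K) = (p%:R ^ e)%:A.
Proof. by rewrite -[RHS]/(in_alg K _) fmorphXz rmorph_nat. Qed.

(** Norms from an unramified quadratic extension have even valuation: an element is p^e w with w a
    unit of O_K, and the norm of w is a unit. *)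
Lemma quad_norm_unramified (theta : K) (T N : F) (x y : F) :
  theta ^+ 2 = T *: theta - N%:A -> (forall c, theta != c%:A) ->
  (x != 0) || (y != 0) ->
  exists (e : int) u, u \is a GRing.unit /\
    x ^+ 2 + T * x * y + N * y ^+ 2 = p%:R ^ (e + e) * tof u.
Proof.
move=> th2 thF xy0.
have nz : x%:A + y *: theta != 0.
  by apply: contraTneq xy0 => /(quad_elem_eq0 thF)[-> ->]; rewrite eqxx.
have [e [w [iw ivw Dw]]] := unr nz; exists e.
set q : F := p%:R ^ e; have q0 : q != 0 by rewrite expfz_neq0.
have Dwe : w = (x / q)%:A + (y / q) *: theta.
  rewrite pexpz_alg in Dw; apply: (mulfI (x := q%:A)).
    by rewrite scaler_eq0 negb_or q0 oner_eq0.
  by rewrite -Dw -scalerAl mul1r scalerDr !scalerA ![q * _]mulrC !divfK.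
have w0 : w != 0 by apply: contraNneq nz => w0; rewrite Dw w0 mulr0.
rewrite Dwe in iw ivw w0.
have [u uU Du] := quad_norm_unit tof_inj closed th2 thF w0 iw ivw.
exists u; split=> //; rewrite -Du expfzDr // -/q.
by field.
Qed.

Hypothesis dimK : \dim {:K} = 2%N.

(** Complete the square to get an element with square in F, then remove the power of p, which is a
    uniformizer of K. What remains is a unit of O_K, so its square is a unit. *)
Lemma quadratic_generator : exists (w : K) (D : A),
  [/\ D \is a GRing.unit, w ^+ 2 = (tof D)%:A, forall c, w != c%:A,
      integral w & integral w^-1].
Proof.
have [x xF] : exists x : K, x \notin 1%VS.
  apply: contrapT => /forallNP all1.
  have : ({:K} <= 1)%VS by apply/subvP => x _; have /negP := all1 x; rewrite negbK.
  by move/dimvS; rewrite dimK dimv1.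
have freeX : free [:: x; 1] by rewrite free_cons span_seq1 xF /= seq1_free oner_eq0.
have basisX : basis_of {:K} [:: x; 1].
  by rewrite basisEfree freeX subvf dimK.
have := memvf (x ^+ 2); rewrite -(span_basis basisX) span_cons span_seq1.
move=> /memv_addP[_ /vlineP[b ->] [_ /vlineP[a ->] x2]].
pose w0 := x - (b / 2)%:A.
have w0F c : w0 != c%:A.
  apply: contra xF => /eqP w0c; rewrite -[x](subrK (b / 2)%:A) -/w0 w0c.
  by rewrite -scalerDl rpredZ ?mem1v.
have w02 : w0 ^+ 2 = (a + (b / 2) ^+ 2)%:A.
  rewrite /w0 sqrrB x2 -scalerAr mulr1 -[in RHS]/(in_alg K _) rmorphD rmorphXn /=.
  rewrite -[_ ^+ 2](rmorphXn (in_alg K)).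
  have -> : ((b / 2) *: x) *+ 2 = b *: x.
    by rewrite -scaler_nat scalerA mulrCA divff // mulr1.
  by rewrite [b *: x + _]addrC addrK.
have w0n : w0 != 0 by have := w0F 0; rewrite scale0r.
have [e [w [iw ivw Dw]]] := unr w0n.
have q0 : (p%:R ^ e : F) != 0 by rewrite expfz_neq0.
have wF c : w != c%:A.
  apply: contra (w0F (p%:R ^ e * c)) => /eqP wc.
  by rewrite Dw wc pexpz_alg -scalerAr mulr1 scalerA mulrC.
set d : F := (a + (b / 2) ^+ 2) / (p%:R ^ e) ^+ 2.
have w2 : w ^+ 2 = d%:A.
  have qA : (p%:R ^ e)%:A != 0 :> K by rewrite scaler_eq0 negb_or q0 oner_eq0.
  apply: (mulfI (expf_neq0 2 qA)); rewrite -exprMn -pexpz_alg -Dw w02 pexpz_alg.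
  rewrite -[_%:A ^+ 2](rmorphXn (in_alg K)) -[in RHS]/(in_alg K _ * in_alg K _).
  by rewrite -rmorphM /d mulrCA divff ?mulr1 // expf_neq0.
have wn : w != 0 by have := wF 0; rewrite scale0r.
have d0 : d != 0 by apply: contraNneq wn => d0; rewrite -sqrf_eq0 w2 d0 scale0r.
have [D DU dD] : is_tof_unit d.
  apply: (integral_unit (K := K) tof_inj closed d0).
    by rewrite -w2 expr2; exact: integralM_alg.
  by rewrite -w2 expr2 invfM; exact: integralM_alg.
by exists w, D; split=> //; rewrite w2 dD.
Qed.
Lemma quadratic_nonsquare (w : K) (D r : A) : w ^+ 2 = (tof D)%:A ->
  (forall c, w != c%:A) -> r ^+ 2 <> D.
Proof.
move=> w2 wF rD; have /eqP : w ^+ 2 = ((tof r)%:A) ^+ 2.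
  by rewrite w2 -rD rmorphXn; exact: (rmorphXn (in_alg K)).
rewrite eqf_sqr (negPf (wF _)) /= => /eqP wr; have /eqP[] := wF (- tof r).
by rewrite wr scaleNr.
Qed.

(** The unramified quadratic extension of Q_2 is Q_2(sqrt 5). As a norm, 1 - D = N(1 + w) is 4^f
    times a unit. Since D is odd, f > 0; and f > 1 would make D = 1 mod 8 a square. So f = 1. *)
Lemma dyadic_generator (w : K) (D : A) : p = 2%N -> D \is a GRing.unit ->
  w ^+ 2 = (tof D)%:A -> (forall c, w != c%:A) ->
  exists2 v, v \is a GRing.unit & D = 1 - 4 * v.
Proof.
move=> p2 DU w2 wF.
have [n [t [pn Dn]]] := local_residue_unit DU.
have [a Da] : exists a, 1 - D = 2 * a.
  have [q Dq] : exists q, n = q * 2 + 1 by exists (n %/ 2)%Z; rewrite p2 in pn; lia.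
  exists (- (q%:~R + t)); rewrite Dn Dq p2 rmorphD rmorphM /= -[(2 : int)%:~R]/(2 : A); ring.
have w2' : w ^+ 2 = 0 *: w - (- tof D)%:A by rewrite w2 scale0r sub0r scaleNr opprK.
have nz : (1 != 0 :> F) || (1 != 0 :> F) by rewrite oner_eq0.
have [f [u [uU]]] := quad_norm_unramified w2' wF nz.
rewrite mul0r mul0r addr0 expr1n mulr1 -[X in X - _](rmorph1 tof) -rmorphB Da.
have two_p (x : A) : x \is a GRing.unit -> forall y, x <> 2 * y.
  by move=> xU y xy; move: xU; rewrite xy -p2 p_nonunit.
rewrite p2; case: f => f Df.
  have {}Df : 2 * a = 4 ^+ f * u.
    apply: tof_inj; rewrite Df rmorphM rmorphXn !rmorph_nat; congr (_ * _).
    by rewrite -PoszD -exprnP addnn -mul2n exprM; congr (_ ^+ _); ring.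
  have {}Da : D = 1 - 4 ^+ f * u by rewrite -Df -Da; ring.
  case: f Df Da => [|[|f]] Df Da.
  - by have := two_p _ uU a; rewrite Df expr0 mul1r.
  - by exists u; rewrite // Da expr1.
  have [r Dr] := hensel (- (2 * 4 ^+ f * u)).
  case: (quadratic_nonsquare (r := r) w2 wF).
  by rewrite Dr Da p2 !exprS; ring.
case: (two_p _ uU (a * 4 ^+ f.+1)); apply: tof_inj.
rewrite mulrA rmorphM Df rmorphXn rmorph_nat mulrAC.
have -> : (2 : F) ^ (Negz f + Negz f) = (4 ^+ f.+1)^-1.
  rewrite expfzDr // -[2 ^ Negz f]/(2 ^- f.+1) -invfM -exprMn.
  by congr ((_ ^+ _)^-1); ring.
have -> : (4 : F) = 2 * 2 by ring.
by rewrite mulVf ?mul1r // expf_neq0 // mulf_neq0.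
Qed.

Lemma expr_residue (x y : A) k : exists z, (x + p%:R * y) ^+ k = x ^+ k + p%:R * z.
Proof.
elim: k => [|k [z IHk]]; first by exists 0; rewrite !expr0 mulr0 addr0.
by exists (x * z + y * (x ^+ k + p%:R * z)); rewrite exprS IHk exprS; ring.
Qed.

Variable s : {lrmorphism K -> K}.
Hypothesis frob : forall x, integral x ->
  exists2 t, integral t & s x - x ^+ p = p%:R * t.

(** The alternative is s w = w. For odd p, w = w^p modulo p then gives D^((p-1)/2) = 1 modulo p, and
    D is a square by Euler and Hensel. For p = 2, x = (1 + w)/2 satisfies x^2 = x - v, and x = x^2
    modulo 2 contradicts that v is a unit. *)
Lemma frobenius_generator (w : K) (D : A) : D \is a GRing.unit ->
  w ^+ 2 = (tof D)%:A -> (forall c, w != c%:A) -> integral w -> integral w^-1 ->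
  s w = - w.
Proof.
move=> DU w2 wF iw ivw; have /eqP : s w ^+ 2 = w ^+ 2.
  by rewrite -rmorphXn /= w2 linearZ /= rmorph1.
rewrite eqf_sqr => /orP[/eqP sw|/eqP//]; exfalso.
have wn : w != 0 by have := wF 0; rewrite scale0r.
have [p2|p2] := eqVneq p 2%N.
  have [v vU Dv] := dyadic_generator p2 DU w2 wF.
  pose x : K := 2^-1 *: (1 + w).
  have dx : 2 * x = 1 + w.
    by rewrite -scalerAr mulr_natl -scaler_nat scalerA mulVf ?scale1r.
  have K2 : (2 : K) != 0 by rewrite -(rmorph_nat (in_alg K)) fmorph_eq0.
  have x2 : x ^+ 2 = x - (tof v)%:A.
    have Dw : w ^+ 2 = 1 - 4 * (tof v)%:A.
      rewrite w2 Dv rmorphB rmorph1 rmorphM rmorph_nat -![_%:A]/(in_alg K _).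
      by rewrite rmorphB rmorph1 rmorphM rmorph_nat.
    apply: (mulfI K2); apply: (mulfI K2).
    transitivity ((2 * x) ^+ 2); first by ring.
    transitivity (2 * (2 * x) - 4 * (tof v)%:A); last by ring.
    by rewrite dx sqrrD Dw; ring.
  have ix : integral x.
    by apply: (integral_quadratic (T := 1) (N := v)); rewrite rmorph1 scale1r.
  have [t it] := frob ix.
  have -> : s x = x by rewrite /x linearZ rmorphD /= rmorph1 sw.
  rewrite p2 x2 opprB addrC subrK => vt.
  have [a Da] : exists a, tof v / 2 = tof a.
    apply: (@integral_base _ _ tof closed K).
    have -> : (tof v / 2)%:A = t :> K; last exact: it.
    by apply: (mulfI K2); rewrite -vt -(rmorph_nat (in_alg K)) -[LHS](rmorphM (in_alg K)) mulrC divfK.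
  by have := p_nonunit a; rewrite p2 -(_ : v = 2 * a) ?vU //; apply: tof_inj;
     rewrite rmorphM rmorph_nat -Da mulrC divfK.
have op : odd p by case: (even_prime pP) => // /eqP; rewrite (negPf p2).
have Dp : p = (p./2.*2).+1 by rewrite -{1}(odd_double_half p) op.
have [t it] := frob iw; rewrite sw {1}Dp exprS -muln2 mulnC exprM w2 => wt.
have wpA : w * (1 - (tof D)%:A ^+ p./2) = p%:R * t by rewrite mulrBr mulr1 wt.
have [a Da] : exists a, (1 - tof D ^+ p./2) / p%:R = tof a.
  apply: (@integral_base _ _ tof closed K).
  have -> : ((1 - tof D ^+ p./2) / p%:R)%:A = t * w^-1; last exact: integralM_alg.
  rewrite -[LHS]/(in_alg K _) fmorph_div rmorphB rmorph1 rmorphXn rmorph_nat.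
  apply/eqP; rewrite eqr_div //; last by rewrite -(rmorph_nat (in_alg K)) fmorph_eq0.
  by rewrite mulrC wpA mulrC.
have {}Da : 1 - D ^+ p./2 = p%:R * a.
  apply: tof_inj; rewrite rmorphB rmorph1 rmorphXn rmorphM rmorph_nat -Da.
  by rewrite mulrC divfK.
have [n [z [pn Dn]]] := local_residue_unit DU.
have [z' Dz'] := expr_residue n%:~R z p./2.
have /local_dvd_int : (1 - n ^+ p./2)%:~R = p%:R * (a + z').
  by rewrite rmorphB rmorphXn mulrDr -Da Dn Dz' rmorph1; ring.
rewrite -Fp_int_eq0 // rmorphB rmorph1 rmorphXn subr_eq0 => /eqP/esym nh.
have [y] := Fp_euler pP op nh.
rewrite [y]Fp_intE; move: (Posz _) => {}y yn.
have /dvdzP[q Dq] : (p %| n - y ^+ 2)%Z.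
  by rewrite -Fp_int_eq0 // rmorphB rmorphXn /= yn subrr.
have py : ~~ (p %| y)%Z.
  apply: contra pn => py; rewrite -[n](subrK (y ^+ 2)) Dq.
  by rewrite rpredD ?dvdz_mull // dvdz_exp.
have [r Dr] : exists r, r ^+ 2 = D.
  apply: (@local_sqrt _ (z + q%:~R) y op py).
  have -> : D = (n - y ^+ 2)%:~R + y%:~R ^+ 2 + p%:R * z.
    by rewrite Dn rmorphB rmorphXn /=; ring.
  by rewrite Dq rmorphM /= -[(p%:Z)%:~R]/(p%:R); ring.
exact: (quadratic_nonsquare w2 wF Dr).
Qed.
(** For odd p, Z = 1 works by [local_norm_equation]. For p = 2, take Y = 1 and Z = 2: as v and v0
    are odd, D + 4v = 1 + 4(v - v0) is 1 modulo 8, hence a square. *)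
Lemma local_norm_isotropic (w : K) (D v : A) : D \is a GRing.unit ->
  v \is a GRing.unit -> w ^+ 2 = (tof D)%:A -> (forall c, w != c%:A) ->
  exists X Y Z : A, X ^+ 2 - D * Y ^+ 2 = v * Z ^+ 2 /\ [|| X != 0, Y != 0 | Z != 0].
Proof.
move=> DU vU w2 wF; have [p2|p2] := eqVneq p 2%N; last first.
  have op : odd p by case: (even_prime pP) => // /eqP; rewrite (negPf p2).
  have [X [Y XY]] := local_norm_equation op DU vU; exists X, Y, 1.
  by rewrite XY expr1n mulr1 oner_eq0 !orbT.
have [v0 v0U Dv0] := dyadic_generator p2 DU w2 wF.
have odd_unit (z : A) : z \is a GRing.unit -> exists t, z = 1 + 2 * t.
  move=> zU; have [n [t [pn Dz]]] := local_residue_unit zU.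
  have [q Dq] : exists q, n = q * 2 + 1 by exists (n %/ 2)%Z; rewrite p2 in pn; lia.
  exists (q%:~R + t); rewrite Dz Dq p2 rmorphD rmorphM /= -[(2 : int)%:~R]/(2 : A); ring.
have [t Dt] := odd_unit _ vU; have [t0 Dt0] := odd_unit _ v0U.
have [r Dr] := hensel (t - t0); exists r, 1, 2.
split; last by rewrite oner_eq0 orbT.
by rewrite Dr p2 Dv0 Dt Dt0; ring.
Qed.

Section Algebra.
Variables (B : falgType F) (iota : {lrmorphism K -> B}) (u : B) (c : F).
Variables (e : int) (v : A).
Hypothesis dimB : \dim {:B} = 4%N.
Hypothesis conj : forall x, u * iota x = iota (s x) * u.
Hypothesis u2 : u ^+ 2 = c%:A.
Hypothesis vU : v \is a GRing.unit.
Hypothesis Dc : c = p%:R ^ e * tof v.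

Lemma c_neq0 : c != 0.
Proof.
rewrite Dc mulf_neq0 ?expfz_neq0 // -(rmorph0 tof) (inj_eq tof_inj).
by apply: contraTneq vU => ->; rewrite unitr0.
Qed.

(** The reduced norm of alpha + beta u, with alpha and beta in K, is N(alpha) - c N(beta). Norms
    from K have even valuation and c has odd valuation, so the two terms cancel only if both vanish.
    Hence every nonzero element has a left inverse. *)
Lemma odd_valuation_division : odd `|e| -> forall q r : B, q * r = 0 -> q = 0 \/ r = 0.
Proof.
move=> oe; have [w [D [DU w2 wF iw ivw]]] := quadratic_generator.
have sw := frobenius_generator DU w2 wF iw ivw.
pose el (x y : F) : K := x%:A + y *: w.
have sel x y : s (el x y) = el x (- y).
  by rewrite /el rmorphD /= !linearZ /= rmorph1 sw scalerN scaleNr.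
have Nel x y : s (el x y) * el x y = (x ^+ 2 - tof D * y ^+ 2)%:A.
  have w2' : w ^+ 2 = in_alg K (tof D) by rewrite w2.
  rewrite sel /el -!(mulr_algl _ w) -![_%:A]/(in_alg K _).
  by ring: w2'.
pose qu x y z t : B := iota (el x y) + iota (el z t) * u.
pose nq x y z t := (x ^+ 2 - tof D * y ^+ 2) - c * (z ^+ 2 - tof D * t ^+ 2).
have left x y z t :
    (iota (s (el x y)) - iota (el z t) * u) * qu x y z t = (nq x y z t)%:A.
  have cross a b : iota b * u * iota a = iota (s a) * (iota b * u).
    by rewrite -mulrA conj !mulrA -!rmorphM mulrC.
  rewrite /qu mulrDr !mulrBl cross addrA subrK mulrA cross -!mulrA -expr2 u2.
  rewrite !mulrA -!rmorphM !Nel /= !linearZ /= rmorph1 -scalerAl mul1r.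
  by rewrite scalerA -scalerBl [_ * c]mulrC.
have w2' : w ^+ 2 = 0 *: w - (- tof D)%:A by rewrite w2 scale0r sub0r scaleNr opprK.
have Nval x y : (x != 0) || (y != 0) -> exists (f : int) a, a \is a GRing.unit /\
    x ^+ 2 - tof D * y ^+ 2 = p%:R ^ (f + f) * tof a.
  move=> xy0; have [f [a [aU Da]]] := quad_norm_unramified w2' wF xy0.
  by exists f, a; rewrite -Da !mul0r addr0 mulNr.
have unit_neq0 f a : a \is a GRing.unit -> p%:R ^ f * tof a != 0.
  move=> aU; rewrite mulf_neq0 ?expfz_neq0 // -(rmorph0 tof) (inj_eq tof_inj).
  by apply: contraTneq aU => ->; rewrite unitr0.
have nq0 x y z t : nq x y z t = 0 -> [/\ x = 0, y = 0, z = 0 & t = 0].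
  rewrite /nq => /eqP; rewrite subr_eq0.
  case: (boolP ((x != 0) || (y != 0))) => [/Nval[f [a [aU ->]]]|];
  case: (boolP ((z != 0) || (t != 0))) => [/Nval[g [b [bU ->]]]|].
  - rewrite Dc mulrACA -expfzDr // -rmorphM => /eqP/val_inj efg.
    have : f + f = e + (g + g) by apply: efg => //; rewrite unitrM vU.
    by move: oe; lia.
  - rewrite negb_or !negbK => /andP[/eqP-> /eqP->].
    by rewrite expr0n mulr0 subr0 mulr0 (negPf (unit_neq0 _ _ aU)).
  - rewrite negb_or !negbK => /andP[/eqP-> /eqP->].
    by rewrite expr0n mulr0 subr0 eq_sym mulf_eq0 (negPf c_neq0) (negPf (unit_neq0 _ _ bU)).
  - rewrite !negb_or !negbK => /andP[/eqP-> /eqP->] /andP[/eqP-> /eqP->].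
    by [].
have quE x y z t : qu x y z t = x *: 1 + (y *: iota w + (z *: u + t *: (iota w * u))).
  rewrite /qu /el !rmorphD /= !linearZ /= rmorph1 mulrDl -!addrA; congr (_ + (_ + _)).
  by rewrite -!scalerAl mul1r.
(* Multiplying a vanishing combination by its conjugate kills the reduced norm, hence all
   coordinates. As B has dimension 4, these elements form a basis and every element of B is covered
   by [left]. *)
have freeX : free [:: 1; iota w; u; iota w * u].
  apply/(freeP (X := in_tuple _)) => k.
  rewrite !big_ord_recl big_ord0 addr0 /= -quE => qu0.
  have := left (k ord0) (k (lift ord0 ord0)) (k (lift ord0 (lift ord0 ord0)))
    (k (lift ord0 (lift ord0 (lift ord0 ord0)))).
  rewrite qu0 mulr0 => /esym/eqP; rewrite scaler_eq0 oner_eq0 orbF.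
  move=> /eqP/nq0[k0 k1 k2 k3].
  case=> -[|[|[|[|i]]]] // lti; [rewrite -[RHS]k0 | rewrite -[RHS]k1 |
     rewrite -[RHS]k2 | rewrite -[RHS]k3]; by apply: (f_equal k); apply: ord_inj.
have basX : basis_of {:B} [:: 1; iota w; u; iota w * u].
  by rewrite basisEfree freeX subvf dimB.
have span q : exists x y z t, q = qu x y z t.
  have := coord_basis (X := in_tuple _) basX (memvf q).
  rewrite !big_ord_recl big_ord0 addr0 /= => Dq.
  by do 4!eexists; rewrite quE; exact: Dq.
move=> q r qr0; have [x [y [z [t Dq]]]] := span q.
have [/nq0[x0 y0 z0 t0]|n0] := eqVneq (nq x y z t) 0.
  by left; rewrite Dq /qu /el x0 y0 z0 t0 !scale0r addr0 rmorph0 mul0r addr0.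
right; have := congr1 (fun b => (iota (s (el x y)) - iota (el z t) * u) * b) qr0.
rewrite mulr0 mulrA Dq left -scalerAl mul1r => /eqP.
by rewrite scaler_eq0 (negPf n0) /= => /eqP.
Qed.

(** After rescaling u by a power of p its square is the unit v. An isotropic vector of X^2 - D Y^2 -
    v Z^2 then gives conjugate factors X + Y w + Z u' and X - Y w - Z u' with product 0. *)
Lemma even_valuation_zero_divisor : ~~ odd `|e| ->
  exists q r : B, [/\ q != 0, r != 0 & q * r = 0].
Proof.
move=> ee; have [w [D [DU w2 wF iw ivw]]] := quadratic_generator.
have sw := frobenius_generator DU w2 wF iw ivw.
have [X [Y [Z [XYZ nz]]]] := local_norm_isotropic DU vU w2 wF.
have [f De] : exists f : int, e = f + f by exists (e %/ 2)%Z; lia.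
have f0 : p%:R ^ f != 0 :> F by rewrite expfz_neq0.
have [u' [u'2 anti]] : exists u' : B,
    u' ^+ 2 = (tof v)%:A /\ u' * iota w = - (iota w * u').
  exists ((p%:R ^ f)^-1 *: u); split.
    rewrite exprZn u2 scalerA; congr (_ *: _).
    by rewrite Dc De expfzDr //; field.
  by rewrite -scalerAl conj sw rmorphN /= mulNr scalerN -scalerAr.
have tof0 a : (tof a == 0) = (a == 0) by rewrite -(rmorph0 tof) (inj_eq tof_inj).
pose q (x y z : F) := iota (x%:A + y *: w) + z *: u'.
have wn : w != 0 by have := wF 0; rewrite scale0r.
(* If z were nonzero, u' would lie in the image of K and commute with w. As it also anticommutes
   with w, it would be 0, against u'^2 = v. *)
have q_eq0 x y z : q x y z = 0 -> [/\ x = 0, y = 0 & z = 0].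
  move=> q0; have [z0|z0] := eqVneq z 0.
    move: q0; rewrite /q z0 scale0r addr0 => /eqP; rewrite fmorph_eq0 => /eqP.
    by case/(quad_elem_eq0 wF) => -> ->.
  have [a Du'] : exists a, u' = iota a.
    exists ((- z^-1) *: (x%:A + y *: w)).
    apply: (scalerI z0); rewrite linearZ /= scalerA mulrN divff // scaleN1r.
    by apply/eqP; rewrite -addr_eq0 addrC -/(q x y z) q0.
  move: anti; rewrite Du' -!rmorphM -rmorphN => /fmorph_inj /eqP.
  rewrite -addr_eq0 [w * _]mulrC -mulr2n -mulr_natl mulf_eq0.
  rewrite -[X in X == 0](rmorph_nat (in_alg K)) fmorph_eq0 (negPf two0) /=.
  rewrite mulf_eq0 (negPf wn) orbF => /eqP a0.
  move/eqP: u'2; rewrite Du' a0 rmorph0 expr0n eq_sym scaler_eq0 oner_eq0 orbF tof0.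
  by move=> /eqP v0; move: vU; rewrite v0 unitr0.
have q_neq0 x y z : [|| x != 0, y != 0 | z != 0] -> q (tof x) (tof y) (tof z) != 0.
  apply: contraTneq => /q_eq0[/eqP + /eqP + /eqP].
  by rewrite !tof0 => -> -> ->.
exists (q (tof X) (tof Y) (tof Z)), (q (tof X) (- tof Y) (- tof Z)).
split; first exact: q_neq0.
  by rewrite -!rmorphN; apply: q_neq0; rewrite !oppr_eq0.
have swap x y : u' * iota (x%:A + (- y) *: w) = iota (x%:A + y *: w) * u'.
  rewrite !rmorphD /= !linearZ /= rmorph1 mulrDr mulrDl -!scalerAr -!scalerAl mulr1 mul1r.
  by rewrite anti scaleNr scalerN opprK.
have w2' : w ^+ 2 = in_alg K (tof D) by rewrite w2.
have el2 : (((tof X)%:A + tof Y *: w) * ((tof X)%:A + - tof Y *: w) : K) =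
    (tof (X ^+ 2 - D * Y ^+ 2))%:A.
  rewrite -!(mulr_algl _ w) -![_%:A]/(in_alg K _).
  by ring: w2'.
rewrite /q; move: el2 (swap (tof X) (tof Y)).
set a := (_ + tof Y *: w); set b := (_ + - tof Y *: w) => el2 ab.
rewrite scaleNr mulrBr !mulrDl -!scalerAl ab -!scalerAr -expr2 u'2 opprD addrA addrK.
rewrite -rmorphM /= el2 XYZ linearZ /= rmorph1 !scalerA -scalerBl.
by rewrite (_ : _ - _ = 0) ?scale0r // rmorphM rmorphXn /=; ring.
Qed.
End Algebra.
End UnramifiedQuadratic.
End LocalQuadratic.

(** * Zero divisors determine the invariant of an algebra of dimension 4 *)

Definition half : QmodZ := QmodZ_of (1 / 2).

Lemma QmodZ_ofP (x y : rat) : (QmodZ_of x == QmodZ_of y) = (x - y \is a Num.int).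
Proof. by rewrite /QmodZ_of -Quotient.idealrBE. Qed.

Lemma QmodZ_ofD (x y : rat) : QmodZ_of (x + y) = QmodZ_of x + QmodZ_of y.
Proof. by rewrite /QmodZ_of raddfD. Qed.

Lemma QmodZ_of0 : QmodZ_of 0 = 0.
Proof. by rewrite /QmodZ_of raddf0. Qed.

Lemma halfD : half + half = 0.
Proof.
apply/eqP; rewrite -QmodZ_ofD -QmodZ_of0 QmodZ_ofP subr0.
by rewrite (_ : 1 / 2 + 1 / 2 = 1) ?rpred1.
Qed.

Lemma half_neq0 : half != 0.
Proof.
rewrite -QmodZ_of0 QmodZ_ofP subr0; apply/negP => /intrP[k].
move/(congr1 ( *%R^~ 2)); rewrite divfK // -[RHS](rmorphM intr k 2) => /eqP.
by rewrite -[1]/(1%:~R) eqr_int => /eqP; lia.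
Qed.

Lemma QmodZ_of_half (e : int) : QmodZ_of (e%:~R / 2) = if odd `|e| then half else 0.
Proof.
have [q ->] : exists q : int, e = q * 2 + (odd `|e|)%:Z.
  by exists (e %/ 2)%Z; lia.
rewrite rmorphD rmorphM mulrDl mulfK // QmodZ_ofD.
have -> : QmodZ_of q%:~R = 0.
  by apply/eqP; rewrite -QmodZ_of0 QmodZ_ofP subr0 rpred_int.
rewrite add0r (_ : odd `|_| = odd `|e|); last by lia.
by case: odd; rewrite ?mul0r ?QmodZ_of0.
Qed.

Section PadicInvariant.
Variable p : prime_nat.
Local Notation Zp := (padic_int p).
Local Notation F := (padic p).

Lemma padic_two_neq0 : (2 : F) != 0.
Proof.
rewrite -(rmorph_nat (@tofrac Zp)) tofrac_eq0.
by rewrite -[2]/((2 : int)%:~R) padic_int_eq0.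
Qed.

Lemma tofrac_inj : injective (@tofrac Zp).
Proof. by move=> x y /eqP; rewrite tofrac_eq => /eqP. Qed.

Lemma padic_residue (z : Zp) : exists (n : int) (t : Zp), z = n%:~R + p%:R * t.
Proof. by have [t Dz] := padic_approx z 1; exists (z 1%N), t. Qed.

Lemma padic_hensel (t : Zp) : exists v, v ^+ 2 = 1 + 4 * p%:R * t.
Proof. by have [v Dv] := padic_sqrt t; exists (1 + 2 * p%:R * v). Qed.

Lemma padic_val_inj (e f : int) (u v : Zp) : u \is a GRing.unit ->
  v \is a GRing.unit -> p%:R ^ e * tofrac u = p%:R ^ f * tofrac v -> e = f.
Proof.
move=> uU vU uv; apply: (@padic_valuation_inj p (p%:R ^ e * tofrac u)).
  by exists u.
by exists v.
Qed.

Section DimFour.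
Variable B : falgType F.
Hypothesis dimB : \dim {:B} = 4%N.

(** This makes the invariant well defined: dimension 4 forces n = 2, and the parity of e, hence q,
    can be read off from the existence of zero divisors in B. *)
Lemma is_padic_invariant_cases (q : QmodZ) : is_padic_invariant B q ->
  (q = half /\ forall x y : B, x * y = 0 -> x = 0 \/ y = 0) \/
  (q = 0 /\ exists x y : B, [/\ x != 0, y != 0 & x * y = 0]).
Proof.
move=> [n [K [s [iota [u [c [e [[n0 dimBn dimK] [[unr frob conj un [v vU Dc]] ->]]]]]]]]].
have n2 : n = 2%N by move: dimBn; rewrite dimB; nia.
rewrite {}n2 in dimK un *; rewrite QmodZ_of_half.
case: (boolP (odd `|e|)) => oe; [left | right]; split=> //.
  exact: (odd_valuation_division (prime_valP p) tofrac_inj (@padic_int_closed p)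
    (padic_p_neq0 p) padic_two_neq0 (@padic_unit1 p) (@padic_p_nonunit p)
    padic_residue padic_hensel padic_val_inj unr dimK frob dimB conj un vU Dc oe).
exact: (even_valuation_zero_divisor (prime_valP p) tofrac_inj (@padic_int_closed p)
    (padic_p_neq0 p) padic_two_neq0 (@padic_unit1 p) (@padic_p_nonunit p)
    padic_residue padic_hensel unr dimK frob dimB conj un vU Dc oe).
Qed.

Lemma padic_invariant_zero_divisor (x y : B) : x != 0 -> y != 0 -> x * y = 0 ->
  padic_invariant B = 0.
Proof.
(* If no invariant exists, the default of [xget] is 0 as well, so no embedding of a field into B has
   to be produced here. *)
move=> x0 y0 xy; rewrite /padic_invariant; case: xgetP => // q _.
case/is_padic_invariant_cases => [[_ div]|[]//].
by case: (div _ _ xy) => /eqP; rewrite ?(negPf x0) ?(negPf y0).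
Qed.

Lemma padic_invariant_division (q : QmodZ) :
  (forall x y : B, x * y = 0 -> x = 0 \/ y = 0) -> is_padic_invariant B q ->
  padic_invariant B = half.
Proof.
move=> div qB; rewrite /padic_invariant; case: xgetP => [r _|/(_ q)//].
case/is_padic_invariant_cases => [[]//|[_ [x [y [x0 y0 /div[]/eqP]]]]].
  by rewrite (negPf x0).
by rewrite (negPf y0).
Qed.
End DimFour.
End PadicInvariant.

Section QuadraticMorphism.
Variables (F : fieldType) (K : fieldExtType F) (theta : K) (T N : F).
Hypothesis theta2 : theta ^+ 2 = T *: theta - N%:A.
Hypothesis thetaNF : forall c : F, theta != c%:A.
Hypothesis dimK : \dim {:K} = 2%N.
Local Notation elem x y := (x%:A + y *: theta : K).

Lemma quad_span (x : K) : exists a b, x = elem a b.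
Proof.
have freeX : free [:: theta; 1].
  rewrite free_cons span_seq1 seq1_free oner_eq0 andbT.
  by apply/negP => /vlineP[c tc]; have /eqP := thetaNF c.
have basisX : basis_of {:K} [:: theta; 1] by rewrite basisEfree freeX subvf dimK.
have := memvf x; rewrite -(span_basis basisX) span_cons span_seq1.
move=> /memv_addP[_ /vlineP[b ->] [_ /vlineP[a ->] ->]].
by exists a, b; rewrite addrC.
Qed.

Lemma quad_lrmorphism (B : falgType F) (j : B) : j ^+ 2 = T *: j - N%:A ->
  exists phi : {lrmorphism K -> B}, forall x y, phi (elem x y) = x%:A + y *: j.
Proof.
move=> j2; have span x : exists ab : F * F, x = elem ab.1 ab.2.
  by have [a [b ->]] := quad_span x; exists (a, b).
have [c Dc] := choice span.
pose phi (x : K) : B := (c x).1%:A + (c x).2 *: j.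
have phiE x y : phi (elem x y) = x%:A + y *: j.
  have := Dc (elem x y) => /eqP; rewrite -subr_eq0 opprD addrACA -!scalerBl.
  move=> /eqP/(quad_elem_eq0 thetaNF)[/eqP + /eqP].
  by rewrite !subr_eq0 /phi => /eqP<- /eqP<-.
have linphi : linear phi.
  move=> k x y; have [a [b ->]] := quad_span x; have [a' [b' ->]] := quad_span y.
  rewrite scalerDr !scalerA addrACA -!scalerDl !phiE.
  by rewrite scalerDr !scalerA addrACA -!scalerDl.
have mulphi : monoid_morphism phi.
  split=> [|x y]; first by have := phiE 1 0; rewrite !scale0r !addr0 !scale1r.
  have [a [b ->]] := quad_span x; have [a' [b' ->]] := quad_span y.
  have comb (X Y Z U V : B) : X + Y + (Z + (U - V)) = X - V + (Y + Z + U).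
    by rewrite !addrA ![X - V + _]addrAC ![_ - V + _]addrAC.
  rewrite (quad_elemM theta2) !phiE mulrDl !mulrDr mulr_algl mulr_algr mulr_algl.
  rewrite -scalerAl -scalerAr -expr2 j2 !scalerA scalerBr !scalerA comb.
  rewrite -scalerBl -!scalerDl; congr (_ *: _ + _ *: _); ring.
pose LF := GRing.isLinear.Build F K B *:%R phi linphi.
pose MF := GRing.isMonoidMorphism.Build K B phi mulphi.
pose psi : {lrmorphism K -> B} := HB.pack phi LF MF.
by exists psi.
Qed.
End QuadraticMorphism.

(** * Construction of the unramified quadratic extension and its Frobenius *)

Section UnramifiedConstruction.
Variables (p : nat) (A : idomainType) (F : fieldType) (tof : {rmorphism A -> F}).
Hypothesis pP : prime p.
Hypothesis tof_inj : injective tof.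
Hypothesis closed : forall c, integralOver tof c -> exists a, c = tof a.
Hypothesis p0 : p%:R != 0 :> F.
Hypothesis p_nonunit : forall z : A, (p%:R * z) \is a GRing.unit = false.
Hypothesis residue : forall z : A, exists (n : int) (t : A), z = n%:~R + p%:R * t.
Hypothesis val_exists : forall c : F, c != 0 ->
  exists (e : int) u, u \is a GRing.unit /\ c = p%:R ^ e * tof u.
Variables T N : A.
Hypothesis anisotropic : forall c d : A,
  (c \is a GRing.unit) || (d \is a GRing.unit) ->
  (c ^+ 2 + T * c * d + N * d ^+ 2) \is a GRing.unit.

Lemma pexpz_tof (e f : int) (u : A) : e <= f ->
  exists a : A, p%:R ^ f * tof u = p%:R ^ e * tof a.
Proof.
move=> ef; exists (p%:R ^+ `|f - e| * u).
rewrite rmorphM rmorphXn rmorph_nat mulrA -[_ ^+ `|f - e|]/(p%:R ^ `|f - e|%N%:Z).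
by rewrite -expfzDr // gez0_abs ?subr_ge0 // subrKC.
Qed.

Lemma primitive_pair (x y : F) : (x != 0) || (y != 0) ->
  exists (e : int) c d, [/\ (c \is a GRing.unit) || (d \is a GRing.unit),
    x = p%:R ^ e * tof c & y = p%:R ^ e * tof d].
Proof.
have [->|x0] := eqVneq x 0.
  move=> /= /val_exists[e [u [uU ->]]]; exists e, 0, u.
  by rewrite uU orbT rmorph0 mulr0.
move=> _; have [->|y0] := eqVneq y 0.
  have [e [u [uU ->]]] := val_exists x0; exists e, u, 0.
  by rewrite uU rmorph0 mulr0.
have [e [u [uU Dx]]] := val_exists x0; have [f [v [vU Dy]]] := val_exists y0.
have [ef|/ltW fe] := leP e f.
  by have [a Da] := pexpz_tof v ef; exists e, u, a; rewrite uU Dx Dy Da.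
by have [a Da] := pexpz_tof u fe; exists f, a, v; rewrite vU orbT Dx Dy Da.
Qed.

Lemma tof_eq0 (a : A) : (tof a == 0) = (a == 0).
Proof. by rewrite -(rmorph0 tof) (inj_eq tof_inj). Qed.

Lemma unit_tof_neq0 (a : A) : a \is a GRing.unit -> tof a != 0.
Proof. by move=> aU; rewrite tof_eq0; apply: contraTneq aU => ->; rewrite unitr0. Qed.

(** A root r of X^2 - T X + N would make the norm form vanish at (-r, 1). Scaled to a primitive
    pair, this contradicts anisotropy modulo p. *)
Lemma quad_field_exists : exists (K : fieldExtType F) (theta : K),
  [/\ \dim {:K} = 2%N, theta ^+ 2 = tof T *: theta - (tof N)%:A &
      forall c, theta != c%:A].
Proof.
pose P : {poly F} := 'X^2 - (tof T *: 'X - (tof N)%:P).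
have sQ : (size (- (tof T *: 'X - (tof N)%:P)) < 3)%N.
  rewrite size_polyN; apply: leq_ltn_trans (size_polyD _ _) _; rewrite size_polyN gtn_max.
  rewrite (leq_ltn_trans (size_scale_leq _ _)) ?size_polyX //=.
  exact: leq_ltn_trans (size_polyC_leq1 _) _.
have sP : size P = 3 by rewrite size_polyDl size_polyXn.
have noroot r : ~~ root P r.
  rewrite /root !hornerE; apply/negP => /eqP r2.
  have nz : (- r != 0) || (1 != 0 :> F) by rewrite oner_eq0 orbT.
  have [e [c [d [cdU Dr D1]]]] := primitive_pair nz.
  have /unit_tof_neq0 := anisotropic cdU.
  have q0 : p%:R ^ e != 0 :> F by rewrite expfz_neq0.
  case/eqP; apply: (mulfI (expf_neq0 2 q0)); rewrite mulr0 -[RHS]r2.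
  rewrite !(rmorphXn, rmorphD, rmorphM) /=.
  transitivity ((p%:R ^ e * tof c) ^+ 2 + tof T * (p%:R ^ e * tof c) * (p%:R ^ e * tof d)
     + tof N * (p%:R ^ e * tof d) ^+ 2); first by ring.
  by rewrite -Dr -D1; ring.
have [K dimK [theta rt _]] : {K : fieldExtType F & \dim {:K} = (size P).-1 &
    {z | root (map_poly (in_alg K) P) z & <<1; z>>%VS = fullv}}.
  by apply: irredp_FAdjoin; apply: cubic_irreducible => //; rewrite sP.
exists K, theta; split; first by rewrite dimK sP.
  move: rt; rewrite /root !rmorphB /= map_polyXn map_polyZ map_polyX map_polyC /=.
  rewrite !hornerE mulr_algl subr_eq0 => /eqP.
  done.
move=> c; apply: contra (noroot c) => /eqP tc.
by rewrite -(fmorph_root (in_alg K)) /= -tc.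
Qed.

Variables (K : fieldExtType F) (theta : K).
Hypothesis theta2 : theta ^+ 2 = tof T *: theta - (tof N)%:A.
Hypothesis thetaNF : forall c : F, theta != c%:A.
Hypothesis dimK : \dim {:K} = 2%N.
Local Notation integral := (integralOver (fun t : A => (tof t)%:A : K)).
Local Notation elem x y := (x%:A + y *: theta : K).
Local Notation norm c d := (c ^+ 2 + T * c * d + N * d ^+ 2).

Lemma quad_elem_integral (c d : A) : integral (elem (tof c) (tof d)).
Proof.
apply: (integral_quadratic (T := c + c + T * d) (N := norm c d)).
rewrite expr2 (quad_elemM theta2) scalerDr !scalerA [in RHS]addrAC -scalerBl -!rmorphM.
rewrite -!rmorphD -!rmorphB.
by congr ((tof _)%:A + tof _ *: _); ring.
Qed.

Lemma quad_elem_inv (c d : A) : norm c d \is a GRing.unit ->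
  (elem (tof c) (tof d))^-1 =
  elem (tof ((c + T * d) / norm c d)) (tof (- d / norm c d)).
Proof.
move=> nU; have e0 : elem (tof c) (tof d) != 0.
  apply/eqP => /(quad_elem_eq0 thetaNF)[/eqP + /eqP]; rewrite !tof_eq0 => /eqP c0 /eqP d0.
  by move: nU; rewrite c0 d0 !(mulr0, expr0n, addr0) unitr0.
apply: (mulfI e0); rewrite divff // (quad_elemM theta2) -!rmorphM -!rmorphD -rmorphB.
rewrite (_ : _ + _ + _ = 0) ?rmorph0 ?scale0r ?addr0; last by ring.
rewrite (_ : _ - _ = norm c d / norm c d); last by ring.
by rewrite divrr // rmorph1 scale1r.
Qed.

Lemma quad_unramified (x : K) : x != 0 -> exists e : int, exists w : K,
  [/\ integral w, integral w^-1 & x = p%:R ^ e * w].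
Proof.
have [a [b ->]] := quad_span thetaNF dimK x => xy0.
have ab0 : (a != 0) || (b != 0).
  by apply: contraNT xy0; rewrite negb_or !negbK => /andP[/eqP-> /eqP->]; rewrite !scale0r addr0.
have [e [c [d [cdU Da Db]]]] := primitive_pair ab0.
exists e, (elem (tof c) (tof d)); split; first exact: quad_elem_integral.
  by rewrite quad_elem_inv ?anisotropic //; exact: quad_elem_integral.
by rewrite pexpz_alg -scalerAl mul1r scalerDr !scalerA Da Db.
Qed.

(** O_K = Z_p[theta]: if x = p^e (c + d [theta]) with (c, d) primitive, then the norm of x is p^(2e)
    times a unit and is integral, so e >= 0. *)
Lemma quad_integral_elem (x : K) : integral x -> exists c d, x = elem (tof c) (tof d).
Proof.
have [a [b ->]] := quad_span thetaNF dimK x => ix.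
have [/orP ab0|] := boolP ((a != 0) || (b != 0)); last first.
  rewrite negb_or !negbK => /andP[/eqP-> /eqP->].
  by exists 0, 0; rewrite rmorph0.
have [e [c [d [cdU Da Db]]]] := primitive_pair (introT orP ab0).
suff e0 : 0 <= e.
  exists (p%:R ^+ `|e| * c), (p%:R ^+ `|e| * d).
  rewrite !rmorphM rmorphXn rmorph_nat -[_ ^+ `|e|]/(p%:R ^ `|e|%N%:Z) gez0_abs //.
  by rewrite Da Db.
have := integralM_alg ix (integral_conj theta2 thetaNF ix).
rewrite (quad_elemM theta2) (_ : _ + _ + _ = 0) ?scale0r ?addr0; last by ring.
move=> /(integral_base closed)[r Dr].
have {}Dr : p%:R ^ (e + e) * tof (norm c d) = tof r.
  rewrite -Dr Da Db !(rmorphXn, rmorphD, rmorphM) /= expfzDr //.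
  by ring.
rewrite leNgt; apply/negP => e0.
have := anisotropic cdU.
have -> : norm c d = p%:R * (p%:R ^+ (absz (e + e)).-1 * r).
  apply: tof_inj; rewrite [p%:R * (_ * r)]mulrA -exprS prednK; last by lia.
  rewrite [RHS]rmorphM -Dr rmorphXn rmorph_nat [RHS]mulrA.
  rewrite -[p%:R ^+ _]/(p%:R ^ (absz (e + e))%:Z) -expfzDr //.
  by rewrite ltz0_abs ?addNr ?expr0z ?mul1r; last by lia.
by rewrite p_nonunit.
Qed.

Lemma fermat_residue (c : A) : exists t, c ^+ p = c + p%:R * t.
Proof.
have [n [t ->]] := residue c; have [z ->] := expr_residue p n%:~R t p.
have /dvdzP[q Dq] : (p %| n ^+ p - n)%Z.
  rewrite -Fp_int_eq0 // rmorphB rmorphXn /=.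
  by have := expf_card (n%:~R : 'F_p); rewrite card_Fp // => ->; rewrite subrr.
exists (q%:~R + z - t).
rewrite -[n%:~R ^+ p]rmorphXn -[n ^+ p](subrK n) Dq rmorphD rmorphM /=.
by rewrite -[(p%:Z)%:~R]/(p%:R); ring.
Qed.

Lemma freshman_integral (x y : K) : integral x -> integral y ->
  exists2 t, integral t & (x + y) ^+ p = x ^+ p + y ^+ p + p%:R * t.
Proof.
move=> ix iy.
have int_nat k : integral k%:R by exact: (@integral_nat _ _ (in_alg K \o tof)).
have int_exp z k : integral z -> integral (z ^+ k).
  move=> iz; elim: k => [|k IHk]; last by rewrite exprS; exact: integralM_alg.
  by rewrite expr0; exact: int_nat 1%N.
exists (\sum_(1 <= i < p) x ^+ (p - i) * y ^+ i * ('C(p, i) %/ p)%N%:R).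
  apply: (big_ind integral).
  - exact: int_nat 0%N.
  - exact: integralD_alg.
  by move=> i _; do 2!apply: integralM_alg => //; exact: int_exp.
rewrite exprDn -(big_mkord predT (fun i => (x ^+ (p - i) * y ^+ i) *+ 'C(p, i))).
rewrite big_nat_recr //= big_ltn ?prime_gt0 // subn0 subnn binn bin0 expr0 mulr1 mul1r.
rewrite -!addrA; congr (_ + _); rewrite addrC; congr (_ + _).
rewrite mulr_sumr big_nat [RHS]big_nat; apply: eq_bigr => i ip.
rewrite mulrCA -natrM mulnC divnK ?mulr_natr //.
by apply: prime_dvd_bin.
Qed.

Hypothesis theta_p : theta ^+ p = (tof T)%:A - theta.

(** In both applications [theta] is a root of unity, so [theta] ^ p equals the conjugate exactly,
    not only modulo p. On Z_p[theta] the congruence follows from Fermat on the coefficients and the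
    additivity of p-th powers modulo p. *)
Lemma quad_frobenius (s : {lrmorphism K -> K}) (x : K) :
  s theta = (tof T)%:A - theta -> integral x ->
  exists2 t, integral t & s x - x ^+ p = p%:R * t.
Proof.
move=> sth ix; have [c [d Dx]] := quad_integral_elem ix.
have tofI a : integral ((tof a)%:A : K) by exact: integral_algebra_int.
have tI : integral theta.
  by have := quad_elem_integral 0 1; rewrite rmorph0 rmorph1 scale0r scale1r add0r.
have [t it Dt] := freshman_integral (tofI c) (integralM_alg (tofI d) tI).
have [c' Dc'] := fermat_residue c; have [d' Dd'] := fermat_residue d.
exists (- (tof c')%:A - (tof d')%:A * ((tof T)%:A - theta) - t).
  apply: integralB_alg => //; apply: integralB_alg.
    by rewrite -scaleNr -rmorphN.
  by apply: integralM_alg => //; exact: integralB_alg.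
have cp (a a' : A) : a ^+ p = a + p%:R * a' ->
    ((tof a)%:A : K) ^+ p = (tof a)%:A + p%:R * (tof a')%:A.
  move=> Da; rewrite -[LHS](rmorphXn (in_alg K)) -rmorphXn Da.
  rewrite -[LHS]/(in_alg K _) !(rmorphD, rmorphM) /=.
  by rewrite rmorph_nat scaler_nat.
have -> : s x = (tof c)%:A + (tof d)%:A * ((tof T)%:A - theta).
  by rewrite Dx rmorphD /= !linearZ /= rmorph1 sth mulr_algl.
rewrite Dx -(mulr_algl _ theta) Dt exprMn theta_p (cp _ _ Dc') (cp _ _ Dd').
by ring.
Qed.
End UnramifiedConstruction.

Section PadicExistence.
Variable p : prime_nat.
Local Notation Zp := (padic_int p).
Local Notation F := (padic p).

Lemma padic_val_exists (c : F) : c != 0 ->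
  exists (e : int) u, u \is a GRing.unit /\ c = p%:R ^ e * tofrac u.
Proof. by move=> /padic_valuation_exists[e [u uU Dc]]; exists e, u. Qed.

(** Reduces the invariant to two elements of B: j, the image of [theta], generates a copy of the
    unramified field, and u induces the Frobenius on it by conjugation. *)
Lemma is_padic_invariant_exists (T N : Zp) (B : falgType F) (j u : B) (c : F) (e : int) :
  (forall c d : Zp, (c \is a GRing.unit) || (d \is a GRing.unit) ->
     (c ^+ 2 + T * c * d + N * d ^+ 2) \is a GRing.unit) ->
  (forall (K : fieldExtType F) (theta : K),
     theta ^+ 2 = tofrac T *: theta - (tofrac N)%:A ->
     theta ^+ p = (tofrac T)%:A - theta) ->
  \dim {:B} = 4%N ->
  j ^+ 2 = tofrac T *: j - (tofrac N)%:A ->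
  u * j = ((tofrac T)%:A - j) * u -> u ^+ 2 = c%:A -> padic_valuation c e ->
  is_padic_invariant B (QmodZ_of (e%:~R / 2)).
Proof.
move=> anis thp dimB j2 uj u2 vc.
have [K [theta [dimK th2 thF]]] := quad_field_exists (@tofrac_inj p) (padic_p_neq0 p)
  padic_val_exists anis.
have cj2 : ((tofrac T)%:A - theta) ^+ 2 = tofrac T *: ((tofrac T)%:A - theta) - (tofrac N)%:A.
  rewrite -!(mulr_algl _ ((tofrac T)%:A - theta)) sqrrB th2 -!(mulr_algl _ theta).
  by ring.
have [s sE] := quad_lrmorphism th2 thF dimK cj2.
have [iota iE] := quad_lrmorphism th2 thF dimK j2.
have sth : s theta = (tofrac T)%:A - theta.
  by have := sE 0 1; rewrite !scale0r !scale1r !add0r.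
exists 2%N, K, s, iota, u, c, e; split; first by rewrite dimB dimK.
split=> //; split=> //.
- exact: (quad_unramified (@tofrac_inj p) (padic_p_neq0 p) padic_val_exists anis th2 thF dimK).
- move=> x; exact: (quad_frobenius (prime_valP p) (@tofrac_inj p) (@padic_int_closed p)
    (padic_p_neq0 p) (@padic_p_nonunit p) (@padic_residue p) padic_val_exists anis
    th2 thF dimK (thp _ _ th2) sth).
move=> x; have [a [b ->]] := quad_span thF dimK x.
rewrite iE sE scalerBr scalerA addrA -scalerDl -scaleNr iE.
rewrite mulrDr mulrDl -!scalerAr -!scalerAl mulr1 mul1r uj.
rewrite mulrBl scalerBr -scalerAl mul1r scalerA addrA -scalerDl.
by rewrite scaleNr.
Qed.
End PadicExistence.

Lemma padic_invariantE (p : prime_nat) (B : falgType (padic p)) (q : QmodZ) :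
  \dim {:B} = 4%N -> is_padic_invariant B q -> padic_invariant B = q.
Proof.
move=> dimB qB; case: (is_padic_invariant_cases dimB qB) => [[-> div]|[-> [x [y [x0 y0 xy]]]]].
  exact: padic_invariant_division div qB.
exact: padic_invariant_zero_divisor x0 y0 xy.
Qed.

(** * The invariants of the quaternion algebras (a, -1) *)

Lemma dim_quaternion (F : fieldType) (a b : F) : \dim {:quaternion a b} = 4%N.
Proof. by rewrite dimvf /dim /=. Qed.

(** With a = r^2 + s^2, the element r + i + s j has reduced norm r^2 - a + s^2 = 0; the second
    factor is its conjugate. *)
Lemma quaternion_zero_divisor (F : fieldType) (r s : F) :
  exists x y : quaternion (r ^+ 2 + s ^+ 2) (- 1), [/\ x != 0, y != 0 & x * y = 0].
Proof.
exists (quat _ _ r 1 s 0), (quat _ _ r (- 1) (- s) 0); split.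
- by apply/eqP => /rowP/(_ 1)/eqP; rewrite !mxE /= oner_eq0.
- by apply/eqP => /rowP/(_ 1)/eqP; rewrite !mxE /= oppr_eq0 oner_eq0.
by apply: quat_eqP; rewrite !(quatE, mxE); ring.
Qed.

Lemma quaternion_gaussian (F : fieldType) (a : F) :
  let B : falgType F := quaternion a (- 1) in
  let i : B := quat_i a (- 1) in let j : B := quat_j a (- 1) in
  [/\ j ^+ 2 = 0 *: j - 1%:A, i * j = (0%:A - j) * i & i ^+ 2 = a%:A].
Proof.
by split; apply: quat_eqP; rewrite !(quatE, mxE) /=; ring.
Qed.

Lemma expr_sqrtN1 (R : nzRingType) (x : R) (n : nat) :
  (n %% 4 = 3)%N -> x ^+ 2 = - 1 -> x ^+ n = - x.
Proof.
move=> n3 x2; have -> : n = (1 + 2 * (n./2))%N by lia.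
have on : odd n./2 by lia.
by rewrite exprD expr1 exprM x2 -signr_odd on mulrN1.
Qed.

Lemma sum2sq_sqrtN1 (F : fieldType) (a i : F) : 2 != 0 :> F -> i ^+ 2 = - 1 ->
  a = ((a + 1) / 2) ^+ 2 + ((a - 1) / 2 * i) ^+ 2.
Proof.
move=> two0 i2; rewrite [(_ * i) ^+ 2]exprMn i2.
by field.
Qed.

(* With i' = (r i + s ij) / a and k' = i' j, these are the Hurwitz unit
   (- 1 + i' + j + k') / 2 of order 3 and i' - j. *)
Lemma quaternion_hurwitz (F : fieldType) (r s : F) :
  let B : falgType F := quaternion (- (r ^+ 2 + s ^+ 2)) (- 1) in
  2 != 0 :> F -> r ^+ 2 + s ^+ 2 != 0 -> exists j u : B,
  [/\ j ^+ 2 = (- 1) *: j - 1%:A, u * j = ((- 1)%:A - j) * u & u ^+ 2 = (- 2)%:A].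
Proof.
move=> B two0 rs0.
pose a := - (r ^+ 2 + s ^+ 2).
exists (quat _ _ (- 1 / 2) ((r - s) / (2 * a)) (1 / 2) ((r + s) / (2 * a)) : B),
  (quat _ _ 0 (r / a) (- 1) (s / a) : B).
by split; apply: quat_eqP; rewrite !(quatE, mxE) /= /a; field;
   rewrite ?two0 ?oppr_eq0 ?rs0.
Qed.

(** The norm form of a cube root of unity is anisotropic modulo 2, because X^2 + X + 1 has no root
    in F_2. *)
Lemma hurwitz_anisotropic (x y : int) :
  (2 %| x ^+ 2 + - 1 * x * y + 1 * y ^+ 2)%Z -> (2 %| x)%Z && (2 %| y)%Z.
Proof.
have dec z : exists a : int, exists b : bool, z = a * 2 + b%:Z.
  by exists (z %/ 2)%Z, ((z %% 2)%Z == 1); case: eqP; lia.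
have [a [b ->]] := dec x; have [c [d ->]] := dec y.
case: b d => [] [] /=.
- have -> : (a * 2 + 1%N%:Z) ^+ 2 + -1 * (a * 2 + 1%N%:Z) * (c * 2 + 1%N%:Z) + 1 * (c * 2 + 1%N%:Z) ^+ 2
    = 2 * (2 * a ^+ 2 + a - 2 * a * c + 2 * c ^+ 2 + c) + 1 by ring.
  by lia.
- have -> : (a * 2 + 1%N%:Z) ^+ 2 + -1 * (a * 2 + 1%N%:Z) * (c * 2 + 0%N%:Z) + 1 * (c * 2 + 0%N%:Z) ^+ 2
    = 2 * (2 * a ^+ 2 + 2 * a - 2 * a * c + 2 * c ^+ 2 - c) + 1 by ring.
  by lia.
- have -> : (a * 2 + 0%N%:Z) ^+ 2 + -1 * (a * 2 + 0%N%:Z) * (c * 2 + 1%N%:Z) + 1 * (c * 2 + 1%N%:Z) ^+ 2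
    = 2 * (2 * a ^+ 2 - a - 2 * a * c + 2 * c ^+ 2 + 2 * c) + 1 by ring.
  by lia.
by lia.
Qed.

Section QuaternionInvariant.
Variable p : prime_nat.
Local Notation Zp := (padic_int p).
Local Notation F := (padic p).

Lemma padic_invariant_norm (r s : F) :
  padic_invariant (quaternion (r ^+ 2 + s ^+ 2) (- 1) : falgType F) = 0.
Proof.
have [x [y [x0 y0 xy]]] := quaternion_zero_divisor r s.
by apply: (padic_invariant_zero_divisor (dim_quaternion _ _) x0 y0 xy).
Qed.

Lemma padic_nonunit_dvd (z : Zp) : z \isn't a GRing.unit -> exists t, z = p%:R * t.
Proof.
rewrite padic_unitE negbK => /eqP/padic_dvdP[t ->].
by exists t; rewrite expr1.
Qed.

Lemma padic_unit_int (n : int) (t : Zp) : ((n%:~R + p%:R * t) \is a GRing.unit) = ~~ (p %| n)%Z.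
Proof.
apply/idP/idP => [nU|pn].
  apply/negP => /dvdzP[q Dn]; move: nU; rewrite Dn rmorphM /= -[(p%:Z)%:~R]/(p%:R) mulrC.
  by rewrite -mulrDr padic_p_nonunit.
have nU := local_int_unit (prime_valP p) (@padic_unit1 p) pn.
have -> : n%:~R + p%:R * t = n%:~R * (1 + p%:R * (t / n%:~R)).
  by rewrite mulrDr mulr1 mulrCA [n%:~R * _]mulrC divrK.
by rewrite unitrM nU padic_unit1.
Qed.

Lemma padic_norm_anisotropic (T N : int) :
  (forall x y : int, (p %| x ^+ 2 + T * x * y + N * y ^+ 2)%Z ->
    (p %| x)%Z && (p %| y)%Z) ->
  forall c d : Zp, (c \is a GRing.unit) || (d \is a GRing.unit) ->
    (c ^+ 2 + T%:~R * c * d + N%:~R * d ^+ 2) \is a GRing.unit.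
Proof.
move=> anis c d; have [n [t ->]] := padic_residue c; have [m [s ->]] := padic_residue d.
rewrite !padic_unit_int -negb_and; apply: contraNT => nU; apply: anis.
apply/negPn; apply: contra nU => nm.
suff [z ->] : exists z, (n%:~R + p%:R * t) ^+ 2 + T%:~R * (n%:~R + p%:R * t) * (m%:~R + p%:R * s) +
   N%:~R * (m%:~R + p%:R * s) ^+ 2 = (n ^+ 2 + T * n * m + N * m ^+ 2)%:~R + p%:R * z.
  by rewrite padic_unit_int.
exists (2 * n%:~R * t + p%:R * t ^+ 2 + T%:~R * (n%:~R * s + t * m%:~R + p%:R * t * s) +
  N%:~R * (2 * m%:~R * s + p%:R * s ^+ 2)).
by rewrite !(rmorphXn, rmorphD, rmorphM) /=; ring.
Qed.

(** The quaternion j generates Q_p(sqrt(-1)), which is unramified, and i, whose square is a,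
    conjugates j to -j. *)
Lemma padic_invariant_mod4_3 (a : F) (e : int) : (p %% 4 = 3)%N ->
  padic_valuation a e ->
  padic_invariant (quaternion a (- 1) : falgType F) = if odd `|e| then half else 0.
Proof.
move=> p3 va; rewrite -QmodZ_of_half; apply: padic_invariantE; first exact: dim_quaternion.
have [j2 ij i2] := quaternion_gaussian a.
have anis := @padic_norm_anisotropic 0 1 _.
have thp (K : fieldExtType F) (theta : K) :
     theta ^+ 2 = tofrac (0%:~R : Zp) *: theta - (tofrac (1%:~R : Zp))%:A ->
     theta ^+ p = (tofrac (0%:~R : Zp))%:A - theta.
  rewrite !rmorph0 !rmorph1 !scale0r !sub0r scale1r => th2.
  exact: expr_sqrtN1.
apply: (is_padic_invariant_exists (T := 0%:~R) (N := 1%:~R) _ thp _ _ _ i2 va).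
- apply: padic_norm_anisotropic => x y.
  have -> : x ^+ 2 + 0 * x * y + 1 * y ^+ 2 = x ^+ 2 + y ^+ 2 by ring.
  exact: (dvdz_sum2sq (prime_valP p) p3).
- exact: dim_quaternion.
- by rewrite !rmorph0 !rmorph1; exact: j2.
- by rewrite !rmorph0; exact: ij.
Qed.

Lemma padic_sqrtN1 : (p %% 4 = 1)%N -> exists i : Zp, i ^+ 2 = - 1.
Proof.
move=> p1; have [x] := Fp_sqrtN1 (prime_valP p) p1.
rewrite [x]Fp_intE; move: (Posz _) => {}x x2.
have op : odd p by lia.
have /dvdzP[q Dq] : (p %| x ^+ 2 + 1)%Z.
  by rewrite -Fp_int_eq0 ?prime_valP // rmorphD rmorphXn /= x2 addNr.
apply: (local_sqrt (prime_valP p) (@padic_unit1 p) (@padic_hensel p) (t := - q%:~R) op (y := x)).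
  apply/negP => px; have : (p %| q * p - x ^+ 2)%Z.
    by rewrite rpredB ?dvdz_mull // dvdz_exp.
  have -> : q * p - x ^+ 2 = 1 by rewrite -Dq; ring.
  by rewrite dvdz1 /= => /eqP p11; have := prime_gt1 (prime_valP p); rewrite p11.
rewrite mulrN -[p%:R]/(p%:Z%:~R) -rmorphM /= mulrC -Dq.
by rewrite rmorphD rmorphXn /=; ring.
Qed.

Lemma padic_invariant_mod4_1 (a : F) : (p %% 4 = 1)%N ->
  padic_invariant (quaternion a (- 1) : falgType F) = 0.
Proof.
move=> p1; have [i i2] := padic_sqrtN1 p1.
have Di : tofrac i ^+ 2 = - 1 by rewrite -rmorphXn i2 rmorphN1.
have -> : a = ((a + 1) / 2) ^+ 2 + ((a - 1) / 2 * tofrac i) ^+ 2.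
  exact: sum2sq_sqrtN1 (padic_two_neq0 p) Di.
exact: padic_invariant_norm.
Qed.
(** The answer is the same for all r and s: the algebra contains a copy of Hamilton's quaternions,
    and the element u of [quaternion_hurwitz] has square -2, of valuation 1. *)
Lemma padic_invariant_dyadic (r s : F) : (p : nat) = 2%N -> r ^+ 2 + s ^+ 2 != 0 ->
  padic_invariant (quaternion (- (r ^+ 2 + s ^+ 2)) (- 1) : falgType F) = half.
Proof.
move=> p2 rs0; have [j [u [j2 uj u2]]] := quaternion_hurwitz (padic_two_neq0 p) rs0.
have v2 : padic_valuation (- 2 : F) 1.
  exists (- 1); first by rewrite unitrN unitr1.
  by rewrite expr1z rmorphN rmorph1 mulrN1 p2.
have -> : half = QmodZ_of ((1 : int)%:~R / 2) by rewrite QmodZ_of_half.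
apply: padic_invariantE; first exact: dim_quaternion.
apply: (is_padic_invariant_exists (T := (- 1)%:~R) (N := 1%:~R) (j := j) (u := u) _ _ _ _ _ u2 v2).
- apply: padic_norm_anisotropic => x y; rewrite p2.
  exact: hurwitz_anisotropic.
- by move=> K th; rewrite !rmorphN !rmorph1 p2 => ->; rewrite !scaleN1r scale1r addrC.
- exact: dim_quaternion.
- by rewrite !rmorphN !rmorph1.
- by rewrite !rmorphN !rmorph1.
Qed.

(** For s even, 1 + 4s is 1 modulo 8 and is a square; for s odd, this holds for 1 + 4s - 2^2. *)
Lemma dyadic_sum2sq (s : Zp) : (p : nat) = 2%N -> exists r t, r ^+ 2 + t ^+ 2 = 1 + 4 * s.
Proof.
move=> p2; have [n [t Ds]] := padic_residue s.
have n2 : (exists q, n = q * 2) \/ (exists q, n = q * 2 + 1).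
  have : (n %% 2)%Z = 0 \/ (n %% 2)%Z = 1 by lia.
  case=> h; first by left; exists (n %/ 2)%Z; lia.
  by right; exists (n %/ 2)%Z; lia.
case: n2 => -[q Dn]; have [v Dv] := padic_hensel (q%:~R + t).
  exists v, 0; by rewrite Dv Ds Dn p2 rmorphM /=; ring.
exists v, 2; by rewrite Dv Ds Dn p2 rmorphD rmorphM /=; ring.
Qed.

(** * Local invariants at points *)

(* The extension of [chi p] to nonzero [p]-adic integers, each of which is an
   integer times a square congruent to 1. *)
Definition chi_rel (t : Zp) (c : bool) := exists (a : int) (v : Zp),
  [/\ a != 0, chi p a = c & t = a%:~R * (1 + 2 * p%:R * v) ^+ 2].

(** Write a as a power of 2 times an odd number. The sign makes the odd part 1 modulo 4, hence a sum
    of two squares in Z_2, and so is 2 = 1 + 1. *)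
Lemma dyadic_chi (a : int) (c : bool) (y : Zp) : (p : nat) = 2%N -> a != 0 -> chi p a = c ->
  exists r s : Zp, a%:~R * y ^+ 2 = (-1) ^+ c * (r ^+ 2 + s ^+ 2).
Proof.
move=> p2 a0; rewrite p2 => ca.
have [m m2 Da] := unit_part (isT : prime 2) a0; set e := logn _ _ in Da.
move: ca; rewrite Da chi2E // => ca.
have [k Dk] : exists k : int, m = (-1) ^+ c * (1 + 4 * k).
  rewrite -ca; have [h|h] := odd_mod4 m2; rewrite h /=.
    by exists (m %/ 4)%Z; rewrite expr0 mul1r; lia.
  by exists (- ((m + 1) %/ 4)%Z); rewrite expr1 mulN1r; lia.
have [r [s rs]] := dyadic_sum2sq k%:~R p2.
have [r' [s' rs']] : exists r' s' : Zp, r' ^+ 2 + s' ^+ 2 = ((2 ^ e)%N%:Z)%:~R.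
  elim: {Da} e => [|e [r' [s' IHe]]]; first by exists 1, 0; rewrite expn0; ring.
  exists (r' - s'), (r' + s'); rewrite expnS PoszM rmorphM /= -IHe.
  by rewrite -[(2 : int)%:~R]/(2 : Zp); ring.
exists ((r * r' - s * s') * y), ((r * s' + s * r') * y).
rewrite Dk !rmorphM /= -rs' rmorphXn rmorphD rmorphM rmorph1 /= -[(4 : int)%:~R]/(4 : Zp) -rs.
by rewrite rmorphN rmorph1; ring.
Qed.

Lemma padic_invariant_chi (t : Zp) (c : bool) : chi_rel t c ->
  padic_invariant (quaternion (tofrac t) (- 1) : falgType F) = if c then half else 0.
Proof.
move=> [a [v [a0 ca Dt]]]; set y := 1 + _ in Dt.
have yU : y \is a GRing.unit.
  rewrite /y (_ : 2 * p%:R * v = p%:R * (2 * v)) ?padic_unit1 //.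
  by rewrite mulrA [p%:R * _]mulrC.
have pP := prime_valP p.
have [p2|p2] := eqVneq (p : nat) 2%N.
  have [r [s Drs]] := dyadic_chi y p2 a0 ca.
  have y0 : y != 0 by apply: contraTneq yU => ->; rewrite unitr0.
  have t0 : t != 0 by rewrite Dt mulf_neq0 ?expf_neq0 ?padic_int_eq0.
  have {}Dt : tofrac t = (-1) ^+ c * (tofrac r ^+ 2 + tofrac s ^+ 2).
    by rewrite Dt Drs rmorphM rmorphXn rmorphN1 rmorphD !rmorphXn.
  rewrite Dt; case: (c) Dt => Dt; last by rewrite expr0 mul1r; exact: padic_invariant_norm.
  rewrite expr1 mulN1r; apply: padic_invariant_dyadic => //.
  by apply: contraNneq t0 => rs0; rewrite -tofrac_eq0 Dt rs0 mulr0.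
have op : odd p by case: (even_prime pP) => // /eqP; rewrite (negPf p2).
move: ca; rewrite /chi (negPf p2); have [p3|p3] := eqVneq (p %% 4)%N 3%N; last first.
  by move=> <- /=; apply: padic_invariant_mod4_1; lia.
move=> <-; have [m pm Da] := unit_part pP a0.
apply: (padic_invariant_mod4_3 (e := (logn p `|a|)%:Z) p3).
have mU : (m%:~R : Zp) \is a GRing.unit by apply: (local_int_unit pP (@padic_unit1 p)).
exists (m%:~R * y ^+ 2); first by rewrite unitrM mU unitrX.
have -> : t = ((p ^ logn p `|a|)%N%:Z)%:~R * (m%:~R * y ^+ 2).
  by rewrite Dt {1}Da [(_ * m)%:~R]rmorphM mulrA.
rewrite [LHS]rmorphM; congr (_ * _).
by rewrite -ppowE rmorphXn /= rmorph_nat.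
Qed.
End QuaternionInvariant.

(** * The symbol on nonzero p-adic integers *)

Section ChiRel.
Variable p : prime_nat.
Local Notation Zp := (padic_int p).
Local Notation F := (padic p).
Implicit Types (t x y : Zp) (c : bool).

(** A relative error divisible by p^3 lands in 1 + 4p Z_p, which consists of squares, uniformly in
    p: 8 = 4 p for p = 2, and 4 is a unit otherwise. *)
Lemma padic_cube_four : exists z : Zp, p%:R ^+ 3 = 4 * p%:R * z.
Proof.
have [p2|p2] := eqVneq (p : nat) 2%N; first by exists 1; rewrite p2; ring.
have U4 : (4 : Zp) \is a GRing.unit.
  apply: (@local_int_unit p _ (prime_valP p) (@padic_unit1 p) 4).
  rewrite dvdzE -[(_ %| _)%N]/(p %| 2 ^ 2)%N Euclid_dvdX ?prime_valP // andbT.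
  by rewrite dvdn_prime2 ?prime_valP.
exists (p%:R ^+ 2 / 4).
have -> : 4 * p%:R * (p%:R ^+ 2 / 4) = p%:R ^+ 3 * (4 / 4) :> Zp by ring.
by rewrite divrr // mulr1.
Qed.

Lemma chi_rel_neq0 t c : chi_rel t c -> t != 0.
Proof.
move=> [a [v [a0 _ ->]]]; rewrite mulf_neq0 ?padic_int_eq0 // expf_neq0 //.
have : (1 + 2 * p%:R * v : Zp) \is a GRing.unit.
  by rewrite (_ : 2 * p%:R * v = p%:R * (2 * v)) ?padic_unit1 //; ring.
by apply: contraTneq => ->; rewrite unitr0.
Qed.

(** Different ways of writing t as an integer times a square yield the same symbol because the
    invariant of (t, -1) depends on t alone. *)
Lemma chi_rel_fun t c c' : chi_rel t c -> chi_rel t c' -> c = c'.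
Proof.
move=> /padic_invariant_chi h /padic_invariant_chi; rewrite {}h.
by case: c c' => [] [] // /eqP; rewrite ?(negPf half_neq0) // eq_sym (negPf half_neq0).
Qed.

Lemma chi_rel_mul t t' c c' : chi_rel t c -> chi_rel t' c' -> chi_rel (t * t') (c (+) c').
Proof.
move=> [a [v [a0 <- ->]]] [a' [v' [a'0 <- ->]]].
exists (a * a'), (v + v' + 2 * p%:R * v * v'); split; first by rewrite mulf_neq0.
  by rewrite chiM ?prime_valP.
by rewrite rmorphM /=; ring.
Qed.

Lemma chi_rel_int (a : int) : a != 0 -> chi_rel (a%:~R : Zp) (chi p a).
Proof. by move=> a0; exists a, 0; split=> //; ring. Qed.

Lemma chi_rel_int_eq (a : int) c : chi_rel (a%:~R : Zp) c -> chi p a = c.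
Proof.
move=> ac; have := chi_rel_neq0 ac; rewrite padic_int_eq0 => a0.
exact: chi_rel_fun (chi_rel_int a0) ac.
Qed.

Lemma chi_rel_mul1 t c (z : Zp) : chi_rel t c -> chi_rel (t * (1 + 4 * p%:R * z)) c.
Proof.
move=> tc; have [v <-] := padic_sqrt z; rewrite -[c]addbF.
apply: chi_rel_mul => //; exists 1, v; split=> //; first by rewrite chi1 ?prime_valP.
by rewrite mul1r.
Qed.

Lemma chi_rel_close t c : chi_rel t c -> exists n, forall t', t' n = t n -> chi_rel t' c.
Proof.
move=> tc; have [e [u [uU Dt]]] := padic_decomp (chi_rel_neq0 tc).
(* Three digits beyond the valuation e, as in [padic_cube_four], change t by a square factor
   only. *)
exists (e + 3)%N => t' /padic_eq_seq[z tt'].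
have [w Dw] := padic_cube_four.
have -> : t' = t * (1 + 4 * p%:R * (w * z / u)).
  rewrite -[t'](subrK t) tt' exprD Dw Dt mulrDr mulr1 addrC; congr (_ + _).
  have -> : p%:R ^+ e * u * (4 * p%:R * (w * z / u)) =
    p%:R ^+ e * (4 * p%:R * w) * z * (u / u) by ring.
  by rewrite divrr // mulr1.
exact: chi_rel_mul1.
Qed.

Lemma chi_rel_exists t : t != 0 -> exists c, chi_rel t c.
Proof.
move=> t0; have [e [u [uU Dt]]] := padic_decomp t0.
have [z Dz] := padic_approx t (e + 3); set a := t (e + 3)%N in Dz.
have [w Dw] := padic_cube_four.
have Da : a%:~R = p%:R ^+ e * (u - p%:R ^+ 3 * z).
  by rewrite mulrBr mulrA -exprD -Dt Dz addrK.
have u'U : (u - p%:R ^+ 3 * z) \is a GRing.unit.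
  have -> : u - p%:R ^+ 3 * z = u * (1 + p%:R * (- p%:R ^+ 2 * z / u)).
    rewrite [RHS]mulrDr mulr1; congr (_ + _).
    have -> : u * (p%:R * (- p%:R ^+ 2 * z / u)) = - (p%:R ^+ 3 * z) * (u / u) by ring.
    by rewrite divrr // mulr1.
  by rewrite unitrM uU padic_unit1.
have a0 : a != 0.
  rewrite -(padic_int_eq0 p) Da mulf_neq0 //.
    by rewrite ppowE padic_int_eq0 ppow_neq0.
  by apply: contraTneq u'U => ->; rewrite unitr0.
exists (chi p a); move: (u - _) Da u'U => u' Da u'U.
have -> : t = a%:~R * (1 + 4 * p%:R * (w * z / u')).
  rewrite Dz exprD Dw Da mulrDr mulr1; congr (_ + _).
  have -> : p%:R ^+ e * u' * (4 * p%:R * (w * z / u')) =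
    p%:R ^+ e * (4 * p%:R * w) * z * (u' / u') by ring.
  by rewrite divrr // mulr1.
exact: chi_rel_mul1 (chi_rel_int a0).
Qed.

(** By local constancy x and y may be truncated to integers, where [chi_sum2sq] applies. *)
Lemma chi_rel_sum2sq x y c : chi_rel (x ^+ 2 + y ^+ 2) c -> c = false.
Proof.
move=> xyc; have [n Hn] := chi_rel_close xyc.
have [x' Dx] := padic_approx x n; have [y' Dy] := padic_approx y n.
have {Hn} : chi_rel (((x n) ^+ 2 + (y n) ^+ 2)%:~R : Zp) c.
  apply: Hn; apply/padic_eq_seq.
  exists (- (2 * (x n)%:~R * x' + p%:R ^+ n * x' ^+ 2) - (2 * (y n)%:~R * y' + p%:R ^+ n * y' ^+ 2)).
  by rewrite {2}Dx {2}Dy rmorphD !rmorphXn /=; ring.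
move=> xyc'; have := chi_rel_neq0 xyc'; rewrite padic_int_eq0 => xy0.
by rewrite -(chi_rel_int_eq xyc') chi_sum2sq ?prime_valP.
Qed.

Lemma chi_rel_unit t c : t \is a GRing.unit -> (p : nat) != 2%N -> chi_rel t c -> c = false.
Proof.
move=> tU p2 [a [v [a0 <- Dt]]]; rewrite /chi (negPf p2) logn_coprime ?andbF //.
rewrite prime_coprime ?prime_valP //; apply/negP => pa.
have /dvdzP[q Dq] : (p %| a)%Z by [].
move: tU; rewrite Dt Dq rmorphM /= -[(p%:Z)%:~R]/(p%:R).
have -> : q%:~R * p%:R * (1 + 2 * p%:R * v) ^+ 2 =
  p%:R * (q%:~R * (1 + 2 * p%:R * v) ^+ 2) :> Zp by ring.
by rewrite padic_p_nonunit.
Qed.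
End ChiRel.

(* [factor1] and [factor2] are [chart1] and [chart2] over a ring instead of a
   field. *)
Section Charts.
Variables (R : comNzRingType) (a b : nat) (n : int).

Definition factor1 (z : R) : R := n%:~R - z ^+ b.
Definition factor2 (z : R) : R := \sum_(i < a) n%:~R ^+ (a.-1 - i) * z ^+ (b * i).

Lemma factor12 z : factor1 z * factor2 z = (n ^+ a)%:~R - z ^+ (a * b).
Proof.
rewrite mulnC exprM rmorphXn subrXX /factor1 /factor2; apply: congr1.
by apply: eq_bigr => i _; rewrite exprM.
Qed.

(** The reason why the two charts cover the surface, as a n^(a-1) is nonzero, and why only primes
    dividing 2 a m can be bad. *)
Lemma factor2_mod z : exists w, factor2 z = a%:R * n%:~R ^+ a.-1 + factor1 z * w.
Proof.
exists (- \sum_(i < a) n%:~R ^+ (a.-1 - i) * \sum_(j < i) n%:~R ^+ (i.-1 - j) * (z ^+ b) ^+ j).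
rewrite mulrN mulr_sumr -[a in a%:R]card_ord -sumr_const mulr_suml -sumrB.
apply: eq_bigr => i _; rewrite mul1r mulrCA -subrXX mulrBr -exprD subnK ?opprB; last first.
  by have := ltn_ord i; lia.
by rewrite subrKC exprM.
Qed.
End Charts.

Lemma factor1_rmorph (R S : comNzRingType) (f : {rmorphism R -> S}) b n z :
  f (factor1 b n z) = factor1 b n (f z).
Proof. by rewrite /factor1 rmorphB rmorph_int rmorphXn. Qed.

Lemma factor2_rmorph (R S : comNzRingType) (f : {rmorphism R -> S}) a b n z :
  f (factor2 a b n z) = factor2 a b n (f z).
Proof.
rewrite rmorph_sum; apply: eq_bigr => i _.
by rewrite rmorphM !rmorphXn rmorph_int.
Qed.

Lemma factor1_int (R : comNzRingType) b n (z : int) :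
  factor1 b n (z%:~R : R) = (factor1 b n z)%:~R.
Proof. by rewrite -(factor1_rmorph (intr : {rmorphism int -> R})). Qed.

Lemma factor2_int (R : comNzRingType) a b n (z : int) :
  factor2 a b n (z%:~R : R) = (factor2 a b n z)%:~R.
Proof. by rewrite -(factor2_rmorph (intr : {rmorphism int -> R})). Qed.

Section LocalInvariant.
Variables (p : prime_nat) (k : nat) (m : int) (a b : nat) (n : int).
Hypotheses (m0 : m != 0) (a0 : (0 < a)%N) (kab : k = (a * b)%N) (mna : m = n ^+ a).
Local Notation Zp := (padic_int p).
Local Notation F := (padic p).
Local Notation tof := (@tofrac Zp : {rmorphism Zp -> F}).

Definition local_inv (P : points k m Zp) : QmodZ :=
  padic_invariant (azumaya_fibre a b n (points_map tof P)).

Lemma n_neq0 : n != 0.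
Proof. by apply: contraNneq m0 => n0; rewrite mna n0 expr0n gtn_eqF. Qed.

Lemma points_factor12 (S : comNzRingType) (P : points k m S) :
  factor1 b n (zcoord P) * factor2 a b n (zcoord P) = xcoord P ^+ 2 + ycoord P ^+ 2.
Proof. by rewrite factor12 -mna -kab -(pointsP P) addrK. Qed.

Lemma factor2_root (z : Zp) : factor1 b n z = 0 -> factor2 a b n z != 0.
Proof.
move=> f0; have [w ->] := factor2_mod a b n z; rewrite f0 mul0r addr0.
rewrite -[a%:R]/(a%:Z%:~R) -rmorphXn -rmorphM padic_int_eq0 mulf_neq0 //.
  by rewrite eqz_nat -lt0n.
by rewrite expf_neq0 // n_neq0.
Qed.

(** The product of the two factors is x^2 + y^2, of trivial symbol, so both have the same symbol
    when both are nonzero. If the first one vanishes, the second does not and computes the fibre. *)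
Lemma local_inv_chi (P : points k m Zp) : exists c : bool,
  [/\ local_inv P = if c then half else 0,
      factor1 b n (zcoord P) != 0 -> chi_rel (factor1 b n (zcoord P)) c &
      factor2 a b n (zcoord P) != 0 -> chi_rel (factor2 a b n (zcoord P)) c].
Proof.
have := points_factor12 P; set f1 := factor1 _ _ _; set f2 := factor2 _ _ _ _ => f12.
have zE : zcoord (points_map tof P) = tof (zcoord P) by [].
have c1E : chart1 b n (zcoord (points_map tof P)) = tof f1.
  by rewrite zE -[LHS]/(factor1 b n (tof (zcoord P))) -factor1_rmorph.
have c2E : chart2 a b n (zcoord (points_map tof P)) = tof f2.
  by rewrite zE -[LHS]/(factor2 a b n (tof (zcoord P))) -factor2_rmorph.
rewrite /local_inv /azumaya_fibre c1E c2E tofrac_eq0.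
have [f10|f10] := eqVneq f1 0; last first.
  have [c f1c] := chi_rel_exists f10; exists c; split=> //=.
    exact: padic_invariant_chi.
  move=> f20; have [d f2d] := chi_rel_exists f20.
  have := chi_rel_mul f1c f2d; rewrite f12 => /chi_rel_sum2sq.
  by move: f2d; case: (c) (d) => [] [].
have f20 : f2 != 0 := factor2_root f10.
have [c f2c] := chi_rel_exists f20; exists c; split=> //=.
exact: padic_invariant_chi.
Qed.

(** Use the factor that is nonzero at P and the local constancy of its symbol. Here z' ranges over
    all of Z_p, since it will be an integer that need not come from a local point. *)
Lemma local_inv_near (P : points k m Zp) : exists N, forall z' : Zp,
  z' N = zcoord P N -> exists c : bool,
  local_inv P = (if c then half else 0) /\
  (chi_rel (factor1 b n z') c \/ chi_rel (factor2 a b n z') c).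
Proof.
have [c [-> h1 h2]] := local_inv_chi P.
have near (f : Zp -> Zp) d : (forall x y, exists w, f x - f y = (x - y) * w) ->
    chi_rel (f (zcoord P)) d ->
    exists N, forall z' : Zp, z' N = zcoord P N -> chi_rel (f z') d.
  move=> lip /chi_rel_close[N HN]; exists N => z' /padic_eq_seq[z zz'].
  apply: HN; apply/padic_eq_seq; have [w ->] := lip z' (zcoord P).
  by exists (z * w); rewrite zz' mulrA.
have lipX i x y : exists w, x ^+ i - y ^+ i = (x - y) * w :> Zp.
  by rewrite subrXX; eexists.
have lip1 x y : exists w, factor1 b n x - factor1 b n y = (x - y) * w :> Zp.
  have [w Dw] := lipX b x y; exists (- w).
  by rewrite mulrN -Dw /factor1; ring.
have lip2 x y : exists w, factor2 a b n x - factor2 a b n y = (x - y) * w :> Zp.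
  have h (i : 'I_a) := lipX (b * i)%N x y; have [w Dw] := choice h.
  exists (\sum_(i < a) n%:~R ^+ (a.-1 - i) * w i); rewrite mulr_sumr -sumrB.
  by apply: eq_bigr => i _; rewrite mulrCA -Dw mulrBr.
have [f10|/h1 f1c] := eqVneq (factor1 b n (zcoord P)) 0.
  have [N HN] := near _ _ lip2 (h2 (factor2_root f10)).
  by exists N => z' /HN; exists c; split=> //; right.
have [N HN] := near _ _ lip1 f1c.
by exists N => z' /HN; exists c; split=> //; left.
Qed.

Lemma local_inv_stable (P : points k m Zp) : exists N, forall Q : points k m Zp,
  zcoord Q N = zcoord P N -> local_inv Q = local_inv P.
Proof.
have [N HN] := local_inv_near P; exists N => Q /HN[c [-> h]].
have [d [-> h1 h2]] := local_inv_chi Q; congr (if _ then _ else _).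
case: h => fc; [have := h1 (chi_rel_neq0 fc)|have := h2 (chi_rel_neq0 fc)] => fd;
  exact: chi_rel_fun fd fc.
Qed.

(** If the second factor is the one controlled near P, the triviality of the symbol of the product
    transfers the value to the first factor. *)
Lemma local_inv_int (P : points k m Zp) : exists N, forall z : int,
  (z%:~R : Zp) N = zcoord P N -> n ^+ a - z ^+ (a * b) != 0 ->
  chi p (n ^+ a - z ^+ (a * b)) = false ->
  local_inv P = if chi p (factor1 b n z) then half else 0.
Proof.
have [N HN] := local_inv_near P; exists N => z /HN[c [-> h]] mz0 mz.
have := factor12 a b n z; rewrite intz => f12.
have := mz0; rewrite -f12 mulf_eq0 negb_or => /andP[f10 f20].
have := mz; rewrite -f12 chiM ?prime_valP // => f12c.
congr (if _ then _ else _); case: h; rewrite ?factor1_int ?factor2_int => /chi_rel_int_eq <- //.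
by move: f12c; case: chi; case: chi.
Qed.

(** If the first factor is not a unit, the second is a n^(a-1) modulo p, hence a unit. At odd p,
    units have trivial symbol. *)
Lemma local_inv_good (P : points k m Zp) : ~~ (p %| (2 * a)%N%:Z * m)%Z -> local_inv P = 0.
Proof.
move=> pam; have pP := prime_valP p.
have p2 : (p : nat) != 2%N.
  by apply: contraNneq pam => ->; rewrite PoszM -mulrA dvdz_mulr.
have [c [-> h1 h2]] := local_inv_chi P.
suff -> : c = false by [].
have [f1U|f1N] := boolP (factor1 b n (zcoord P) \is a GRing.unit).
  apply: (chi_rel_unit f1U p2); apply: h1.
  by apply: contraTneq f1U => ->; rewrite unitr0.
have f2U : factor2 a b n (zcoord P) \is a GRing.unit.
  have [w ->] := factor2_mod a b n (zcoord P); have [t ->] := padic_nonunit_dvd f1N.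
  rewrite -mulrA -[a%:R]/(a%:Z%:~R) -rmorphXn -rmorphM padic_unit_int.
  apply: contra pam => pan; apply: (@dvdz_trans (a%:Z * n ^+ a.-1)) => //.
  have -> : (2 * a)%N%:Z * m = a%:Z * n ^+ a.-1 * (2 * n).
    by rewrite mna -[X in _ * n ^+ X](prednK a0) exprS PoszM; ring.
  exact: dvdz_mulr.
apply: (chi_rel_unit f2U p2); apply: h2.
by apply: contraTneq f2U => ->; rewrite unitr0.
Qed.
End LocalInvariant.

(** * Integers near a local point at which m - z^k has trivial symbol *)

Section LocalApproximation.
Variables (p : prime_nat) (k : nat) (m : int).
Hypotheses (m0 : m != 0) (k0 : (0 < k)%N).
Local Notation Zp := (padic_int p).

Lemma expr_second_order (R : comNzRingType) (z h : R) :
  exists w, (z - h) ^+ k = z ^+ k - k%:R * z ^+ k.-1 * h + h ^+ 2 * w.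
Proof.
elim: (k) => [|i [w IHi]]; first by exists 0; rewrite !expr0; ring.
case: i w IHi => [|i] w IHi; first by exists 0 => /=; rewrite !expr1 expr0; ring.
exists (i.+1%:R * z ^+ i + (z - h) * w).
by rewrite exprSr IHi -[i.+2%:R]natr1 /= !exprS; ring.
Qed.

(* At a zero of m - z^k, move z by kappa * p^(2E), kappa = k z^(k-1), so that
   the value becomes (kappa p^E)^2 (1 + O(p^(2E))). *)
Lemma local_sum2sq_near (P : points k m Zp) (N : nat) : exists z' : Zp,
  z' N = zcoord P N /\ chi_rel (m%:~R - z' ^+ k) false.
Proof.
set z := zcoord P; have xyz := pointsP P; rewrite -/z in xyz.
have [mz|mz] := eqVneq (m%:~R - z ^+ k) 0; last first.
  exists z; split=> //; have [c] := chi_rel_exists mz.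
  by rewrite -xyz addrK => mzc; rewrite -(chi_rel_sum2sq mzc).
pose kap := k%:R * z ^+ k.-1.
have z0 : z != 0.
  apply: contraNneq m0 => z0; rewrite -(padic_int_eq0 p).
  by move/eqP: mz; rewrite z0 expr0n gtn_eqF // subr0.
have kap0 : kap != 0.
  rewrite mulf_neq0 ?expf_neq0 // -[k%:R]/(k%:Z%:~R) padic_int_eq0.
  by rewrite eqz_nat -lt0n.
pose E := (N + 2)%N; pose h := kap * p%:R ^+ (E + E).
have [w Dw] := expr_second_order z h.
exists (z - h); split.
  apply/padic_eq_seq; exists (- kap * p%:R ^+ (E + 2)).
  by rewrite /h /E addrAC subrr sub0r !exprD; ring.
have [q Dq] := padic_cube_four p.
have -> : m%:~R - (z - h) ^+ k =
    ((kap * p%:R ^+ E) ^+ 2 + 0 ^+ 2) * (1 + 4 * p%:R * (- q * p%:R ^+ (N + N + 1) * w)).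
  have -> : 4 * p%:R * (- q * p%:R ^+ (N + N + 1) * w) =
      - (4 * p%:R * q) * p%:R ^+ (N + N + 1) * w :> Zp by ring.
  rewrite -Dq Dw -/kap; move/eqP: mz; rewrite subr_eq0 => /eqP->.
  by rewrite /h /E !exprD; ring.
apply: chi_rel_mul1.
have nz : (kap * p%:R ^+ E) ^+ 2 + 0 ^+ 2 != 0 :> Zp.
  rewrite expr0n addr0 expf_neq0 // mulf_neq0 //.
  by rewrite ppowE padic_int_eq0 ppow_neq0.
have [c hc] := chi_rel_exists nz.
by rewrite -(chi_rel_sum2sq hc).
Qed.

Lemma local_sum2sq_approx (P : points k m Zp) (N : nat) : exists (L : nat) (c : int),
  forall z : int, ((p ^ L)%N%:Z %| z - c)%Z ->
  [/\ (z%:~R : Zp) N = zcoord P N, m - z ^+ k != 0 & chi p (m - z ^+ k) = false].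
Proof.
have [y [yP yc]] := local_sum2sq_near P N.
have [M HM] := chi_rel_close yc.
exists (maxn N M), (y (maxn N M)) => z zc.
have zE i : (i <= maxn N M)%N -> (z%:~R : Zp) i = y i.
  move=> iNM; rewrite padic_intE -(padic_seq_small y i) -(padic_seq_le y iNM); apply/eqP.
  rewrite eqz_mod_dvd; apply: dvdz_trans zc.
  by rewrite dvdzE /= dvdn_exp2l.
have zc' : chi_rel ((m - z ^+ k)%:~R : Zp) false.
  rewrite rmorphB rmorphXn; apply: HM.
  have /padic_eq_seq[w Dw] := zE M (leq_maxr _ _).
  apply/padic_eq_seq; exists (- w * \sum_(i < k) z%:~R ^+ (k.-1 - i) * y ^+ i).
  rewrite mulrA mulrN -Dw mulNr -subrXX /=; ring.
split; last exact: chi_rel_int_eq.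
  by rewrite zE ?leq_maxl.
by have := chi_rel_neq0 zc'; rewrite padic_int_eq0.
Qed.
End LocalApproximation.

(** * Integral points from hypothesis (H) *)

Lemma maximal_power (k : nat) (m : int) : (0 < k)%N -> m != 0 ->
  exists a b n, [/\ (0 < a)%N, (0 < b)%N, k = (a * b)%N, m = n ^+ a & not_proper_power b n].
Proof.
move=> k0 m0.
suff H b : forall a n, (0 < a)%N -> (0 < b)%N -> k = (a * b)%N -> m = n ^+ a ->
    exists a b n, [/\ (0 < a)%N, (0 < b)%N, k = (a * b)%N, m = n ^+ a & not_proper_power b n].
  by apply: (H k 1%N m); rewrite ?mul1n ?expr1.
elim/ltn_ind: b => b IHb a n a0 b0 kab mna.
have [npp|] := pselect (not_proper_power b n); first by exists a, b, n.
move=> /existsNP[l /existsNP[c /not_implyP[/dvdnP[b' Db] /not_implyP[nc l1]]]].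
have l0 : (0 < l)%N by move: b0; rewrite Db; case: (l); rewrite ?muln0.
have b'0 : (0 < b')%N by move: b0; rewrite Db; case: (b').
apply: (IHb b' _ (a * l)%N c) => //.
- by rewrite Db; case: (l) l0 l1 => [|[|i]] // _ _; rewrite ltn_Pmulr.
- by rewrite muln_gt0 a0.
- by rewrite kab Db -mulnA [(b' * l)%N]mulnC.
- by rewrite mna nc -exprM mulnC.
Qed.

Lemma comp_affine_expand (P : {poly int}) (z M : int) :
  exists Q, P \Po (z%:P + M%:P * 'X) = P.[z]%:P + M%:P * Q.
Proof.
elim/poly_ind: P => [|P c [Q IH]]; first by exists 0; rewrite comp_poly0 horner0 mulr0 addr0.
exists (P.[z]%:P * 'X + Q * (z%:P + M%:P * 'X)).
rewrite comp_polyD comp_polyM comp_polyX comp_polyC IH hornerMXaddC polyCD polyCM.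
by ring.
Qed.

Lemma irreducible_comp_affine (F : fieldType) (P : {poly F}) (a b : F) : a != 0 ->
  irreducible_poly P -> irreducible_poly (P \Po (b%:P + a%:P * 'X)).
Proof.
move=> a0 [sP irrP].
pose L := b%:P + a%:P * 'X; pose L' := (- b / a)%:P + (a^-1)%:P * 'X.
have sL (u v : F) : v != 0 -> size (u%:P + v%:P * 'X) = 2.
  by move=> v0; rewrite addrC size_MXaddC polyC_eq0 (negPf v0) /= size_polyC v0.
have LL' : L \Po L' = 'X.
  rewrite /L comp_polyD comp_polyM comp_polyX !comp_polyC /L' mulrDr mulrA -!polyCM.
  by rewrite mulrCA divff // mulr1 addrA -polyCD subrr polyC0 add0r mul1r.
have L'L : L' \Po L = 'X.
  rewrite /L' comp_polyD comp_polyM comp_polyX !comp_polyC /L mulrDr mulrA -!polyCM.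
  rewrite mulVf // addrA -polyCD (_ : - b / a + a^-1 * b = 0); last by field.
  by rewrite polyC0 add0r mul1r.
have size_comp (q : {poly F}) (u v : F) : v != 0 -> size (q \Po (u%:P + v%:P * 'X)) = size q.
  by move=> v0; rewrite size_comp_poly2 // sL.
split=> [|q q1 qP]; first by rewrite size_comp.
have ai0 : a^-1 != 0 by rewrite invr_eq0.
have : q \Po L' %| P.
  case/dvdpP: qP => r Dr; apply/dvdpP; exists (r \Po L').
  by rewrite -comp_polyM -Dr -comp_polyA LL' comp_polyXr.
move/irrP; rewrite size_comp // => /(_ q1) /andP[_ /dvdpP[r Dr]].
rewrite /eqp qP; apply/dvdpP; exists (r \Po L).
by rewrite -comp_polyM -Dr -comp_polyA L'L comp_polyXr.
Qed.

Lemma poly_int_pinfty (P : {poly int}) : (1 < size P)%N -> 0 < lead_coef P ->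
  forall M : int, exists N : int, forall x, N <= x -> M <= P.[x].
Proof.
elim/poly_ind: P => [|P c IH]; first by rewrite size_poly0.
have [->|P0] := eqVneq P 0; first by rewrite mul0r add0r size_polyC; case: (c != 0).
move=> _; rewrite lead_coefDl ?lead_coefMX; last first.
  by rewrite size_mulX // ltnS size_polyC; case: (c != 0); rewrite ?size_poly_gt0.
move=> lcP M.
have [N HN] : exists N : int, forall x, N <= x -> 1 <= P.[x].
  have [sP|sP] := ltnP 1 (size P); first exact: IH.
  exists 0 => x _; move: lcP; rewrite (size1_polyC sP) lead_coefC hornerC.
  by [].
exists (Num.max 1 (Num.max N (M - c))) => x.
rewrite !ge_max => /and3P[x1 /HN Px Mx]; rewrite hornerMXaddC.
by nia.
Qed.

(** Thus for odd d > 1 the degree b phi(d) is even, and d = 1 is the only factor whose sign has to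
    be changed. *)
Lemma odd_totient (d : nat) : (1 < d)%N -> odd d -> ~~ odd (totient d).
Proof.
move=> d1 od; set q := pdiv d; have qP : prime q := pdiv_prime d1.
have d0 : (0 < d)%N by apply: ltnW.
have [r qr Dr] := pfactor_coprime qP d0; set e := logn q d in Dr.
have e0 : (0 < e)%N by rewrite logn_gt0 mem_primes qP d0 pdiv_dvd.
have oq : odd q by move: od; rewrite Dr oddM oddX eqn0Ngt e0 => /andP[].
rewrite Dr mulnC totient_coprime ?coprimeXl // totient_pfactor // !oddM.
by rewrite -[odd q.-1]negbK -oddS prednK ?prime_gt0 // oq.
Qed.

(* The sign makes the values tend to [+oo] as [Z] tends to [-oo]. *)
Definition signed_factor (b : nat) (n : int) (d : nat) : {poly int} :=
  (-1) ^+ (d == 1)%N *: hom_cyclotomic b n d.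

Section SignedFactor.
Variables (b : nat) (n : int).
Hypotheses (n0 : n != 0) (ob : odd b).
Local Notation f := (signed_factor b n).
Let b0 : (0 < b)%N. Proof. by case: b ob. Qed.

Lemma signed_factor_prod a (z : int) : (0 < a)%N ->
  \prod_(d <- divisors a) (f d).[z] = n ^+ a - z ^+ (a * b).
Proof.
move=> a0; under eq_bigr do rewrite hornerZ.
rewrite big_split /= -horner_prod hom_cyclotomic_prod // !hornerE.
rewrite (bigD1_seq 1%N) ?divisors_uniq -?dvdn_divisors //= expr1 big1.
  by ring.
by move=> d /negPf->; rewrite expr0.
Qed.

Lemma lead_coef_hom_cyclotomic d : (0 < d)%N -> lead_coef (hom_cyclotomic b n d) = 1.
Proof.
move=> d0; apply: (@intr_inj algC).
transitivity (lead_coef (map_poly (intr : int -> algC) (hom_cyclotomic b n d))).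
  by rewrite (lead_coef_map_inj (@intr_inj algC)).
by rewrite (eqP (hom_cyclotomicC_monic n0 b0 d0)).
Qed.

Lemma signed_factor_pinfty d (z M : int) : (0 < d)%N -> odd d -> 0 < M ->
  forall C : int, exists N : int, forall t, N <= t -> C <= (f d).[z - M * t].
Proof.
move=> d0 od M0 C.
pose L := z%:P + (- M)%:P * 'X : {poly int}.
have sL : size L = 2.
  by rewrite /L addrC size_MXaddC polyC_eq0 oppr_eq0 gt_eqF //= size_polyC oppr_eq0 gt_eqF.
have lL : lead_coef L = - M.
  rewrite lead_coefE sL /L coefD coefC coefMX coefC /= add0r //.
have sG := size_hom_cyclotomic n0 b0 d0.
have sf : size (f d) = (b * totient d).+1.
  by rewrite size_scale ?signr_eq0.
have [||N HN] := @poly_int_pinfty (f d \Po L) _ _ C.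
- by rewrite size_comp_poly2 // sf ltnS muln_gt0 b0 totient_gt0.
- rewrite lead_coef_comp ?sL // lL sf lead_coefZ lead_coef_hom_cyclotomic // mulr1 /=.
  have [->|d1] := eqVneq d 1%N.
    rewrite expr1 muln1 mulN1r.
    by rewrite exprNn -signr_odd ob expr1 mulN1r opprK exprn_gt0.
  rewrite mul1r exprNn -signr_odd oddM (negPf (odd_totient _ od)) ?andbF ?mul1r ?exprn_gt0 //.
  by rewrite ltn_neqAle eq_sym d1.
exists N => t /HN; rewrite horner_comp /L !hornerE.
by rewrite mulNr.
Qed.
End SignedFactor.

Lemma irreducible_scale (F : fieldType) (c : F) (P : {poly F}) : c != 0 ->
  irreducible_poly P -> irreducible_poly (c *: P).
Proof.
move=> c0 [sP irrP]; split; first by rewrite size_scale.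
move=> q q1; rewrite dvdpZr // => /irrP-/(_ q1) /eqp_trans; apply.
by rewrite eqp_sym eqp_scale.
Qed.

Lemma absz_pos (x : int) : 0 < x -> x = `|x|%N%:Z.
Proof. by case: x. Qed.

Lemma prime_dvdn_fact (p n : nat) : prime p -> (p %| n`!)%N = (p <= n)%N.
Proof.
move=> pP; apply/idP/idP => [|pn]; last by rewrite dvdn_fact ?prime_gt0.
elim: n => [|n IHn]; first by rewrite dvdn1 => /eqP p1; rewrite p1 in pP.
by rewrite factS Euclid_dvdM // => /orP[/dvdn_leq->//|/IHn/leqW].
Qed.

(** * Applying hypothesis (H) near an integer with the right symbols *)

Section SchinzelPoint.
Variables (a b : nat) (n : int) (B N : nat) (z0 : int).
Hypotheses (n0 : n != 0) (oab : odd (a * b)) (npp : not_proper_power b n).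
Hypotheses (B2 : (2 <= B)%N)
  (mB : forall p, prime p -> (p%:Z %| n ^+ a)%Z -> (p <= B)%N).
Local Notation k := (a * b)%N.
Local Notation m := (n ^+ a).
Local Notation f := (signed_factor b n).
Hypothesis v0 : m - z0 ^+ k != 0.
Hypothesis chiv : forall p, prime p -> (p <= B)%N -> chi p (m - z0 ^+ k) = false.
Hypothesis chif : forall d, (d %| a)%N ->
  \big[addb/false]_(p < B.+1 | prime p) chi p (f d).[z0] = false.

Let oa : odd a. Proof. by move: oab; rewrite oddM => /andP[]. Qed.
Let ob : odd b. Proof. by move: oab; rewrite oddM => /andP[]. Qed.
Let a0 : (0 < a)%N. Proof. by case: a oa. Qed.
Let b0 : (0 < b)%N. Proof. by case: b ob. Qed.

Let small : nat_pred := [pred p | p <= B]%N.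
Let v := m - z0 ^+ k.
Let C := ((absz v)`_small)%N.
(** For each p <= B, the power of B! supplies p^N for the approximation and one further p. The
    factor C contains the p-part of every f_d(z0), and together with 4p this is the precision
    required by [chi_close]. *)
Let M := (4 * B`! ^ N.+1 * C)%N.
Let g d := (f d).[z0].
Let c d := ((absz (g d))`_small)%N.

Let C0 : (0 < C)%N. Proof. exact: part_gt0. Qed.
Let c0 d : (0 < c d)%N. Proof. exact: part_gt0. Qed.
Let M0 : (0 < M)%N. Proof. by rewrite !muln_gt0 expn_gt0 fact_gt0 C0. Qed.

Let g_dvd d : (d %| a)%N -> (g d %| v)%Z.
Proof.
move=> da; rewrite /v -(signed_factor_prod b n0 _ a0).
rewrite (bigD1_seq d) ?divisors_uniq -?dvdn_divisors //=.
exact: dvdz_mulr.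
Qed.

Let g0 d : (d %| a)%N -> g d != 0.
Proof. by move=> /g_dvd gv; apply: contraNneq v0 => e; move: gv; rewrite e dvd0z. Qed.

Let cC d : (d %| a)%N -> (c d %| C)%N.
Proof. by move=> /g_dvd gv; apply: partn_dvd; rewrite ?absz_gt0 // -dvdzE. Qed.

Let pM p : prime p -> (p <= B)%N -> (p * (p ^ N * (4 * C)) %| M)%N.
Proof.
move=> pP pB; have -> : M = (B`! ^ N.+1 * (4 * C))%N by rewrite /M mulnAC mulnC.
rewrite mulnA -expnS dvdn_mul //.
by apply: dvdn_exp2r; apply: dvdn_fact; rewrite prime_gt0 ?pB.
Qed.

Let pfactor_M p (x : int) : prime p -> (p <= B)%N -> x != 0 -> (x %| v)%Z ->
  ((p ^ logn p (absz x))%N%:Z * (4 * p%:Z) %| M%:Z)%Z.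
Proof.
move=> pP pB x0 xv; rewrite [X in _ * X](_ : _ = (4 * p)%N%:Z) // -PoszM dvdzE /=.
have pC : (p ^ logn p (absz x) %| C)%N.
  have : (p ^ logn p (absz x) %| absz v)%N.
    by rewrite (dvdn_trans (pfactor_dvdnn _ _)) // -dvdzE.
  rewrite -(@partnC small (absz v)) ?absz_gt0 // Gauss_dvdl //.
  rewrite coprimeXl // prime_coprime //.
  have /pnatP := part_pnat small^' (absz v); rewrite part_gt0 => /(_ isT p pP) H.
  by apply/negP => /H; rewrite !inE pB.
apply: dvdn_trans (pM pP pB).
have -> : (p * (p ^ N * (4 * C)) = p ^ N * (C * (4 * p)))%N by ring.
by rewrite dvdn_mull // dvdn_mul.
Qed.

Let M_small q : prime q -> (q %| M)%N -> (q <= B)%N.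
Proof.
move=> qP; rewrite /M !Euclid_dvdM // Euclid_dvdX // andbT prime_dvdn_fact //.
move=> /orP[/orP[|//]|].
  rewrite -[4%N]/(2 ^ 2)%N Euclid_dvdX // => /andP[/dvdn_leq q2 _].
  exact: leq_trans (q2 isT) B2.
have /pnatP := part_pnat small (absz v); rewrite part_gt0 => /(_ isT q qP).
by rewrite !inE.
Qed.

(* The substitution [z = z0 - M X] keeps every [chi p], [p <= B], and divides
   the part of [f d] supported on the primes up to [B] out. *)
Let h_exists d : exists h : {poly int}, (d %| a)%N ->
  [/\ (c d)%:Z%:P * h = f d \Po (z0%:P + (- M%:Z)%:P * 'X),
      forall t, ((M %/ c d)%N%:Z %| h.[t] - ((absz (g d))`_small^')%N%:Z * Num.sg (g d))%Z &
      forall t, (M%:Z %| (f d).[z0 - M%:Z * t] - g d)%Z].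
Proof.
have [da|] := boolP (d %| a)%N; last by exists 0.
have [Q DQ] := comp_affine_expand (f d) z0 (- M%:Z).
have cM : (c d * (M %/ c d) = M)%N.
  by rewrite mulnC divnK // dvdn_mull // cC.
have gE : g d = (c d)%:Z * (((absz (g d))`_small^')%N%:Z * Num.sg (g d)).
  by rewrite mulrA -PoszM partnC ?absz_gt0 ?g0 // abszE mulrC -numEsg.
set w := _ * Num.sg _ in gE *.
exists (w%:P - (M %/ c d)%N%:Z%:P * Q) => _; split.
- by rewrite DQ -/(g d) gE mulrDr mulrN mulrA -!polyCM -PoszM cM polyCN mulNr.
- move=> t; rewrite !hornerE addrAC subrr add0r -mulrN; exact: dvdz_mulr.
- move=> t; have -> : z0 - M%:Z * t = (z0%:P + (- M%:Z)%:P * 'X).[t].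
    by rewrite !hornerE mulNr.
  rewrite -horner_comp DQ /g; set e := _.[z0].
  by rewrite !hornerE addrAC subrr add0r mulNr -mulrN; apply: dvdz_mulr.
Qed.

Section FactorPolynomials.
Variable h : nat -> {poly int}.
Hypothesis hE : forall d, (d %| a)%N ->
  (c d)%:Z%:P * h d = f d \Po (z0%:P + (- M%:Z)%:P * 'X).
Hypothesis hM : forall d, (d %| a)%N -> forall t,
  ((M %/ c d)%N%:Z %| (h d).[t] - ((absz (g d))`_small^')%N%:Z * Num.sg (g d))%Z.

Lemma horner_h d t : (d %| a)%N -> (c d)%:Z * (h d).[t] = (f d).[z0 - M%:Z * t].
Proof.
move=> da; have -> : z0 - M%:Z * t = (z0%:P + (- M%:Z)%:P * 'X).[t].
  by rewrite !hornerE mulNr.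
by rewrite -horner_comp -hE // hornerM hornerC.
Qed.

(** Modulo p every value of [h d] is, up to sign, the part of f_d(z0) prime to all primes up to B: p
    still divides M / c_d, thanks to the extra factor p in M. *)
Let h_small d t p : (d %| a)%N -> prime p -> (p <= B)%N -> ~~ (p%:Z %| (h d).[t])%Z.
Proof.
move=> da pP pB; have := hM da t; set w := _ * Num.sg (g d) => hMw.
have pw : ~~ (p%:Z %| w)%Z.
  rewrite dvdzE abszM !absz_nat absz_sg g0 // muln1.
  have /pnatP := part_pnat small^' (absz (g d)); rewrite part_gt0 => /(_ isT p pP) H.
  by apply/negP => /H; rewrite !inE pB.
have pMc : (p%:Z %| (M %/ c d)%N%:Z)%Z.
  have cM : (c d %| M)%N by rewrite dvdn_mull // cC.
  rewrite dvdzE /= (dvdn_divRL _ cM).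
  by apply: dvdn_trans (pM pP pB); rewrite dvdn_mul // !dvdn_mull // cC.
by rewrite -(subrK w (h d).[t]) (rpredDl _ (dvdz_trans pMc hMw)).
Qed.

Let h_prod t : (\prod_(d <- divisors a) (c d)%:Z) * \prod_(d <- divisors a) (h d).[t]
  = m - (z0 - M%:Z * t) ^+ k.
Proof.
rewrite -(signed_factor_prod b n0 _ a0) -big_split /=.
by rewrite !big_seq; apply: eq_bigr => d; rewrite -dvdn_divisors // => /horner_h.
Qed.

Lemma h_irreducible d : (d %| a)%N ->
  irreducible_poly (map_poly (intr : int -> rat) (h d)).
Proof.
move=> da; have d0 : (0 < d)%N := dvdn_gt0 a0 da.
have c0' : (c d)%:Z%:~R != 0 :> rat by rewrite intr_eq0 -lt0n.
have -> : map_poly (intr : int -> rat) (h d) = ((c d)%:Z%:~R)^-1 *: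
   (map_poly intr (f d) \Po ((z0%:~R)%:P + ((- M%:Z)%:~R)%:P * 'X)).
  apply: (scalerI c0'); rewrite scalerA divff // scale1r -mul_polyC.
  have /(congr1 (map_poly (intr : int -> rat))) := hE da.
  by rewrite rmorphM /= map_comp_poly rmorphD rmorphM /= !map_polyC map_polyX.
apply: irreducible_scale; first by rewrite invr_eq0.
apply: irreducible_comp_affine.
  by rewrite intr_eq0 oppr_eq0 -lt0n.
rewrite /signed_factor map_polyZ /=; apply: irreducible_scale.
  by rewrite intr_eq0 signr_eq0.
exact: hom_cyclotomic_irreducible.
Qed.

(** Primes up to B are excluded by [h_small]. A prime q > B is prime to M, so t can be chosen with
    z0 - M t divisible by q; then q would divide m, contradicting the choice of B. *)
Lemma h_fixed_divisor (e : nat) :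
  (forall t, (e%:Z %| \prod_(d <- divisors a) (h d).[t])%Z) -> e = 1%N.
Proof.
move=> eh; apply/eqP; apply: contraT => e1; exfalso.
have [q qP qe] : exists2 q, prime q & (q %| e)%N.
  case: e e1 {eh} => [|[|e]] // _; first by exists 2%N.
  by exists (pdiv e.+2); rewrite ?pdiv_prime ?pdiv_dvd.
have qh t : (q%:Z %| \prod_(d <- divisors a) (h d).[t])%Z.
  by apply: dvdz_trans (eh t); rewrite dvdzE.
have [qB|Bq] := leqP q B.
  have : ~~ (q%:Z %| \prod_(d <- divisors a) (h d).[0])%Z.
    rewrite big_seq; elim/big_ind: _ => [|x y|d].
    - by rewrite dvdzE /= dvdn1 neq_ltn prime_gt1 ?orbT.
    - by rewrite !dvdzE abszM Euclid_dvdM // negb_or => -> ->.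
    - by rewrite -dvdn_divisors // => /h_small; apply.
  by rewrite qh.
have /coprimezP[[u w] /= uw] : coprimez M%:Z q%:Z.
  rewrite coprimezE /= coprime_sym prime_coprime //; apply: contraL Bq => /M_small.
  by rewrite -leqNgt; apply.
have := dvdz_mull (\prod_(d <- divisors a) (c d)%:Z) (qh (u * z0)).
rewrite h_prod => qm; apply/negP: Bq; rewrite -leqNgt; apply: mB => //.
rewrite -[m](subrK ((z0 - M%:Z * (u * z0)) ^+ k)) rpredD //.
have k0 : (0 < k)%N by rewrite muln_gt0 a0.
rewrite -(prednK k0) exprS; apply: dvdz_mulr.
have -> : z0 - M%:Z * (u * z0) = (w * z0) * q%:Z.
  by rewrite -[X in X - _]mul1r -uw; ring.
exact: dvdz_mull.
Qed.

Hypothesis hMf : forall d, (d %| a)%N -> forall t,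
  (M%:Z %| (f d).[z0 - M%:Z * t] - g d)%Z.

(** By closeness, f_d(z0) and c_d q have the same symbols at all p <= B, and these sum to 0. Those
    of c_d sum to 0 by the product formula, as its prime factors are at most B. Those of q > B
    reduce to the one at 2, which must therefore vanish. *)
Let chi_h d t (q : nat) : (d %| a)%N -> (h d).[t] = q%:Z -> prime q -> (q %% 4 != 3)%N.
Proof.
move=> da hq qP; have Bq : (B < q)%N.
  by rewrite ltnNge; apply/negP => /(h_small t da qP); rewrite hq dvdzE dvdnn.
have chi_fc p : prime p -> (p <= B)%N ->
    chi p (f d).[z0] = chi p (c d)%:Z (+) chi p q%:Z.
  move=> pP pB; rewrite -chiM ?eqz_nat -?lt0n ?(prime_gt0 qP) //.
  rewrite -hq horner_h //; symmetry; apply: (chi_close pP (g0 da) _).2.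
  exact: dvdz_trans (pfactor_M pP pB (g0 da) (g_dvd da)) (hMf da t).
have := chif da.
rewrite (eq_bigr (fun p : 'I_B.+1 => chi p (c d)%:Z (+) chi p q%:Z)); last first.
  by move=> p pP; rewrite chi_fc // -ltnS.
rewrite big_split /= chi_product //; last first.
  move=> p pP; have /pnatP := part_pnat small (absz (g d)); rewrite part_gt0.
  by move=> /(_ isT p pP) H /H; rewrite inE.
rewrite (bigD1 (Ordinal (B2 : 2 < B.+1)%N)) //= chi_prime // orbT andbT.
rewrite big1 ?addbF; first by move->.
move=> p /andP[pP p2]; have pq : (p < q)%N by rewrite (leq_trans _ Bq).
by rewrite chi_prime // (ltn_eqF pq) -[p == 2 :> nat]/(p == Ordinal (B2 : 2 < B.+1)%N) (negPf p2) andbF.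
Qed.

Let v_close t : (M%:Z %| (m - (z0 - M%:Z * t) ^+ k) - v)%Z.
Proof.
have -> : m - (z0 - M%:Z * t) ^+ k - v = z0 ^+ k - (z0 - M%:Z * t) ^+ k.
  by rewrite /v; ring.
by rewrite subrXX opprB addrC subrK; apply: dvdz_mulr; apply: dvdz_mulr.
Qed.

(** Positivity comes from that of the primes. At a prime p <= B that is 3 mod 4, even valuation is
    the trivial symbol inherited from z0; a larger one does not divide the value, since the only
    prime factors above B are the values of the [h d]. *)
Lemma sum2sq_fixed t : (forall d, (d %| a)%N -> exists2 q : nat, prime q & (h d).[t] = q%:Z) ->
  exists x y, x ^+ 2 + y ^+ 2 = m - (z0 - M%:Z * t) ^+ k.
Proof.
move=> hq; set u := m - _.
have Du : u = (\prod_(d <- divisors a) (c d)%:Z) * \prod_(d <- divisors a) (h d).[t] by rewrite h_prod.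
have u0 : 0 < u.
  rewrite Du mulr_gt0 // big_seq; apply: prodr_gt0 => d; rewrite -dvdn_divisors //.
    by move=> _; rewrite ltz_nat.
  by move=> /hq[q qP ->]; rewrite ltz_nat prime_gt0.
rewrite (absz_pos u0); have [||x [y ->]] := @sum2sq (absz u); last by exists x, y.
  by rewrite absz_gt0 gt_eqF.
move=> p pP p3; have [pB|Bp] := leqP p B.
  have pv : ((p ^ logn p (absz v))%N%:Z * (4 * p%:Z) %| u - v)%Z.
    exact: dvdz_trans (pfactor_M pP pB v0 (dvdzz _)) (v_close t).
  have := (chi_close pP v0 pv).2; rewrite chiv // /chi p3 eqxx /=.
  by case: eqP => [p2|_ ->]; first by rewrite p2 in p3.
suff /negPf pu : ~~ (p %| absz u)%N by rewrite lognE pu !andbF.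
rewrite Du abszM Euclid_dvdM // negb_or; apply/andP; split.
- rewrite big_seq; elim/big_ind: _ => [|x y|d].
  + by rewrite dvdn1 neq_ltn prime_gt1 ?orbT.
  + by rewrite abszM Euclid_dvdM // negb_or => -> ->.
  move=> _; have /pnatP := part_pnat small (absz (g d)); rewrite part_gt0 => /(_ isT p pP) H.
  by apply: contraL Bp => /H; rewrite inE -leqNgt.
- rewrite big_seq; elim/big_ind: _ => [|x y|d].
  + by rewrite dvdn1 neq_ltn prime_gt1 ?orbT.
  + by rewrite abszM Euclid_dvdM // negb_or => -> ->.
  rewrite -dvdn_divisors // => da; have [q qP hdq] := hq d da.
  rewrite hdq dvdn_prime2 //; apply: contra_eqN p3 => /eqP->.
  exact: chi_h da hdq qP.
Qed.
End FactorPolynomials.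

Theorem schinzel_point : schinzel_hypothesis ->
  exists z x y : int, x ^+ 2 + y ^+ 2 + z ^+ k = m /\
    forall p, prime p -> (p <= B)%N -> ((p ^ N)%N%:Z %| z - z0)%Z.
Proof.
move=> schinzel; have [h hP] := choice h_exists.
have hE d da := let: And3 H _ _ := hP d da in H.
have hM d da := let: And3 _ H _ := hP d da in H.
have hMf d da := let: And3 _ _ H := hP d da in H.
pose ds := in_tuple (divisors a).
have dsP (i : 'I_(size (divisors a))) : (tnth ds i %| a)%N.
  by rewrite dvdn_divisors // mem_tnth.
have [|||t tP] := schinzel _ (fun i => h (tnth ds i)).
- by move=> i; exact: h_irreducible hE _ (dsP i).
- move=> e eP; apply: (h_fixed_divisor hE hM) => t.
  by rewrite big_tnth; exact: eP.
- move=> i K; have d0 := dvdn_gt0 a0 (dsP i); have od := dvdn_odd (dsP i) oa.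
  have [L LP] := signed_factor_pinfty n0 ob z0 d0 od (M0 : 0 < M%:Z) ((c (tnth ds i))%:Z * K).
  by exists L => t /LP; rewrite -(horner_h hE _ (dsP i)) ler_pM2l // ltz_nat.
have [|x [y xy]] := @sum2sq_fixed h hE hM hMf t.
  move=> d; rewrite dvdn_divisors // => /(tnthP ds)[i ->]; exact: tP.
exists (z0 - M%:Z * t), x, y; rewrite xy subrK; split=> // p pP pB.
rewrite addrC addKr -mulrN; apply: dvdz_mulr; rewrite dvdzE /=.
by apply: dvdn_trans (pM pP pB); rewrite dvdn_mull // dvdn_mulr.
Qed.

End SchinzelPoint.

(** * Sums of local invariants *)

Lemma ltr_odd_exp (R : realDomainType) (a : nat) (x y : R) :
  odd a -> x < y -> x ^+ a < y ^+ a.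
Proof.
move=> oa xy; have a0 : (0 < a)%N by case: a oa.
have [x0|x0] := leP 0 x; first by rewrite ltrXn2r // -lt0n.
have [y0|y0] := leP 0 y.
  by rewrite (lt_le_trans (y := 0)) ?exprn_odd_lt0 // exprn_ge0.
rewrite -[x]opprK -[y]opprK !(exprNn (- _)) -!(signr_odd _ a) oa expr1 !mulN1r ltrN2.
by rewrite ltrXn2r -?lt0n ?ltrN2 // oppr_ge0 ltW.
Qed.

Section FactorPositivity.
Variables (S : realDomainType) (k : nat) (m : int) (a b : nat) (n : int).
Hypotheses (m0 : m != 0) (oa : odd a) (kab : k = (a * b)%N) (mna : m = n ^+ a).

(** As n^a - (z^b)^a = x^2 + y^2 >= 0 and a is odd, n >= z^b. This is used over the reals and over
    the integers. *)
Lemma factor1_gt0 (P : points k m S) : factor1 b n (zcoord P) != 0 ->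
  0 < factor1 b n (zcoord P).
Proof.
rewrite lt0r /factor1 => -> /=; rewrite subr_ge0 leNgt; apply/negP => /(ltr_odd_exp oa).
apply/negP; rewrite -leNgt -exprM mulnC -kab.
have -> : n%:~R ^+ a = m%:~R :> S by rewrite mna rmorphXn.
rewrite -(pointsP P) lerDr.
by rewrite addr_ge0 ?sqr_ge0.
Qed.

Lemma factor2_gt0 (z : S) : factor1 b n z = 0 -> 0 < factor2 a b n z.
Proof.
have a0 : (0 < a)%N by case: a oa.
move=> f0; have [w ->] := factor2_mod a b n z; rewrite f0 mul0r addr0.
rewrite mulr_gt0 ?ltr0n // -rmorphXn /= ltr0z exprn_even_gt0 ?(n_neq0 m0 a0 mna) ?orbT //.
by move: oa; rewrite -[X in odd X](prednK a0).
Qed.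
End FactorPositivity.

(** With s^2 = c, send i to the diagonal matrix (s, -s) and j to the rotation by a right angle; [G]
    is the inverse map. *)
Lemma split_quaternion (R : realType) (c : R) : 0 < c ->
  split_algebra (quaternion c (- 1) : falgType R).
Proof.
move=> c0; pose s := Num.sqrt c.
have s0 : s != 0 by rewrite gt_eqF // sqrtr_gt0.
have s2 : c = s ^+ 2 by rewrite sqr_sqrtr // ltW.
pose Q := quaternion c (- 1).
pose mx (x y z t : R) : 'M[R]_2 := \matrix_(i < 2, j < 2)
  nth 0 (nth [::] [:: [:: x; y]; [:: z; t]] i) j.
pose F (q : Q) := mx (q 0 0 + s * q 0 1) (- q 0 2 - s * q 0 3)
                     (q 0 2 - s * q 0 3) (q 0 0 - s * q 0 1).
pose G (A : 'M[R]_2) : Q := quat c (- 1) ((A 0 0 + A 1 1) / 2)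
  ((A 0 0 - A 1 1) / (2 * s)) ((A 1 0 - A 0 1) / 2) (- (A 1 0 + A 0 1) / (2 * s)).
have mxP (A B : 'M[R]_2) : A 0 0 = B 0 0 -> A 0 1 = B 0 1 -> A 1 0 = B 1 0 ->
    A 1 1 = B 1 1 -> A = B.
  move=> e00 e01 e10 e11; apply/matrixP => i j.
  have h (l : 'I_2) : l = 0 \/ l = 1.
    by case: l => [[|[|l]]] //= il; [left | right]; apply: val_inj.
  by case: (h i) (h j) => -> [] ->.
have linF : linear F.
  by move=> x u v; apply: mxP; rewrite !mxE /=; ring.
have mulF : monoid_morphism F.
  split; first by apply: mxP; rewrite !mxE /=; ring.
  move=> u v; apply: mxP; rewrite !mxE !big_ord_recl big_ord0 !mxE /= ?s2; ring.
pose LF := GRing.isLinear.Build R Q 'M[R]_2 *:%R F linF.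
pose MF := GRing.isMonoidMorphism.Build Q 'M[R]_2 F mulF.
pose phi : {lrmorphism Q -> 'M[R]_2} := HB.pack F LF MF.
exists 1%N, phi; exists G => q.
- by apply: quat_eqP; rewrite !quatE !mxE /=; field; rewrite ?s0.
- by apply: mxP; rewrite !mxE /=; field; rewrite ?s0.
Qed.

Section InvariantSum.
Variables (R : realType) (k : nat) (m : int) (a b : nat) (n : int).
Hypotheses (m0 : m != 0) (oa : odd a) (kab : k = (a * b)%N) (mna : m = n ^+ a).
Let a0 : (0 < a)%N. Proof. by case: a oa. Qed.

Lemma invariant_at_infinite (P : adelic_points R k m) : invariant_at a b n P Infinite = 0.
Proof.
rewrite /invariant_at /= /real_invariant /azumaya_fibre.
set Q := points_map _ _; rewrite asboolT //.
have [f0|f0] := eqVneq (chart1 b n (zcoord Q)) 0 => /=; apply: split_quaternion.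
  exact: (factor2_gt0 m0 oa mna f0).
exact: (factor1_gt0 oa kab mna f0).
Qed.
End InvariantSum.

Lemma sum_half (I : Type) (r : seq I) (P c : pred I) :
  \sum_(i <- r | P i) (if c i then half else 0) =
  if \big[addb/false]_(i <- r | P i) c i then half else 0.
Proof.
apply: (big_rec2 (fun x (y : bool) => x = if y then half else 0)) => //= i x y _ ->.
by case: (c i) y => [] []; rewrite ?halfD ?addr0 ?add0r.
Qed.

Lemma sum_places (F : place -> QmodZ) (B : nat) (c : nat -> bool) :
  F Infinite = 0 -> (forall p : prime_nat, (B < p)%N -> F (Defs.Finite p) = 0) ->
  (forall p : prime_nat, (p <= B)%N -> F (Defs.Finite p) = if c p then half else 0) ->
  \sum_(v \in [set: place]) F v =
  if \big[addb/false]_(p < B.+1 | prime p) c p then half else 0.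
Proof.
move=> Foo FB Fc.
pose r : seq place := [seq Defs.Finite p | p <- pmap insub (iota 0 B.+1)].
have rP p : Defs.Finite p \in r = (p < B.+1)%N.
  rewrite mem_map; last by move=> x y [].
  by rewrite mem_pmap_sub mem_iota.
rewrite -(fsbig_widen [set` r]) //; last first.
  move=> [|p] [_] /=; first by rewrite Foo.
  by move=> /negP; rewrite rP -leqNgt => /FB.
rewrite -fsbig_seq; last first.
  by rewrite map_inj_uniq ?pmap_sub_uniq ?iota_uniq // => x y [].
rewrite big_map big_pmap -[iota 0 _]/(index_iota 0 B.+1) big_mkord /= -sum_half [RHS]big_mkcond.
apply: eq_bigr => i _; case: insubP => [p _ pi|/negPf->] //=; rewrite -pi prime_valP.
by rewrite Fc // -ltnS pi.
Qed.

Lemma sum_half_eq0 (c : bool) : (if c then half else 0) = 0 -> c = false.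
Proof. by case: c => // h; have := half_neq0; rewrite h eqxx. Qed.

Lemma invariant_at_finite (R : realType) (k : nat) (m : int) a b n (P : adelic_points R k m)
  (p : prime_nat) :
  invariant_at a b n P (Defs.Finite p) = local_inv a b n (P (Defs.Finite p) : points k m (padic_int p)).
Proof. by []. Qed.

Section Reciprocity.
Variables (R : realType) (k : nat) (m : int) (a b : nat) (n : int).
Hypotheses (m0 : m != 0) (oa : odd a) (kab : k = (a * b)%N) (mna : m = n ^+ a).
Let a0 : (0 < a)%N. Proof. by case: a oa. Qed.

(** At an integral point the vanishing of n - z^b is the same at all places, so one chart serves
    everywhere and one positive integer represents all local algebras. *)
Lemma invariant_at_int (Q : points k m int) : exists2 c : int, 0 < c &
  forall p : prime_nat, invariant_at a b n (integral_to_adelic R k m Q) (Defs.Finite p) =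
    if chi p c then half else 0.
Proof.
have zE (p : prime_nat) : zcoord (integral_to_adelic R k m Q (Defs.Finite p)) = (zcoord Q)%:~R by [].
have [f0|f0] := eqVneq (factor1 b n (zcoord Q)) 0.
  have f2 := factor2_gt0 m0 oa mna f0; exists (factor2 a b n (zcoord Q)) => // p.
  rewrite invariant_at_finite.
  have [c [-> _]] := local_inv_chi m0 a0 kab mna (integral_to_adelic R k m Q (Defs.Finite p)).
  rewrite zE factor2_int padic_int_eq0 gt_eqF // => /(_ isT) H.
  by rewrite (chi_rel_int_eq H).
exists (factor1 b n (zcoord Q)); first exact: (factor1_gt0 oa kab mna f0).
move=> p.
rewrite invariant_at_finite.
have [c [-> + _]] := local_inv_chi m0 a0 kab mna (integral_to_adelic R k m Q (Defs.Finite p)).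
rewrite zE factor1_int padic_int_eq0 f0 => /(_ isT) H.
by rewrite (chi_rel_int_eq H).
Qed.

Lemma brauer_set_int (Q : points k m int) : brauer_set a b n (integral_to_adelic R k m Q).
Proof.
have [c c0 cP] := invariant_at_int Q; pose B := maxn 2 (absz c).
have cB p : prime p -> (p %| absz c)%N -> (p <= B)%N.
  by move=> _ pc; rewrite leq_max (dvdn_leq _ pc) ?orbT // absz_gt0 gt_eqF.
rewrite /brauer_set /= (@sum_places _ B (chi^~ c)).
- by rewrite (absz_pos c0) chi_product ?leq_maxl // absz_gt0 gt_eqF.
- exact: (invariant_at_infinite m0 oa kab mna).
- move=> p Bp; rewrite cP /chi; case: eqP => p2.
    by move: Bp; rewrite p2 /B; case: (2 <= absz c)%N; lia.
  rewrite lognE; case: and3P => [[pP _ /(cB _ pP)]|]; last by rewrite andbF.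
  by rewrite leqNgt Bp.
- by move=> p _.
Qed.

Lemma invariant_at_good (P : adelic_points R k m) (p : prime_nat) :
  (2 * a * absz m < p)%N -> invariant_at a b n P (Defs.Finite p) = 0.
Proof.
move=> mp; apply: (local_inv_good m0 a0 kab mna).
rewrite dvdzE abszM absz_nat; apply: contraL mp => /dvdn_leq.
by rewrite -leqNgt; apply; rewrite !muln_gt0 a0 absz_gt0 m0.
Qed.
End Reciprocity.

Lemma crt_primes (B : nat) (L : nat -> nat) (c : nat -> int) : exists z : int,
  forall p, prime p -> (p <= B)%N -> ((p ^ L p)%N%:Z %| z - c p)%Z.
Proof.
elim: B => [|B [z IH]]; first by exists 0 => p pP; rewrite leqn0 => /eqP p0; rewrite p0 in pP.
have [pB|npB] := boolP (prime B.+1); last first.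
  exists z => p pP; rewrite leq_eqVlt => /orP[/eqP pB|]; last exact: IH.
  by rewrite -pB pP in npB.
pose M := (\prod_(p < B.+1 | prime p) p ^ L p)%N.
have co : coprimez M%:Z (B.+1 ^ L B.+1)%N%:Z.
  rewrite coprimezE /= coprimeXr // coprime_sym.
  apply: (big_ind (coprime B.+1)) => [|x y xc yc|p pP].
  - by rewrite coprimen1.
  - by rewrite coprimeMr xc.
  rewrite coprimeXr // prime_coprime // dvdn_prime2 //.
  by rewrite gtn_eqF.
exists (zchinese M%:Z (B.+1 ^ L B.+1)%N%:Z z (c B.+1)) => p pP.
rewrite leq_eqVlt => /orP[/eqP->|pB'].
  by rewrite -eqz_mod_dvd; apply/eqP; apply: zchinese_modr.
have pM : ((p ^ L p)%N%:Z %| M%:Z)%Z.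
  by rewrite dvdzE /= /M (bigD1 (Ordinal pB')) //= dvdn_mulr.
rewrite -[X in X - _](subrK z) -addrA rpredD ?IH //.
apply: dvdz_trans pM _.
by rewrite -eqz_mod_dvd; apply/eqP; apply: zchinese_modl.
Qed.

Lemma chi_prod (I : Type) (r : seq I) (F : I -> int) (p : nat) : prime p ->
  \prod_(i <- r) F i != 0 ->
  chi p (\prod_(i <- r) F i) = \big[addb/false]_(i <- r) chi p (F i).
Proof.
move=> pP; elim: r => [|i r IHr]; first by rewrite !big_nil chi1.
by rewrite !big_cons mulf_eq0 negb_or => /andP[Fi Fr]; rewrite chiM ?IHr.
Qed.

(** * Approximating a point of the Brauer-Manin set by integral points *)

Section Approximation.
Variables (R : realType) (k : nat) (m : int) (P : adelic_points R k m).
Hypotheses (ok : odd k) (m0 : m != 0) (PB : brauer_manin_set R k m P).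
Let k0 : (0 < k)%N. Proof. by case: k ok. Qed.

Section MaximalPower.
Variables (a b : nat) (n : int).
Hypotheses (a0 : (0 < a)%N) (b0 : (0 < b)%N) (kab : k = (a * b)%N) (mna : m = n ^+ a).

(** For this decomposition of k and m, the first chart is n^e - z^(be), the product of the f_d(z)
    over d | e. *)
Let ediv e : (e %| a)%N ->
  [/\ (0 < a %/ e)%N, (0 < b * e)%N, k = (a %/ e * (b * e))%N & m = (n ^+ e) ^+ (a %/ e)].
Proof.
move=> ea; have e0 := dvdn_gt0 a0 ea; have ea' : (a %/ e * e = a)%N by rewrite divnK.
split; rewrite ?muln_gt0 ?b0 //; first by rewrite divn_gt0 // dvdn_leq.
  by rewrite mulnCA ea' mulnC.
by rewrite -exprM mulnC ea'.
Qed.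

(** There are finitely many divisors e of a, so the maximum of their precisions and N gives one
    residue class that serves all conditions. *)
Lemma local_approximation (p : prime_nat) (N : nat) : exists Lc : nat * int,
  forall z : int, ((p ^ Lc.1)%N%:Z %| z - Lc.2)%Z ->
  [/\ (z%:~R : padic_int p) N = zcoord (P (Defs.Finite p)) N,
      m - z ^+ k != 0, chi p (m - z ^+ k) = false &
      forall e, (e %| a)%N -> invariant_at (a %/ e) (b * e) (n ^+ e) P (Defs.Finite p) =
        if chi p (n ^+ e - z ^+ (b * e)) then half else 0].
Proof.
pose Pp : points k m (padic_int p) := P (Defs.Finite p).
have h e : exists Ne, (e %| a)%N -> forall z : int, (z%:~R : padic_int p) Ne = zcoord Pp Ne ->
    m - z ^+ k != 0 -> chi p (m - z ^+ k) = false ->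
    local_inv (a %/ e) (b * e) (n ^+ e) Pp = if chi p (factor1 (b * e) (n ^+ e) z) then half else 0.
  have [ea|] := boolP (e %| a)%N; last by exists 0%N.
  have [a'0 b'0 kab' mna'] := ediv ea.
  have [Ne HNe] := local_inv_int m0 a'0 kab' mna' Pp; exists Ne => _ z zNe zm0 zm.
  by apply: HNe; rewrite // -mna' -kab'.
have [f fP] := choice h; pose N' := maxn N (\max_(e < a.+1) f e).
have [L [c Lc]] := local_sum2sq_approx m0 k0 Pp N'.
exists (L, c) => z /Lc[zN' zm0 zm].
have down i : (i <= N')%N -> (z%:~R : padic_int p) i = zcoord Pp i.
  move=> iN; rewrite -(padic_seq_small _ i) -(padic_seq_small (zcoord Pp) i).
  by rewrite -!(padic_seq_le _ iN) zN'.
split=> //; first by rewrite down ?leq_maxl.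
move=> e ea; rewrite invariant_at_finite (fP e ea z) /factor1 ?intz // down //.
have ea1 : (e < a.+1)%N by rewrite ltnS dvdn_leq.
by rewrite leq_max (leq_bigmax (Ordinal ea1)) orbT.
Qed.

(** The Brauer conditions say that the sum of [X d] over d | e is 0 for each e | a; strong induction
    on the divisor then isolates each [X d]. *)
Lemma brauer_chi (B : nat) (z0 : int) : (2 * a * absz m <= B)%N -> n != 0 -> odd a -> odd b ->
  m - z0 ^+ k != 0 ->
  (forall (p : prime_nat) e, (p <= B)%N -> (e %| a)%N ->
     invariant_at (a %/ e) (b * e) (n ^+ e) P (Defs.Finite p) =
     if chi p (n ^+ e - z0 ^+ (b * e)) then half else 0) ->
  forall d, (d %| a)%N ->
  \big[addb/false]_(p < B.+1 | prime p) chi p (signed_factor b n d).[z0] = false.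
Proof.
move=> mB n0 oa ob z0m inv.
set X := fun d => \big[addb/false]_(p < B.+1 | prime p) chi p (signed_factor b n d).[z0].
have Xe e : (e %| a)%N -> \big[addb/false]_(d <- divisors e) X d = false.
  move=> ea; have [a'0 b'0 kab' mna'] := ediv ea; have e0 := dvdn_gt0 a0 ea.
  have oa' : odd (a %/ e) by apply: dvdn_odd oa; rewrite dvdn_div.
  rewrite exchange_big /=.
  rewrite -[RHS](_ : \big[addb/false]_(p < B.+1 | prime p)
                       chi p (n ^+ e - z0 ^+ (b * e)) = _).
    apply: eq_bigr => p pP; rewrite mulnC -(signed_factor_prod b n0 z0 e0) chi_prod //.
    rewrite (signed_factor_prod b n0 z0 e0); apply: contraNneq z0m => nz.
    by rewrite mna' kab' mulnC exprM (mulnC b) subrXX nz mul0r.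
  apply: sum_half_eq0; have := PB a'0 b'0 kab' mna'.
  rewrite /brauer_set /= (@sum_places _ B (fun p => chi p (n ^+ e - z0 ^+ (b * e)))) //.
  - exact: (invariant_at_infinite m0 oa' kab' mna').
  - move=> p Bp; apply: (invariant_at_good m0 oa' kab' mna').
    apply: leq_ltn_trans Bp; apply: leq_trans mB.
    by rewrite leq_mul // leq_mul // leq_div.
  - by move=> p pB; exact: inv.
elim/ltn_ind => d IHd da; have d0 := dvdn_gt0 a0 da.
have := Xe d da; rewrite (bigD1_seq d) ?divisors_uniq -?dvdn_divisors //=.
rewrite big_seq_cond big1 ?addbF // => e; rewrite -dvdn_divisors // => /andP[ed ned].
by apply: IHd; [rewrite ltn_neqAle ned dvdn_leq | exact: dvdn_trans ed da].
Qed.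
End MaximalPower.

Lemma integral_approximation (N : nat) : schinzel_hypothesis -> exists Q : points k m int,
  forall p : prime_nat, (p <= N)%N ->
  ((zcoord Q)%:~R : padic_int p) N = zcoord (P (Defs.Finite p)) N.
Proof.
move=> schinzel; have [a [b [n [a0 b0 kab mna npp]]]] := maximal_power k0 m0.
have oab : odd (a * b) by rewrite -kab.
have /andP[oa ob] : odd a && odd b by rewrite -oddM.
(* Large enough to include 2, the primes where approximation is required, those dividing m, and all
   those where some invariant may be nonzero. *)
pose B := (2 + N + 2 * a * absz m)%N.
have h (p : nat) : exists Lc : nat * int, forall (pP : prime p) (z : int),
    ((p ^ Lc.1)%N%:Z %| z - Lc.2)%Z ->
    [/\ (z%:~R : padic_int (PrimeNat pP)) N = zcoord (P (Defs.Finite (PrimeNat pP))) N,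
      m - z ^+ k != 0, chi p (m - z ^+ k) = false &
      forall e, (e %| a)%N -> invariant_at (a %/ e) (b * e) (n ^+ e) P (Defs.Finite (PrimeNat pP)) =
        if chi p (n ^+ e - z ^+ (b * e)) then half else 0].
  have [pP|npP] := pselect (prime p); last by exists (0%N, 0) => pP; case: npP.
  have [Lc LcP] := local_approximation a0 b0 kab mna (PrimeNat pP) N.
  by exists Lc => pP' z /LcP; rewrite (bool_irrelevance pP' pP).
have [Lc LcP] := choice h.
have [z0 z0P] := crt_primes B (fun p => (Lc p).1) (fun p => (Lc p).2).
have z0m : m - z0 ^+ k != 0.
  have [] // := LcP 2%N isT z0; exact: z0P.
have [||||||z [x [y [xyz zz0]]]] := @schinzel_point a b n B N z0 _ oab npp _ _ _ _ _ schinzel.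
- exact: n_neq0 m0 a0 mna.
- by rewrite /B -addnA leq_addr.
- move=> p pP; rewrite -mna dvdzE /= => pm; apply: (@leq_trans (absz m)).
    by rewrite dvdn_leq // absz_gt0.
  by rewrite /B (leq_trans _ (leq_addl _ _)) // leq_pmull // muln_gt0.
- by rewrite -mna -kab.
- by move=> p pP pB; rewrite -mna -kab; case: (LcP p pP z0 (z0P p pP pB)).
- apply: (brauer_chi a0 b0 kab mna) => //.
  + exact: leq_addl.
  + exact: n_neq0 m0 a0 mna.
  move=> [p pP] e pB ea; have [_ _ _] := LcP p pP z0 (z0P p pP pB); exact.
have xyz' : (x, y, z).1.1 ^+ 2 + (x, y, z).1.2 ^+ 2 + (x, y, z).2 ^+ k == m%:~R :> int.
  by rewrite intz mna kab /= xyz.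
exists (Sub (x, y, z) xyz') => p pN; rewrite /zcoord SubK /=.
have pB : (p <= B)%N by rewrite (leq_trans pN) // /B -addnA addnCA leq_addr.
have [+ _ _ _] := LcP p (prime_valP p) z0 (z0P p (prime_valP p) pB).
have -> : PrimeNat (prime_valP p) = p by case: (p).
move=> <-; rewrite !padic_intE; apply/eqP; rewrite eqz_mod_dvd.
exact: zz0 (prime_valP p) pB.
Qed.
End Approximation.

(** * The adelic topology *)

Local Open Scope classical_set_scope.
Local Open Scope ring_scope.

Lemma nbhs_indiscrete (T : choiceType) (x : indiscrete T) (A : set (indiscrete T)) :
  nbhs x A -> A = setT.
Proof.
rewrite nbhsE => -[B [Bop Bx] BA]; apply/seteqP; split=> // y _; apply: BA.
by case: Bop Bx => [->|->].
Qed.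

Section AdelicTopology.
Variables (R : realType) (k : nat) (m : int).
Local Notation adelic := (adelic_points R k m).

Lemma padic_ball_seq (p : prime_nat) (x y : padic_int p) (N : nat) :
  (exists t : padic_int p, tofrac y = tofrac x + p%:R ^+ N * tofrac t) <-> y N = x N.
Proof.
have tofpN (t : padic_int p) : p%:R ^+ N * tofrac t = tofrac (p%:R ^+ N * t).
  by rewrite rmorphM rmorphXn rmorph_nat.
split=> [[t]|/padic_eq_seq[t yx]]; last first.
  by exists t; rewrite tofpN -yx rmorphB /= addrC subrK.
rewrite tofpN -rmorphD => /tofrac_inj ->; apply/padic_eq_seq.
by exists t; rewrite addrC addKr.
Qed.

Lemma nbhs_adelic1 (P : adelic) (p : prime_nat) (N : nat) :
  nbhs P [set Q : adelic | zcoord (Q (Defs.Finite p)) N = zcoord (P (Defs.Finite p)) N].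
Proof.
pose v := Defs.Finite p.
have c1 : (fun Q : adelic => Q v) @ P --> P v by apply: (@proj_continuous _ (@local_points R k m)).
have c2 := @initial_continuous _ _ (@to_affine_space R k m v) (P v).
have c3 : snd @ (nbhs (to_affine_space (P v))) --> (to_affine_space (P v)).2 by exact: cvg_snd.
have := cvg_comp _ _ (cvg_comp _ _ c1 c2) c3.
move=> /(_ [set y | exists t : padic_int p, y = tofrac (zcoord (P v)) + p%:R ^+ N * tofrac t]) H.
have {}H := H (ex_intro2 _ _ N I (fun y h => h)).
change (nbhs P [set Q : adelic | exists t : padic_int p,
  tofrac (zcoord (Q v)) = tofrac (zcoord (P v)) + p%:R ^+ N * tofrac t]) in H.
by apply: filterS H => Q /padic_ball_seq.
Qed.

Lemma nbhs_adelic (P : adelic) (B : nat) (N : prime_nat -> nat) :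
  nbhs P [set Q : adelic | forall p : prime_nat, (p <= B)%N ->
    zcoord (Q (Defs.Finite p)) (N p) = zcoord (P (Defs.Finite p)) (N p)].
Proof.
pose A := fun j => [set Q : adelic | forall p : prime_nat, p = j :> nat ->
    zcoord (Q (Defs.Finite p)) (N p) = zcoord (P (Defs.Finite p)) (N p)].
have nA j : nbhs P (A j).
  have [jP|njP] := pselect (prime j); last first.
    by apply: filterS (filterT) => Q _ p pj; case: njP; rewrite -pj prime_valP.
  apply: filterS (nbhs_adelic1 P (PrimeNat jP) (N (PrimeNat jP))) => Q h p pj.
  by have -> : p = PrimeNat jP by exact: val_inj.
have : nbhs P (\big[setI/setT]_(j < B.+1) A j).
  by elim/big_ind: _ => //; [exact: filterT | move=> x y; exact: filterI].
apply: filterS => Q + p pB; rewrite -bigcap_mkord => /(_ p); apply => //.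
Qed.

(** The coordinates X, Y and the whole real component are indiscrete, so only the digits of the
    Z-coordinates at finite places matter. *)
Lemma cvg_adelic (u : nat -> adelic) (P : adelic) :
  (forall (p : prime_nat) N, \forall n \near \oo,
     zcoord (u n (Defs.Finite p)) N = zcoord (P (Defs.Finite p)) N) ->
  u @ \oo --> P.
Proof.
move=> h; apply/cvg_sup => v A /= [_ [[B Bop <-] BP sBA]].
have [C Cop CB] := Bop.
have {BP} CP : C (to_affine_space (P v)) by move: BP; rewrite -CB.
have : nbhs (to_affine_space (P v)) C by apply: open_nbhs_nbhs.
case=> -[D E] [/= [[D1 D2] [/= /nbhs_indiscrete D1T /nbhs_indiscrete D2T] D12] nE] DEC.
have : \forall n \near \oo, E (to_affine_space (u n v)).2.
  move: nE; clear -h; case: v E => [|p] E nE.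
    by move/nbhs_indiscrete: nE => ->; apply: filterS filterT.
  case: nE => N _ NE; apply: filterS (h p N) => n e; apply: NE.
  exact/padic_ball_seq.
apply: filterS => n En; apply: sBA => /=; rewrite -CB; apply: DEC; split=> //=.
by apply: D12; rewrite D1T D2T.
Qed.
End AdelicTopology.

Theorem theorem5p4 (R : realType) (k : nat) (m : int) :
  (3 <= k)%N -> odd k -> m != 0 ->
  schinzel_hypothesis ->
  closure (range (integral_to_adelic R k m)) = brauer_manin_set R k m.
Proof.
move=> k3 ok m0 schinzel; apply/seteqP; split=> P.
  move=> PC a b n a0 b0 kab mna.
  have oa : odd a by move: ok; rewrite kab oddM => /andP[].
  have h (p : prime_nat) := local_inv_stable m0 a0 kab mna (P (Defs.Finite p)).
  have [N NP] := choice h.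
  have [_ [[Q _ <-] QP]] := PC _ (nbhs_adelic P (2 * a * absz m) N).
  have := brauer_set_int R m0 oa kab mna Q; rewrite /brauer_set /=.
  (* Up to 2 a |m|, Q is so close to P that the invariants agree; at the other places both vanish.
     So P inherits the condition from Q. *)
  suff -> : invariant_at a b n (integral_to_adelic R k m Q) = invariant_at a b n P by [].
  apply/funext => -[|p]; first by rewrite !(invariant_at_infinite m0 oa kab mna).
  have [pB|Bp] := leqP p (2 * a * absz m); last by rewrite !(invariant_at_good m0 oa kab mna).
  by rewrite !invariant_at_finite; apply: NP; exact: QP.
move=> PB A nA.
have h N := @integral_approximation R k m P ok m0 PB N schinzel.
have [Q QP] := choice h.
suff : (fun N => integral_to_adelic R k m (Q N)) @ \oo --> P.
  move=> /(_ A nA) [N _ NA]; exists (integral_to_adelic R k m (Q N)).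
  by split; [exists (Q N) | apply: NA; exact: leqnn].
(* The point [Q i] approximates only at primes up to i and only to i digits, so i has to reach both
   p and N. *)
apply: cvg_adelic => p N; exists (maxn p N) => // i /=; rewrite geq_max => /andP[pi Ni].
rewrite -(padic_seq_small _ N) -[RHS]padic_seq_small.
by rewrite -!(padic_seq_le _ Ni) -QP.
Qed.
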